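(* For every constant $\alpha>0$ there is a constant $c>0$ such that the following holds for all integers $k\ge 3$ and $n\ge 1$: if $G$ is an $n$-vertex outerplane graph having at least $\alpha\, n/k$ internal faces of size $k$, then every internally-strictly-convex grid drawing of $G$ has area at least $c\,n k^{2}$. (That is, every $n$-vertex outerplane graph with $\Omega(n/k)$ internal faces of size $k$ requires $\Omega(nk^2)$ area in any internally-strictly-convex grid drawing.)
   Context: A graph is outerplanar if it admits a planar drawing in which every vertex is incident to the outer face; an outerplane graph is an outerplanar graph equipped with an outerplanar embedding (a combinatorial equivalence class, given by rotation systems and outer-face boundary order, of planar drawings with all vertices on the outer face). Its internal faces are the bounded faces of this embedding; the size of a face is the number of vertices on its boundary. A grid drawing maps vertices to distinct integer points. An internally-strictly-convex drawing is a planar straight-line drawing (edges are segments, no two edges intersect except at common endpoints) in which every internal (bounded) face is bounded by a polygon all of whose internal angles are strictly smaller than $180^\circ$; the drawing is not required to respect the given embedding. For a grid drawing $\Gamma$, width $=\max_x(\Gamma)-\min_x(\Gamma)+1$, height $=\max_y(\Gamma)-\min_y(\Gamma)+1$ (extremes of vertex coordinates), and area $=$ width $\times$ height. *)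

(* Defs.v *)
From HB Require Import structures.
From mathcomp Require Import all_boot all_order all_fingroup all_algebra.
From mathcomp Require Import all_classical all_reals all_analysis.
From mathcomp Require Import Rstruct Rstruct_topology.
From Stdlib Require Import Rdefinitions.
Set Implicit Arguments. Unset Strict Implicit. Unset Printing Implicit Defensive.
Import Order.TTheory GRing.Theory Num.Theory.
Local Open Scope classical_set_scope.
Local Open Scope ring_scope.

Definition point := (R * R)%type.

Definition simple_graph n (e : rel 'I_n) : Prop :=
  (forall u v, e u v = e v u) /\ (forall u, ~~ e u u).

(* ---------- outerplane graphs (combinatorial outerplanar embeddings) ------
   An outerplanar embedding is encoded, as usual, by the cyclic order
   [sigma] in which the vertices are met along the outer face: vertex [v]
   sits at position [sigma v] on a circle, edges are chords, and the
   embedding is outerplanar iff no two edges cross. *)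

Definition chords_cross (a b c d : nat) : bool :=
  let a' := minn a b in let b' := maxn a b in
  let c' := minn c d in let d' := maxn c d in
  [|| [&& ltn a' c', ltn c' b' & ltn b' d'] | [&& ltn c' a', ltn a' d' & ltn d' b']].

Definition outerplane n (e : rel 'I_n) (sigma : {perm 'I_n}) : Prop :=
  simple_graph e /\
  forall u v x y, e u v -> e x y ->
    ~~ chords_cross (sigma u) (sigma v) (sigma x) (sigma y).

Definition cyc_order n (sigma : {perm 'I_n}) (S : {set 'I_n}) : seq 'I_n :=
  sort (fun u v => leq (sigma u) (sigma v)) (enum S).

(* S is the vertex set of an internal face of the outerplane graph (e,sigma):
   listed in outer-face order, cyclically consecutive vertices are adjacent
   (S bounds a cycle) and there is no other edge inside S (no chord), so the
   cycle bounds a face of the embedding; its size is #|S|. *)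
Definition internal_face n (e : rel 'I_n) (sigma : {perm 'I_n})
    (S : {set 'I_n}) : Prop :=
  let c := cyc_order sigma S in
  leq 3 #|S| /\
  (forall u, u \in S -> e u (next c u)) /\
  (forall u v, u \in S -> v \in S -> e u v -> v = next c u \/ u = next c v).

Definition num_internal_faces_of_size n (e : rel 'I_n) (sigma : {perm 'I_n})
    (k : nat) : nat :=
  #|[set S : {set 'I_n} | `[< internal_face e sigma S >] && (#|S| == k)]|.

Definition grid_drawing n (G : 'I_n -> int * int) : Prop := injective G.

Definition pt n (G : 'I_n -> int * int) (v : 'I_n) : point :=
  (((G v).1)%:~R, ((G v).2)%:~R).

Definition segment (a b : point) : set point :=
  [set p | exists t : R, 0 <= t <= 1 /\
     p = ((1 - t) * a.1 + t * b.1, (1 - t) * a.2 + t * b.2)].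

Definition edge_seg n (G : 'I_n -> int * int) (u v : 'I_n) : set point :=
  segment (pt G u) (pt G v).

Definition planar_straight_line n (e : rel 'I_n) (G : 'I_n -> int * int)
    : Prop :=
  (forall u v x y p, e u v -> e x y ->
     ~ ((u = x /\ v = y) \/ (u = y /\ v = x)) ->
     edge_seg G u v p -> edge_seg G x y p ->
     exists w, p = pt G w /\ (w = u \/ w = v) /\ (w = x \/ w = y)) /\
  (forall w u v, e u v -> edge_seg G u v (pt G w) -> w = u \/ w = v).

Definition drawn n (e : rel 'I_n) (G : 'I_n -> int * int) : set point :=
  [set p | (exists v, p = pt G v) \/
           (exists u v, e u v /\ edge_seg G u v p)].

Definition face n (e : rel 'I_n) (G : 'I_n -> int * int) (F : set point)
    : Prop :=
  exists x, (~` drawn e G) x /\ F = connected_component (~` drawn e G) x.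

Definition bounded_set (F : set point) : Prop :=
  exists M : R, forall p, F p -> `|p.1| <= M /\ `|p.2| <= M.

Definition conv_hull (P : set point) : set point :=
  [set p | exists (m : nat) (q : 'I_m -> point) (l : 'I_m -> R),
     (forall i, P (q i)) /\ (forall i, 0 <= l i) /\ \sum_(i < m) l i = 1 /\
     p = (\sum_(i < m) l i * (q i).1, \sum_(i < m) l i * (q i).2)].

(* F is bounded by a polygon all of whose internal angles are < 180 degrees:
   the drawn vertices on the closure of F are exactly the corners of a
   strictly convex polygon (none lies in the hull of the others) and F is
   the interior of that polygon. *)
Definition strictly_convex_face n (G : 'I_n -> int * int) (F : set point)
    : Prop :=
  let P := [set v : 'I_n | closure F (pt G v)] in
  F = interior (conv_hull [set p | exists2 v, P v & p = pt G v]) /\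
  forall v, P v ->
    ~ conv_hull [set p | exists2 w, P w /\ w <> v & p = pt G w] (pt G v).

Definition internally_strictly_convex n (e : rel 'I_n)
    (G : 'I_n -> int * int) : Prop :=
  planar_straight_line e G /\
  forall F, face e G F -> bounded_set F -> strictly_convex_face G F.

Definition coord_span (s : seq int) : int :=
  match s with
  | [::] => 0
  | x :: t => foldr Num.max x t - foldr Num.min x t + 1
  end.

Definition width n (G : 'I_n -> int * int) : int :=
  coord_span [seq (G v).1 | v <- enum 'I_n].
Definition height n (G : 'I_n -> int * int) : int :=
  coord_span [seq (G v).2 | v <- enum 'I_n].
Definition area n (G : 'I_n -> int * int) : int := width G * height G.

(* Main.v *)
Require Import Defs.
From mathcomp Require Import all_boot all_order all_fingroup all_algebra.
From mathcomp Require Import all_classical all_reals all_analysis.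
From mathcomp Require Import Rstruct Rstruct_topology.
From mathcomp Require Import ring lra zify.
From Stdlib Require Import Rdefinitions.
Set Implicit Arguments. Unset Strict Implicit. Unset Printing Implicit Defensive.
Import Order.TTheory GRing.Theory Num.Theory numFieldNormedType.Exports.
Local Open Scope ring_scope.

(** Every internal face of the outerplane graph is drawn as a bounded face. Indeed the boundary of a
    bounded face is a strictly convex polygon without chords, hence an internal face in the circular
    order. Given an internal face [S], start from a point inside the polygon drawn for [S] (inside:
    odd crossing number), and consider the bounded face around it. If its vertex set is not [S], cross
    one of its edges that is not an edge of [S]: one stays inside [S], hence in a bounded face, and
    the edge can be chosen so that the new face lies beyond it in the circular order, so that the
    process stops.

    A strictly convex lattice polygon with [k] vertices contains a lattice triangle of area at least
    a constant times [k ^ 3]: along a monotone convex chain of [m] edges inscribed in a triangle of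
    area [D / 2], affinely normalised to unit size, consecutive edges have cross product at least
    [1 / D] whereas their lengths and slope variations add up to [O(1)], and AM-GM gives [D >= c m ^ 3].

    The faces being disjoint, their areas add up to at most the area of the bounding box; areas are
    compared by counting the points of a fine grid. For bounded [k] the area is at least [n]. *)

(** * Faces in the circular order *)

(** The drawing need not respect the embedding: a priori the cycle of an internal face could be
    drawn around other parts of the graph. Only the convexity of the bounded faces excludes this,
    hence the detour through the circular order.

    Strict convexity, as assumed, says only that a bounded face is the interior of the hull of the
    vertices in its closure. That the sides of this hull are edges, and that edges between its
    vertices are sides, has to be derived from planarity.

    The Jordan curve theorem is replaced by three properties of the crossing parity of a closed
    polygon: it is constant on connected sets missing the polygon, it is even outside a large box,
    and it changes across some edge.

    Areas are compared by counting because a nondegenerate lattice triangle has double area at least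
    1: with mesh [1 / (8 * W)], where [W] is the width of the drawing, the columns counted in such a
    triangle are long enough for rounding to cost only a constant factor. *)

Definition cyc (a b c : nat) : bool :=
  ([|| (a < b) && (b < c), (b < c) && (c < a) | (c < a) && (a < b)])%nat.

Lemma cycaa (a c : nat) : (cyc a a c = false) * (cyc a c c = false) * (cyc a c a = false).
Proof. by rewrite /cyc; split; [split|]; lia. Qed.

(** Here [u] is the last vertex inside the gap from [p] to [q], and [w] is its successor. If [w] is
    not [q], it is [p] or lies in the gap before [u]; the open arc from [u] to [w] then contains
    everything from [q] on until [p], so a point off this arc and off the gap can only be [p]. The
    next lemma is the mirror image. *)
Lemma cyc_gap_last (p q u w x : nat) : cyc p u q -> ~~ cyc q w p ->
  (cyc p w q -> ~~ cyc p u w) -> w <> q -> w <> u -> ~~ cyc u x w ->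
  ~~ cyc p x q -> x = p.
Proof. by rewrite /cyc => /or3P[] /andP[h1 h2]; lia. Qed.

Lemma cyc_gap_first (p q u w x : nat) : cyc p u q -> ~~ cyc q w p ->
  (cyc p w q -> ~~ cyc p w u) -> w <> p -> w <> u -> ~~ cyc w x u ->
  ~~ cyc p x q -> x = q.
Proof. by rewrite /cyc => /or3P[] /andP[h1 h2]; lia. Qed.

Section CyclicOrder.
Local Open Scope nat_scope.
Context (T : finType) (pos : T -> nat) (N : nat) (e : rel T).
Context (pos_inj : injective pos) (pos_lt : forall v, (pos v < N)%nat).

(** Successor in circular order, as a relation rather than through [next] on a sorted list, so that
    the vertex sets of drawn faces can be handled like internal faces. *)
Definition arc_next (S : {set T}) (u v : T) : Prop :=
  [/\ u \in S, v \in S, u != v &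
      forall w, w \in S -> ~~ cyc (pos u) (pos w) (pos v)].

Definition cyc_face (S : {set T}) : Prop :=
  [/\ leq 3 #|S|, forall u v, arc_next S u v -> e u v &
      forall u v, u \in S -> v \in S -> e u v -> arc_next S u v \/ arc_next S v u].

Let dist (u v : T) : nat :=
  if leq (pos u) (pos v) then pos v - pos u else (N + pos v) - pos u.

Lemma pos_neq u v : u != v -> pos u <> pos v.
Proof. by move=> /eqP uv /pos_inj. Qed.

Lemma dist_cyc u v w : v != u -> w != u ->
  (dist u w < dist u v) = cyc (pos u) (pos w) (pos v).
Proof.
move=> /pos_neq vu /pos_neq wu; move: (pos_lt u) (pos_lt v) (pos_lt w) vu wu.
by rewrite /dist /cyc; case: ifP; case: ifP => *; lia.
Qed.

Lemma card_ge2_other (S : {set T}) u : leq 2 #|S| -> exists2 v, v \in S & v != u.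
Proof.
move=> S2; have : leq 1 #|S :\ u| by rewrite (cardsD1 u S) in S2; lia.
by move=> /card_gt0P[v] /setD1P[vu vS]; exists v.
Qed.

Lemma card_ge3_other (S : {set T}) u v : leq 3 #|S| ->
  exists w, [/\ w \in S, w != u & w != v].
Proof.
move=> S3; have S2 : leq 2 #|S :\ u| by rewrite (cardsD1 u S) in S3; lia.
by have [w /setD1P[wu wS] wv] := card_ge2_other v S2; exists w.
Qed.

Lemma arc_next_exists (S : {set T}) u : leq 2 #|S| -> u \in S -> exists v, arc_next S u v.
Proof.
move=> S2 uS; have [v0 v0S v0u] := card_ge2_other u S2.
have P0 : v0 \in S :\ u by rewrite !inE v0u v0S.
case: (arg_minnP (fun v => dist u v) P0) => v /setD1P[vu vS] vmin.
exists v; split=> //; first by rewrite eq_sym.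
move=> w wS; apply/negP => uwv.
have wu : w != u by apply: contraTneq uwv => ->; rewrite cycaa.
have wSu : w \in S :\ u by rewrite !inE wu.
by have := vmin _ wSu; rewrite leqNgt dist_cyc // uwv.
Qed.

Lemma arc_prev_exists (S : {set T}) u : leq 2 #|S| -> u \in S -> exists v, arc_next S v u.
Proof.
move=> S2 uS; have [v0 v0S v0u] := card_ge2_other u S2.
have P0 : v0 \in S :\ u by rewrite !inE v0u v0S.
case: (arg_maxnP (fun v => dist u v) P0) => v /setD1P[vu vS] vmax.
exists v; split=> //.
move=> w wS; apply/negP => uwv.
have wu : w != u by apply: contraTneq uwv => ->; rewrite cycaa.
have wSu : w \in S :\ u by rewrite !inE wu.
by have := vmax _ wSu; rewrite /= leqNgt dist_cyc //; move: uwv; clear; rewrite /cyc; lia.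
Qed.

Lemma arc_next_inj (S : {set T}) u v w : arc_next S u v -> arc_next S u w -> v = w.
Proof.
move=> [uS vS uv nv] [_ wS uw nw]; apply/eqP/negPn/negP => vw.
have := nv _ wS; have := nw _ vS.
have := pos_neq vw; have := pos_neq uv; have := pos_neq uw; rewrite /cyc; lia.
Qed.

Lemma arc_prev_inj (S : {set T}) u v w : arc_next S v u -> arc_next S w u -> v = w.
Proof.
move=> [vS uS uv nv] [wS _ uw nw]; apply/eqP/negPn/negP => vw.
have := nv _ wS; have := nw _ vS.
have := pos_neq vw; have := pos_neq uv; have := pos_neq uw; rewrite /cyc; lia.
Qed.

Lemma arc_next_asym (S : {set T}) u v : leq 3 #|S| -> arc_next S u v -> ~ arc_next S v u.
Proof.
move=> S3 [uS vS uv nv] [_ _ _ nu].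
have [w [wS wu wv]] := card_ge3_other u v S3.
have := nv _ wS; have := nu _ wS.
have := pos_neq wu; have := pos_neq uv; have := pos_neq wv; rewrite /cyc; lia.
Qed.

Lemma in_gap (S : {set T}) x v : leq 2 #|S| -> x \in S -> v \notin S ->
  exists p q, arc_next S p q /\ cyc (pos p) (pos v) (pos q).
Proof.
move=> S2 xS vS.
case: (arg_maxnP (fun u => dist v u) xS) => p pS pmax.
have [q pq] := arc_next_exists S2 pS.
exists p, q; split=> //.
case: (pq) => _ qS npq _.
have pv : p != v by apply: contraNneq vS => <-.
have qv : q != v by apply: contraNneq vS => <-.
have := pmax _ qS; rewrite /= leqNgt dist_cyc //.
have := pos_neq pv; have := pos_neq npq; have := pos_neq qv.
by rewrite /cyc; lia.
Qed.

Context (esym : symmetric e) (noncross : forall p q u v, e p q -> e u v ->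
  ~~ (cyc (pos p) (pos u) (pos q) && cyc (pos q) (pos v) (pos p))).

(** A vertex [v] of [D] outside [D'] lies in a gap [pq] of [D']. The cycle [D] cannot cross the edge
    [pq], so it leaves the gap through [p] and [q], which are therefore consecutive in [D], in the
    order [q], [p] because of [v]. Thus [D] stays between [p] and [q], whereas [x] and [y] are not
    inside the gap: they are [p] and [q], and either order is contradictory. *)
Lemma cyc_face_arc_sub D D' x y : cyc_face D -> cyc_face D' ->
  arc_next D x y -> arc_next D' x y -> D \subset D'.
Proof.
move=> [D3 De Dch] [D'3 D'e D'ch] Dxy D'xy.
apply/fintype.subsetP => v vD; apply/negPn/negP => vD'.
have [xD yD xy nD] := Dxy; have [xD' yD' _ nD'] := D'xy.
have [p [q [pq pvq]]] := in_gap (ltnW D'3) xD' vD'.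
have epq := D'e _ _ pq; have [pD' qD' npq nq] := pq.
have xo := nq _ xD'; have yo := nq _ yD'.
have pxy := pos_neq xy; have ppq := pos_neq npq.
pose inside := [set w in D | cyc (pos p) (pos w) (pos q)].
have vi : v \in inside by rewrite inE vD.
have in_neq u : u \in inside -> u != p.
  by rewrite inE => /andP[_ up]; apply: contraTneq up => ->; rewrite cycaa.
(* Were the successor of the last vertex of [D] inside the gap not [q], both [x] and [y] would be
   [p]. *)
have qD : q \in D.
  case: (arg_maxnP (fun w => dist p w) vi) => u ui umax.
  have /setIdP[uD uin] := ui.
  have [w uw] := arc_next_exists (ltnW D3) uD.
  have [_ wD nuw wn] := uw.
  have := noncross epq (De _ _ uw); rewrite uin /= => wout.
  have wi : w \in inside -> ~~ cyc (pos p) (pos u) (pos w).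
    by move=> wi; have := umax _ wi; rewrite /= leqNgt dist_cyc ?in_neq.
  case: (eqVneq w q) => [<- //|wq].
  have wiD : cyc (pos p) (pos w) (pos q) -> ~~ cyc (pos p) (pos u) (pos w).
    by move=> wpq; apply: wi; rewrite inE wD.
  have /pos_neq wu : w != u by rewrite eq_sym.
  have key x' := @cyc_gap_last _ _ _ _ (pos x') uin wout wiD (pos_neq wq) wu.
  by case: pxy; rewrite (key x (wn _ xD) xo) (key y (wn _ yD) yo).
have pD : p \in D.
  case: (arg_minnP (fun w => dist p w) vi) => u ui umin.
  have /setIdP[uD uin] := ui.
  have [w uw] := arc_prev_exists (ltnW D3) uD.
  have [wD _ nuw wn] := uw.
  have eqp : e q p by rewrite esym.
  have := noncross eqp (De _ _ uw); rewrite uin andbT => wout.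
  have wi : w \in inside -> ~~ cyc (pos p) (pos w) (pos u).
    by move=> wi; have := umin _ wi; rewrite /= leqNgt dist_cyc ?in_neq.
  case: (eqVneq w p) => [<- //|wp].
  have wiD : cyc (pos p) (pos w) (pos q) -> ~~ cyc (pos p) (pos w) (pos u).
    by move=> wpq; apply: wi; rewrite inE wD.
  have key x' := @cyc_gap_first _ _ _ _ (pos x') uin wout wiD (pos_neq wp) (pos_neq nuw).
  by case: pxy; rewrite (key x (wn _ xD) xo) (key y (wn _ yD) yo).
have [[_ _ _ /(_ _ vD)]|qpD] := Dch _ _ pD qD epq; first by rewrite pvq.
have [_ _ _ nqp] := qpD.
have xpq : x = p \/ x = q.
  case: (eqVneq x p) => [|/pos_neq xp]; first by left.
  case: (eqVneq x q) => [|/pos_neq xq]; first by right.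
  by move: (nqp _ xD) xo xp xq ppq; clear; rewrite /cyc; lia.
have ypq : y = p \/ y = q.
  case: (eqVneq y p) => [|/pos_neq yp]; first by left.
  case: (eqVneq y q) => [|/pos_neq yq]; first by right.
  by move: (nqp _ yD) yo yp yq ppq; clear; rewrite /cyc; lia.
case: xpq => xE; case: ypq => yE; subst; try by rewrite eqxx in xy.
- by have := nD _ vD; rewrite pvq.
- exact: arc_next_asym D'xy pq.
Qed.

Lemma cyc_face_arc_inj D D' x y : cyc_face D -> cyc_face D' ->
  arc_next D x y -> arc_next D' x y -> D = D'.
Proof.
move=> fD fD' Dxy D'xy; apply/eqP; rewrite finset.eqEsubset.
by rewrite (cyc_face_arc_sub fD fD' Dxy D'xy) (cyc_face_arc_sub fD' fD D'xy Dxy).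
Qed.

(** An edge [uv] with vertices of [P] on both arcs would separate them once [u] and [v] are removed,
    as no edge crosses it. So edges inside [P] join consecutive vertices, and two distinct
    neighbours of a vertex must be its successor and its predecessor. Connectivity is expressed by
    predicates closed under adjacency, which avoids paths. *)
Lemma polygon_cyc_face (P : {set T}) : 3 <= #|P| ->
  (forall u, u \in P -> exists a b, [/\ a \in P, b \in P, a != b, e u a & e u b]) ->
  (forall u v, u \in P -> v \in P -> e u v -> forall Q : pred T,
     (forall w w', w \in P :\: [set u; v] -> w' \in P :\: [set u; v] ->
        e w w' -> Q w -> Q w') ->
     forall w w', w \in P :\: [set u; v] -> w' \in P :\: [set u; v] -> Q w -> Q w') ->
  (forall u, ~~ e u u) ->
  cyc_face P.
Proof.
move=> P3 nbr conn irr.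
have consec u v : u \in P -> v \in P -> e u v -> arc_next P u v \/ arc_next P v u.
  move=> uP vP euv.
  have uv : u != v by apply: contraTneq euv => ->.
  have evu : e v u by rewrite esym.
  case: (pickP [pred w in P | cyc (pos u) (pos w) (pos v)]) => [w /andP[wP uwv]|nw]; last first.
    by left; split=> // w wP; have := nw w; rewrite /= wP /= => ->.
  case: (pickP [pred w in P | cyc (pos v) (pos w) (pos u)]) => [w' /andP[w'P vwu]|nw']; last first.
    by right; split=> //; [rewrite eq_sym | move=> w' w'P; have := nw' w'; rewrite /= w'P /= => ->].
  have outP z : z \in P :\: [set u; v] ->
      [/\ z \in P, pos z <> pos u & pos z <> pos v].
    rewrite !inE negb_or => /andP[/andP[zu zv] zP].
    by split=> //; apply: pos_neq.
  have wD : w \in P :\: [set u; v].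
    rewrite !inE wP andbT negb_or; apply/andP.
    by split; apply: contraTneq uwv => ->; rewrite cycaa.
  have w'D : w' \in P :\: [set u; v].
    rewrite !inE w'P andbT negb_or; apply/andP.
    by split; apply: contraTneq vwu => ->; rewrite cycaa.
  have := conn u v uP vP euv (fun z => cyc (pos u) (pos z) (pos v)) _ w w' wD w'D uwv.
  have step : forall z z', z \in P :\: [set u; v] -> z' \in P :\: [set u; v] ->
      e z z' -> cyc (pos u) (pos z) (pos v) -> cyc (pos u) (pos z') (pos v).
    move=> z z' /outP[_ zu zv] /outP[_ z'u z'v] ezz' uzv.
    have := noncross euv ezz'; rewrite uzv /=.
    by move: z'u z'v (pos_neq uv); clear; rewrite /cyc; lia.
  by move=> /(_ step); move: vwu; clear; rewrite /cyc; lia.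
split=> // u v uv; have [uP vP _ _] := uv.
have [a [b [aP bP ab ea eb]]] := nbr u uP.
have [ua|au] := consec _ _ uP aP ea; first by rewrite (arc_next_inj uv ua).
have [ub|bu] := consec _ _ uP bP eb; first by rewrite (arc_next_inj uv ub).
by rewrite (arc_prev_inj au bu) eqxx in ab.
Qed.

Definition pos_span (D : {set T}) : nat := \max_(u in D) \max_(v in D) (pos v - pos u).

(** This is the decreasing measure of the walk across edges: [D'] lies on the other side of [xy],
    hence between the positions of [x] and [y], while a third vertex of [D] is outside this
    range. *)
Lemma pos_span_lt D D' x y : cyc_face D -> cyc_face D' -> D <> D' ->
  arc_next D x y -> pos x < pos y -> x \in D' -> y \in D' -> e x y ->
  pos_span D' < pos_span D.
Proof.
move=> fD fD' DD' Dxy xy xD' yD' exy.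
have [_ _ D'ch] := fD'; have [D3 _ _] := fD.
have [D'xy|[_ _ _ nyx]] := D'ch _ _ xD' yD' exy.
  by case: DD'; apply: cyc_face_arc_inj Dxy D'xy.
have [xD yD _ nxy] := Dxy.
have [w [wD /pos_neq wx /pos_neq wy]] := card_ge3_other x y D3.
have D'in z : z \in D' -> pos x <= pos z <= pos y.
  by move=> /nyx; move: xy; clear; rewrite /cyc; lia.
apply: (@leq_ltn_trans (pos y - pos x)).
  apply/bigmax_leqP => u /D'in uD'; apply/bigmax_leqP => v /D'in vD'.
  by move: uD' vD'; clear; lia.
have ge u v : u \in D -> v \in D -> pos v - pos u <= pos_span D.
  move=> uD vD; apply: (leq_trans _ (leq_bigmax_cond _ uD)).
  exact: (leq_bigmax_cond (F := fun v => pos v - pos u)).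
have := nxy _ wD; have := ge _ _ xD wD; have := ge _ _ wD yD.
by move: xy wx wy; clear; rewrite /cyc; lia.
Qed.

(** The first vertex [u0] of [D] and its two successors give two sides with increasing positions. If
    [u2] is in [C], it prevents [u1 u0] from being a directed side of [C], and [u0 u1] cannot be one
    without [C = D]; otherwise [u1 u2] has an end outside [C]. *)
Lemma child_edge C D : cyc_face C -> cyc_face D -> C <> D ->
  exists x y, [/\ arc_next D x y, pos x < pos y, ~ arc_next C x y & ~ arc_next C y x].
Proof.
move=> fC fD CD; have [D3 _ _] := fD.
have [v0 v0D] : exists v, v \in D by apply/card_gt0P; apply: leq_trans D3.
case: (arg_minnP pos v0D) => u0 u0D u0min.
have [u1 u01] := arc_next_exists (ltnW D3) u0D.
have [_ u1D /pos_neq p01 n01] := u01.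
have [u2 u12] := arc_next_exists (ltnW D3) u1D.
have [_ u2D /pos_neq p12 n12] := u12.
have p20 : pos u2 <> pos u0.
  move=> /pos_inj u20; move: u12; rewrite u20; exact: arc_next_asym.
have l01 : pos u0 < pos u1 by have := u0min _ u1D; move: p01; clear; lia.
have l12 : pos u1 < pos u2.
  have := n01 _ u2D; have := u0min _ u2D.
  by move: p01 p12 p20; clear; rewrite /cyc; lia.
case: (boolP (u2 \in C)) => u2C.
  exists u0, u1; split=> //; first by move=> C01; apply: CD; apply: cyc_face_arc_inj C01 u01.
  by move=> [_ _ _ /(_ _ u2C)]; move: l01 l12; clear; rewrite /cyc; lia.
by exists u1, u2; split=> //; case=> a b _ _; move: u2C; rewrite ?a ?b.
Qed.

End CyclicOrder.

(** * The circular order of an outerplane graph *)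

Definition position n (sigma : {perm 'I_n}) (v : 'I_n) : nat := sigma v.

Lemma position_inj n (sigma : {perm 'I_n}) : injective (position sigma).
Proof. by move=> u v /val_inj /perm_inj. Qed.

Lemma position_lt n (sigma : {perm 'I_n}) v : (position sigma v < n)%nat.
Proof. exact: ltn_ord. Qed.

Lemma outerplane_noncross n (e : rel 'I_n) sigma : outerplane e sigma ->
  forall p q u v, e p q -> e u v ->
  ~~ (cyc (position sigma p) (position sigma u) (position sigma q) &&
      cyc (position sigma q) (position sigma v) (position sigma p)).
Proof.
move=> [_ nc] p q u v epq euv; apply: contra (nc p q u v epq euv).
rewrite /chords_cross /cyc /position /=.
by move: (nat_of_ord _) (nat_of_ord _) (nat_of_ord _) (nat_of_ord _); lia.
Qed.

Lemma next_nth_index (T : eqType) (c : seq T) u : u \in c ->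
  next c u = nth u c (if (index u c).+1 == size c then 0%nat else (index u c).+1).
Proof.
rewrite next_nth => uc; rewrite uc; move: uc.
case: c => [//|y p]; rewrite -index_mem; move: (index u (y :: p)) => i /=.
case: eqP => [[->] _|/eqP ne ic]; first by rewrite nth_default.
by apply: set_nth_default; move: ne ic; rewrite eqSS => *; lia.
Qed.

Lemma cyc_order_next n (sigma : {perm 'I_n}) (S : {set 'I_n}) u :
  leq 2 #|S| -> u \in S -> arc_next (position sigma) S u (next (cyc_order sigma S) u).
Proof.
move=> S2 uS; set c := cyc_order sigma S.
have cE : c =i S by move=> v; rewrite mem_sort mem_enum.
have cu : uniq c by rewrite sort_uniq enum_uniq.
have cs : sorted (fun u v => leq (sigma u) (sigma v)) c.
  by apply: sort_sorted => x y; exact: leq_total.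
have szc : size c = #|S| by rewrite size_sort -cardE.
have nthlt i j : (i < j)%nat -> (j < size c)%nat ->
    (position sigma (nth u c i) < position sigma (nth u c j))%nat.
  move=> ij jc; rewrite ltn_neqAle; apply/andP; split.
    apply/eqP => /position_inj /eqP; rewrite nth_uniq //; last exact: ltn_trans jc.
    by move=> /eqP ijE; rewrite ijE ltnn in ij.
  apply: (sorted_leq_nth _ _ u cs); rewrite ?inE //; last exact: ltnW.
  - by move=> x y z; apply: leq_trans.
  - exact: ltn_trans jc.
have uc : u \in c by rewrite cE.
have iu := nth_index u uc; have iuc : (index u c < size c)%nat by rewrite index_mem.
have inS k : (k < size c)%nat -> nth u c k \in S by rewrite -cE => /mem_nth.
set i := index u c in iu iuc.
rewrite (next_nth_index uc) -/i.
have jlt : ((if i.+1 == size c then 0 else i.+1) < size c)%nat.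
  case: eqP => [_|/eqP ne]; first exact: leq_ltn_trans iuc.
  by rewrite ltn_neqAle ne iuc.
have lt_or_le j k : (j < size c)%nat -> (k < size c)%nat -> (j <= k)%nat ->
    (position sigma (nth u c j) <= position sigma (nth u c k))%nat.
  by move=> jc kc; rewrite leq_eqVlt => /orP[/eqP -> //|jk]; exact/ltnW/nthlt.
split=> //.
- exact: inS.
- rewrite -{1}iu nth_uniq //.
  have : (1 < size c)%nat by rewrite szc.
  by case: (i.+1 =P size c) => [<-|_ _]; [case: (i) | rewrite neq_ltn leqnn].
- move=> w; rewrite -cE => wc; rewrite -(nth_index u wc).
  have : (index w c < size c)%nat by rewrite index_mem.
  move: (index w c) => j jc; have -> : position sigma u = position sigma (nth u c i) by rewrite iu.
  case: eqP => [ii|/eqP ne].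
    have j0 := lt_or_le 0%nat j (leq_ltn_trans (leq0n j) jc) jc isT.
    have ji := lt_or_le j i jc iuc; have := ji; rewrite -ltnS ii => /(_ jc).
    by move: j0; rewrite /cyc; move: (position _ _) (position _ _) (position _ _) => *; lia.
  have ic : (i.+1 < size c)%nat by rewrite ltn_neqAle ne iuc.
  have [ji|ij] := leqP j i.
    by have := lt_or_le _ _ jc iuc ji; have := nthlt i i.+1 (leqnn _) ic; rewrite /cyc;
       move: (position _ _) (position _ _) (position _ _) => *; lia.
  by have := lt_or_le _ _ ic jc ij; have := nthlt i i.+1 (leqnn _) ic; rewrite /cyc;
       move: (position _ _) (position _ _) (position _ _) => *; lia.
Qed.

Lemma internal_face_cyc_face n (e : rel 'I_n) sigma S : internal_face e sigma S ->
  cyc_face (position sigma) e S.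
Proof.
move=> [S3 [Se Sch]]; split=> // [u v uv|u v uS vS euv].
  have [uS _ _ _] := uv.
  rewrite (arc_next_inj (@position_inj n sigma) uv (cyc_order_next sigma (ltnW S3) uS)).
  exact: Se.
have [->|->] := Sch u v uS vS euv; [left|right]; exact: cyc_order_next (ltnW S3) _.
Qed.

(** * Points in convex position *)

(** Twice the signed area of the triangle [abc], positive when it is counterclockwise; as a function
    of [c], a multiple of the height above the line [ab]. *)
Definition cr (F : pzRingType) (a b c : F * F) :=
  (b.1 - a.1) * (c.2 - a.2) - (b.2 - a.2) * (c.1 - a.1).

Section CrossProduct.
Context (F : comPzRingType).
Implicit Types a b c u v w z : F * F.

Lemma cr_rot a b c : cr b c a = cr a b c.
Proof. by rewrite /cr; ring. Qed.

Lemma cr_swap a b c : cr b a c = - cr a b c.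
Proof. by rewrite /cr; ring. Qed.

Lemma cr_swap23 a b c : cr a c b = - cr a b c.
Proof. by rewrite /cr; ring. Qed.

Lemma cr_aab a b : (cr a a b = 0) * (cr a b a = 0) * (cr a b b = 0).
Proof. by rewrite /cr; split; [split|]; ring. Qed.

(** Cramer's rule for [z - w] in the basis [a - w], [b - w], seen through the height above [uv]. *)
Lemma cr_cone w a b z u v : cr w a b * (cr u v z - cr u v w) =
  cr w z b * (cr u v a - cr u v w) + cr w a z * (cr u v b - cr u v w).
Proof. by rewrite /cr; ring. Qed.

(** The two components of one vector identity, by which three points at the same height above a
    nondegenerate [uv] are collinear. *)
Lemma cr_level a z b u v :
  (v.1 - u.1) * cr a z b =
    (z.1 - a.1) * (cr u v b - cr u v a) - (b.1 - a.1) * (cr u v z - cr u v a) /\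
  (v.2 - u.2) * cr a z b =
    (z.2 - a.2) * (cr u v b - cr u v a) - (b.2 - a.2) * (cr u v z - cr u v a).
Proof. by rewrite /cr; split; ring. Qed.

End CrossProduct.

Lemma tournament_min (T : finType) (A : {set T}) (r : rel T) x0 :
  (forall x y, x \in A -> y \in A -> x != y -> r x y || r y x) ->
  (forall x y z, x \in A -> y \in A -> z \in A -> r x y -> r y z -> r x z) ->
  (forall x, ~~ r x x) -> x0 \in A ->
  exists2 a, a \in A & forall z, z \in A -> z != a -> r a z.
Proof.
move=> tot tr irr x0A.
case: (arg_maxnP (fun a => #|[set z in A | r a z]|) x0A) => a aA0 amax; have aA : a \in A by [].
exists a => // z zA za; apply/negPn/negP => naz.
have rza : r z a by have := tot _ _ zA aA za; rewrite (negbTE naz) orbF.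
have := amax z zA; rewrite /= leqNgt => /negP; apply; apply: proper_card.
apply/properP; split.
  apply/fintype.subsetP => y /setIdP[yA ay]; rewrite inE yA /=.
  exact: tr zA aA yA rza ay.
by exists a; rewrite inE aA //= (negbTE (irr a)).
Qed.

Section ConvexPosition.
Context (F : realFieldType) (T : finType) (f : T -> F * F) (P : {set T}).

(** No three points are collinear and none is strictly inside a triangle of others. The second
    condition makes the order by angle around a vertex transitive. *)
Definition convex_position : Prop :=
  (forall a b c, a \in P -> b \in P -> c \in P -> a != b -> b != c -> a != c ->
     cr (f a) (f b) (f c) != 0) /\
  (forall v a b c, v \in P -> a \in P -> b \in P -> c \in P ->
     0 < cr (f v) (f a) (f b) -> 0 < cr (f v) (f b) (f c) ->
     cr (f v) (f c) (f a) <= 0).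

(** For distinct vertices: [uv] is a side of the polygon, directed counterclockwise. *)
Definition supports (u v : T) : Prop :=
  forall z, z \in P -> z != u -> z != v -> 0 < cr (f u) (f v) (f z).

Hypothesis CP : convex_position.

Lemma cr_neq0_sign u v z : u \in P -> v \in P -> z \in P ->
  u != v -> v != z -> u != z -> (0 < cr (f u) (f v) (f z)) || (0 < cr (f u) (f z) (f v)).
Proof.
move=> uP vP zP uv vz uz; have := CP.1 u v z uP vP zP uv vz uz.
by rewrite [cr _ (f z) _]cr_swap23 oppr_gt0 neq_lt orbC.
Qed.

(** Seen from [w], the other vertices are linearly ordered by angle; the two extremes are the
    neighbours of [w] on the polygon. *)
Lemma supporting_neighbours w : leq 3 #|P| -> w \in P -> exists a b,
  [/\ a \in P, b \in P, a != b & [/\ a != w, b != w, supports w a & supports b w]].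
Proof.
move=> P3 wP; have [x0 x0P x0w] := card_ge2_other w (ltnW P3).
have x0D : x0 \in P :\ w by rewrite !inE x0w.
have tr x y z : x \in P :\ w -> y \in P :\ w -> z \in P :\ w ->
    0 < cr (f w) (f x) (f y) -> 0 < cr (f w) (f y) (f z) -> 0 < cr (f w) (f x) (f z).
  move=> /setD1P[xw xP] /setD1P[yw yP] /setD1P[zw zP] xy yz.
  have xz : x != z.
    by apply: contraTneq yz => <-; rewrite cr_swap23 oppr_gt0 -leNgt ltW.
  have := CP.2 w x y z wP xP yP zP xy yz; rewrite cr_swap23 oppr_le0.
  have := CP.1 w x z wP xP zP; rewrite xz ![w == _]eq_sym xw zw => /(_ isT isT isT).
  by rewrite lt_def => ->.
have irr x : ~~ (0 < cr (f w) (f x) (f x)) by rewrite cr_aab ltxx.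
have tot x y : x \in P :\ w -> y \in P :\ w -> x != y ->
    (0 < cr (f w) (f x) (f y)) || (0 < cr (f w) (f y) (f x)).
  move=> /setD1P[xw xP] /setD1P[yw yP] xy.
  by apply: cr_neq0_sign; rewrite // eq_sym.
have [a /setD1P[aw aP] amin] :=
  @tournament_min _ _ (fun x y => 0 < cr (f w) (f x) (f y)) x0 tot tr irr x0D.
have [b /setD1P[bw bP] bmax] :
    exists2 b, b \in P :\ w & forall z, z \in P :\ w -> z != b -> 0 < cr (f w) (f z) (f b).
  apply: (@tournament_min _ _ (fun x y => 0 < cr (f w) (f y) (f x)) x0) => //.
    by move=> x y xP yP xy; rewrite orbC tot.
  by move=> x y z xP yP zP xy yz; exact: tr yz xy.
have sa : supports w a by move=> z zP zw za; apply: amin => //; rewrite !inE zw.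
have sb : supports b w by move=> z zP zb zw; rewrite -cr_rot; apply: bmax; rewrite // !inE zw.
exists a, b; split=> //; apply/eqP => ab.
have [z [zP zw za]] := card_ge3_other w a P3.
have := sa z zP zw za; have := sb z zP; rewrite -ab za zw => /(_ isT isT).
by rewrite cr_swap oppr_gt0 => /lt_trans h /h; rewrite ltxx.
Qed.

(* Ascending the height [cr u v] above the side [uv] reaches the highest vertex without meeting
   [u] or [v]; two vertices at the same height and a neighbour of one of them would be collinear. *)
Lemma polygon_minus_side_connected u v (Q : pred T) : leq 3 #|P| ->
  u \in P -> v \in P -> u != v -> supports u v ->
  (forall w w', w \in P :\: [set u; v] -> w' \in P :\: [set u; v] ->
     supports w w' \/ supports w' w -> Q w -> Q w') ->
  forall w w', w \in P :\: [set u; v] -> w' \in P :\: [set u; v] -> Q w -> Q w'.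
Proof.
move=> P3 uP vP uv suv.
set D := P :\: [set u; v].
pose h z := cr (f u) (f v) (f z).
have DP z : z \in D -> [/\ z \in P, z != u, z != v & 0 < h z].
  rewrite !inE negb_or => /andP[/andP[zu zv] zP]; split=> //; exact: suv.
have posD z : z \in P -> 0 < h z -> z \in D.
  move=> zP hz; rewrite !inE zP andbT negb_or; apply/andP.
  by split; apply: contraTneq hz => ->; rewrite /h cr_aab ltxx.
have key (Q' : pred T) a b : (forall w w', w \in D -> w' \in D ->
      supports w w' \/ supports w' w -> Q' w -> Q' w') ->
    a \in D -> b \in D -> Q' a -> ~~ Q' b ->
    (forall z, z \in D -> Q' z -> h z <= h a) -> h a <= h b -> False.
  move=> step aD bD Qa Qb amax ab.
  have [aP au av ha] := DP _ aD; have [bP bu bv hb] := DP _ bD.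
  have abn : b != a by apply: contraNneq Qb => ->.
  have [a1 [a2 [a1P a2P a12 [a1a a2a s1 s2]]]] := supporting_neighbours P3 aP.
  have low z : z \in P -> supports a z \/ supports z a -> h a <= h z -> z \in D /\ Q' z /\ h z = h a.
    move=> zP saz az; have zD := posD z zP (lt_le_trans ha az).
    have Qz := step _ _ aD zD saz Qa.
    by split=> //; split=> //; apply/eqP; rewrite eq_le amax.
  have coll z : z \in P -> supports a z \/ supports z a -> h a <= h z -> z != a -> h a < h b.
    move=> zP saz az za; rewrite lt_neqAle ab andbT; apply/eqP => hab.
    have [zD [Qz hz]] := low z zP saz az.
    have zb : z != b by apply: contraNneq Qb => <-.
    have := CP.1 a z b aP zP bP; rewrite zb ![a == _]eq_sym za abn => /(_ isT isT isT).
    have d0 : (f v).1 - (f u).1 != 0 \/ (f v).2 - (f u).2 != 0.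
      case: (eqVneq ((f v).1 - (f u).1) 0) => [d1|]; last by left.
      case: (eqVneq ((f v).2 - (f u).2) 0) => [d2|]; last by right.
      by move: ha; rewrite /h /cr d1 d2 !mul0r subrr ltxx.
    apply/negP/negPn/eqP.
    have [lev1 lev2] := cr_level (f a) (f z) (f b) (f u) (f v).
    rewrite -/(h a) -/(h b) -/(h z) hz -hab subrr !mulr0 subr0 in lev1 lev2.
    case: d0 => d0; apply/eqP.
      by move/eqP: lev1; rewrite mulf_eq0 (negbTE d0).
    by move/eqP: lev2; rewrite mulf_eq0 (negbTE d0).
  (* [b] lies in the cone at [a] spanned by the two neighbours of [a]. These are not higher than
     [a], hence neither is [b]; the neighbours are then strictly lower, and so is [b], against
     [h a <= h b]. *)
  have cone := cr_cone (f a) (f a1) (f a2) (f b) (f u) (f v).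
  rewrite -/(h _) -/(h b) -/(h a1) -/(h a2) in cone.
  have c0 : 0 < cr (f a) (f a1) (f a2) by apply: s1; rewrite // eq_sym.
  have c1 : b != a2 -> 0 < cr (f a) (f b) (f a2) by rewrite -cr_rot => ba2; rewrite -cr_rot; apply: s2.
  have c2 : b != a1 -> 0 < cr (f a) (f a1) (f b) by move=> ba1; apply: s1.
  have c1w : 0 <= cr (f a) (f b) (f a2).
    by case: (eqVneq b a2) => [->|/c1/ltW //]; rewrite cr_aab.
  have c2w : 0 <= cr (f a) (f a1) (f b).
    by case: (eqVneq b a1) => [->|/c2/ltW //]; rewrite cr_aab.
  have nle z : z \in P -> supports a z \/ supports z a -> h z <= h a.
    move=> zP saz; rewrite leNgt; apply/negP => az.
    by have [_ [_ hz]] := low z zP saz (ltW az); rewrite hz ltxx in az.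
  have h1 := nle _ a1P (or_introl s1); have h2 := nle _ a2P (or_intror s2).
  have hba : h b <= h a.
    rewrite -subr_le0 -(pmulr_rle0 _ c0) cone.
    by rewrite -[X in _ <= X]addr0; apply: lerD; apply: mulr_ge0_le0; rewrite ?subr_le0.
  have strict z : z \in P -> supports a z \/ supports z a -> z != a -> h z < h a.
    move=> zP saz za; rewrite ltNge; apply/negP => az.
    by have := coll z zP saz az za; rewrite ltNge hba.
  have l1 := strict _ a1P (or_introl s1) a1a; have l2 := strict _ a2P (or_intror s2) a2a.
  have : cr (f a) (f a1) (f a2) * (h b - h a) < 0.
    rewrite cone; case: (eqVneq b a1) => [ba1|/c2 {}c2].
      rewrite -[X in _ < X]addr0; apply: ltr_leD; last by rewrite mulr_ge0_le0 // subr_le0.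
      by rewrite pmulr_rlt0 ?subr_lt0 // c1 // ba1.
    rewrite -[X in _ < X]addr0; apply: ler_ltD; first by rewrite mulr_ge0_le0 // subr_le0.
    by rewrite pmulr_rlt0 ?subr_lt0.
  by rewrite pmulr_rlt0 // subr_lt0 ltNge ab.
move=> step w w' wD w'D Qw; apply/negPn/negP => Qw'.
have Pa : [pred z in D | Q z] w by rewrite /= wD.
have Pb : [pred z in D | ~~ Q z] w' by rewrite /= w'D.
case: (arg_maxP h Pa) => a /andP[aD Qa] amax.
case: (arg_maxP h Pb) => b /andP[bD Qb] bmax.
have amax' z : z \in D -> Q z -> h z <= h a by move=> zD Qz; apply: amax; rewrite /= zD.
have bmax' z : z \in D -> ~~ Q z -> h z <= h b by move=> zD Qz; apply: bmax; rewrite /= zD.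
have [ab|/ltW ba] := leP (h a) (h b); first exact: key amax' ab.
apply: (key (predC Q) b a) => //=; last by rewrite negbK.
move=> z z' zD z'D s; apply: contra; apply: step => //.
by case: s; [right | left].
Qed.
End ConvexPosition.

(** * Large triangles in lattice polygons *)

Lemma AMGM3 (F : realFieldType) (x y z : F) : 0 <= x -> 0 <= y -> 0 <= z ->
  27 * (x * y * z) <= (x + y + z) ^+ 3.
Proof.
move=> x0 y0 z0; rewrite -subr_ge0.
have -> : (x + y + z) ^+ 3 - 27 * (x * y * z) =
  (x + y + z) * ((x - y) ^+ 2 + (y - z) ^+ 2 + (z - x) ^+ 2) / 2 +
  3 * (x * (y - z) ^+ 2 + y * (z - x) ^+ 2 + z * (x - y) ^+ 2) by field.
have sq (a b : F) : 0 <= (a - b) ^+ 2 := sqr_ge0 _.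
have := mulr_ge0 (addr_ge0 (addr_ge0 x0 y0) z0) (addr_ge0 (addr_ge0 (sq x y) (sq y z)) (sq z x)).
have := mulr_ge0 x0 (sq y z); have := mulr_ge0 y0 (sq z x); have := mulr_ge0 z0 (sq x y).
by lra.
Qed.

(* With [l i] the l1-length of the i-th edge and [tau i] its l1-slope, the cross product of
   consecutive edges is [l i * l i.+1 * (tau i - tau i.+1)], and the sum over [i] of
   [l i + l i.+1 + (tau i - tau i.+1)] telescopes to at most 5; conclude by AM-GM. *)
Lemma concave_chain_bound (F : realFieldType) (u v : nat -> F) (q : nat) (d : F) :
  0 < d ->
  (forall i, (i <= q)%nat -> u i < u i.+1) ->
  (forall i, (i <= q)%nat -> v i <= v i.+1) ->
  u q.+1 - u 0%nat <= 1 -> v q.+1 - v 0%nat <= 1 ->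
  (forall i, (i < q)%nat -> d <= (u i.+2 - u i.+1) * (v i.+1 - v i) -
                           (u i.+1 - u i) * (v i.+2 - v i.+1)) ->
  27 * d * q%:R ^+ 3 <= 125.
Proof.
move=> d0 u_lt v_le u1 v1 cross.
case: q u_lt v_le u1 v1 cross => [|q'] u_lt v_le u1 v1 cross; first by rewrite expr0n mulr0.
set q := q'.+1 in u_lt v_le u1 v1 cross *.
have q0 : 0 < q%:R :> F by rewrite ltr0n.
pose L i := u i + v i; pose l i := L i.+1 - L i.
pose tau i := (v i.+1 - v i) / l i.
have l0 i : (i <= q)%nat -> 0 < l i.
  by move=> iq; rewrite /l /L; have := u_lt i iq; have := v_le i iq; lra.
have tau01 i : (i <= q)%nat -> 0 <= tau i <= 1.
  move=> iq; have li := l0 i iq; have ui := u_lt i iq; have vi := v_le i iq.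
  apply/andP; split; first by apply: divr_ge0; [rewrite subr_ge0 | exact: ltW].
  by rewrite ler_pdivrMr // mul1r /l /L; lra.
pose s i : F := l i + l i.+1 + (tau i - tau i.+1).
have s3 i : (i < q)%nat -> 27 * d <= s i ^+ 3.
  move=> iq; have li := l0 i (ltnW iq); have li1 := l0 i.+1 iq.
  have E : l i * l i.+1 * (tau i - tau i.+1) = (u i.+2 - u i.+1) * (v i.+1 - v i) -
                           (u i.+1 - u i) * (v i.+2 - v i.+1).
    rewrite /tau; have -> : (v i.+2 - v i.+1) = l i.+1 - (u i.+2 - u i.+1) by rewrite /l /L; ring.
    have -> : (v i.+1 - v i) = l i - (u i.+1 - u i) by rewrite /l /L; ring.
    by field; rewrite ?gt_eqF.
  have tt : 0 < tau i - tau i.+1.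
    rewrite -(pmulr_rgt0 _ (mulr_gt0 li li1)) E; exact: lt_le_trans (cross i iq).
  apply: le_trans (AMGM3 (ltW li) (ltW li1) (ltW tt)).
  by rewrite ler_pM2l // E cross.
(* Each of the two sums of lengths is at most 2, because [u] and [v] both grow by at most 1, and the
   slopes stay in [[0, 1]]. *)
have sum_s : \sum_(0 <= i < q) s i <= 5.
  rewrite big_split /= big_split /=.
  
  have -> : \sum_(0 <= i < q) l i = L q - L 0%nat by rewrite telescope_sumr.
  have -> : \sum_(0 <= i < q) l i.+1 = L q.+1 - L 1%nat.
    by rewrite (telescope_sumr (fun i => L i.+1)).
  have -> : \sum_(0 <= i < q) (tau i - tau i.+1) = tau 0%nat - tau q.
    rewrite -[RHS]opprB -(telescope_sumr tau) // -sumrN.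
    by apply: eq_bigr => i _; rewrite opprB.
  have := tau01 0%nat isT; have := tau01 q (leqnn _).
  have := l0 0%nat isT; have := l0 q (leqnn _).
  by move: u1 v1; rewrite /l /L => *; lra.
rewrite leNgt; apply/negP => big.
have s_big i : (i < q)%nat -> 5 / q%:R < s i.
  move=> iq; rewrite ltNge; apply/negP => si.
  have := s3 i iq; apply/negP; rewrite -ltNge.
  have : s i ^+ 3 <= (5 / q%:R) ^+ 3.
    case: (leP 0 (s i)) => [s0|/ltW s0]; first by rewrite lerXn2r // nnegrE ?divr_ge0.
    apply: (@le_trans _ _ 0); last by rewrite exprn_ge0 // divr_ge0.
    by rewrite exprS mulr_le0_ge0 // sqr_ge0.
  move=> /le_lt_trans; apply; rewrite expr_div_n ltr_pdivrMr ?exprn_gt0 //.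
  by apply: le_lt_trans big; rewrite !exprS expr0; lra.
have : \sum_(0 <= i < q) (5 / q%:R) < \sum_(0 <= i < q) s i.
  by apply: ltr_sum_nat => // i /andP[_]; exact: s_big.
rewrite sumr_const_nat subn0 -[X in X < _]mulr_natr divfK ?gt_eqF //.
by rewrite ltNge sum_s.
Qed.

(** The three coefficients are barycentric coordinates of [v] in [abc], up to a common factor. With
    the order of the abscissas, the signs of two of them can give that of the third. *)
Lemma cr_bary1 (F : comPzRingType) (v a b c : F * F) :
  cr v b c * (a.1 - v.1) + cr v c a * (b.1 - v.1) + cr v a b * (c.1 - v.1) = 0.
Proof. by rewrite /cr; ring. Qed.

(** The affine map [z -> (z.1, cr a b z)] multiplies signed areas by [b.1 - a.1]. *)
Lemma cr_height (F : comPzRingType) (a b p q r : F * F) :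
  (b.1 - a.1) * cr p q r = (q.1 - p.1) * (cr a b r - cr a b q) -
                           (r.1 - q.1) * (cr a b q - cr a b p).
Proof. by rewrite /cr; ring. Qed.

Section LatticePolygon.
Context (F : realFieldType) (T : finType) (P : {set T}).

Section Chain.
Context (f : T -> F * F).
Hypothesis CP : convex_position f P.
Hypothesis x_inj : forall u v, u \in P -> v \in P -> (f u).1 = (f v).1 -> u = v.
Context (a b : T) (aP : a \in P) (bP : b \in P).
Hypothesis a_min : forall z, z \in P -> (f a).1 <= (f z).1.
Hypothesis b_max : forall z, z \in P -> (f z).1 <= (f b).1.

(** With a left turn, [p2] is below [p1 p3] and above [ab]. If it is below the line [a p3], it is
    inside the triangle [a b p3], and otherwise inside [a p3 p1]; convex position excludes both. *)
Lemma upper_chain_concave p1 p2 p3 : p1 \in P -> p2 \in P -> p3 \in P ->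
  0 <= cr (f a) (f b) (f p2) ->
  (f p1).1 < (f p2).1 -> (f p2).1 < (f p3).1 -> cr (f p1) (f p2) (f p3) < 0.
Proof.
move=> P1 P2 P3 up2 x12 x23.
have neq u v : (f u).1 < (f v).1 -> u != v by move=> h; apply: contraTneq h => ->; rewrite ltxx.
have xa2 : (f a).1 < (f p2).1 by apply: le_lt_trans x12; exact: a_min.
have x2b : (f p2).1 < (f b).1 by apply: lt_le_trans x23 _; exact: b_max.
have a2 := neq _ _ xa2; have b2 := neq _ _ x2b.
have xab := lt_trans xa2 x2b; have ab := neq _ _ xab.
have x13 := lt_trans x12 x23; have xa3 := lt_trans xa2 x23.
have {}up2 : 0 < cr (f a) (f b) (f p2).
  by rewrite lt_def up2 CP.1 // eq_sym.
rewrite ltNge le_eqVlt negb_or eq_sym CP.1 ?neq //=; apply/negP => conv.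
have up3 : 0 < cr (f a) (f p3) (f p2).
  case: (eqVneq p3 b) => [-> //|p3b].
  have n32 : p3 != p2 by rewrite eq_sym neq.
  have /orP[//|low] := cr_neq0_sign CP aP P3 P2 (neq _ _ xa3) n32 a2.
  have wb : 0 < cr (f p2) (f p3) (f a) by rewrite cr_rot.
  have w3 : 0 < cr (f p2) (f a) (f b) by rewrite -cr_rot.
  have wa : 0 < cr (f p2) (f b) (f p3).
    have xb2 : 0 < (f b).1 - (f p2).1 by rewrite subr_gt0.
    have x32 : 0 < (f p3).1 - (f p2).1 by rewrite subr_gt0.
    have xa2' : 0 < (f p2).1 - (f a).1 by rewrite subr_gt0.
    rewrite -(pmulr_lgt0 _ xa2').
    have -> : cr (f p2) (f b) (f p3) * ((f p2).1 - (f a).1) =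
      cr (f p2) (f p3) (f a) * ((f b).1 - (f p2).1) +
      cr (f p2) (f a) (f b) * ((f p3).1 - (f p2).1).
      have := cr_bary1 (f p2) (f a) (f b) (f p3); lra.
    by rewrite addr_gt0 // mulr_gt0.
  by have := CP.2 p2 a b p3 P2 aP bP P3 w3 wa; rewrite leNgt wb.
have ne1 : p1 != a.
  by apply: contraTneq up3 => <-; rewrite cr_swap23 oppr_gt0 -leNgt ltW.
have xa1 : (f a).1 <= (f p1).1 by exact: a_min.
have w1 : 0 < cr (f p2) (f a) (f p3) by rewrite -cr_rot.
have wa : 0 < cr (f p2) (f p3) (f p1) by rewrite cr_rot.
have w3 : 0 < cr (f p2) (f p1) (f a).
  have x32 : 0 < (f p3).1 - (f p2).1 by rewrite subr_gt0.
  have x21 : 0 < (f p2).1 - (f p1).1 by rewrite subr_gt0.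
  have x2a : 0 < (f p2).1 - (f a).1 by rewrite subr_gt0.
  rewrite -(pmulr_lgt0 _ x32).
  have -> : cr (f p2) (f p1) (f a) * ((f p3).1 - (f p2).1) =
    cr (f p2) (f a) (f p3) * ((f p2).1 - (f p1).1) +
    cr (f p2) (f p3) (f p1) * ((f p2).1 - (f a).1).
    have := cr_bary1 (f p2) (f a) (f p3) (f p1); lra.
  by rewrite addr_gt0 // mulr_gt0.
by have := CP.2 p2 a p3 p1 P2 aP P3 P1 w1 wa; rewrite leNgt w3.
Qed.

Hypothesis cr_ge1 : forall u v w, u \in P -> v \in P -> w \in P ->
  u != v -> v != w -> u != w -> 1 <= `|cr (f u) (f v) (f w)|.

Let h z := cr (f a) (f b) (f z).

(** Stopping at the highest vertex [r] makes heights monotone along the chain. Abscissas are divided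
    by [(f b).1 - (f a).1] and heights by [h r], which altogether divides areas by [h r]; [q + 2]
    vertices make [q + 1] edges and [q] turns. *)
Lemma left_chain_bound r q : r \in P -> 0 < h r -> (forall z, z \in P -> h z <= h r) ->
  leq (q + 2)%nat #|[set z in P | (0 <= h z) && ((f z).1 <= (f r).1)]| ->
  27 * q%:R ^+ 3 <= 125 * h r.
Proof.
move=> rP hr r_max; set U := [set z in P | _] => Uq.
case: q Uq => [|q'] Uq; first by rewrite expr0n mulr0 mulr_ge0 // ltW.
set q := q'.+1 in Uq *.
pose s := sort (fun u v => (f u).1 <= (f v).1) (enum U).
pose p i := nth a s i.
have szs : (q.+1 < size s)%nat by rewrite size_sort -cardE; rewrite addn2 in Uq.
have pU i : (i <= q.+1)%nat -> p i \in U.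
  by move=> iq; rewrite -mem_enum -(mem_sort (fun u v => (f u).1 <= (f v).1)) mem_nth // (leq_ltn_trans iq).
have pP i : (i <= q.+1)%nat -> [/\ p i \in P, 0 <= h (p i) & (f (p i)).1 <= (f r).1].
  by move=> /pU; rewrite inE => /andP[-> /andP[-> ->]].
have x_lt i j : (i < j)%nat -> (j <= q.+1)%nat -> (f (p i)).1 < (f (p j)).1.
  move=> ij jq; have iq := leq_trans (ltnW ij) jq.
  have [iP _ _] := pP i iq; have [jP _ _] := pP j jq.
  rewrite lt_neqAle; apply/andP; split.
    apply: contraTneq ij => /(x_inj iP jP) /eqP; rewrite /p nth_uniq; last first.
    - by rewrite sort_uniq enum_uniq.
    - exact: leq_ltn_trans szs.
    - exact: leq_ltn_trans szs.
    by move=> /eqP ->; rewrite ltnn.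
  apply: (@sorted_leq_nth _ (fun u v => (f u).1 <= (f v).1) _ _ a s).
  - by move=> x y z; exact: le_trans.
  - by move=> x; exact: lexx.
  - by apply: sort_sorted => x y; exact: le_total.
  - by rewrite inE (leq_ltn_trans iq).
  - by rewrite inE (leq_ltn_trans jq).
  - exact: ltnW.
have xab : 0 < (f b).1 - (f a).1.
  rewrite subr_gt0 lt_neqAle b_max // andbT; apply: contraTneq hr => /(x_inj aP bP) ab.
  by rewrite /h ab cr_aab ltxx.
have neq u v : (f u).1 < (f v).1 -> u != v by move=> huv; apply: contraTneq huv => ->; rewrite ltxx.
(* Descending from [p i] to [p i.+1] without descending further to [r] would be a left turn. *)
have h_le i : (i <= q)%nat -> h (p i) <= h (p i.+1).
  move=> iq; have [iP _ ir] := pP i (leqW iq); have [jP hj jr] := pP i.+1 iq.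
  case: (eqVneq (p i.+1) r) => [->|jnr]; first exact: r_max.
  have x2r : (f (p i.+1)).1 < (f r).1.
    by rewrite lt_neqAle jr andbT; apply: contraNneq jnr => /(x_inj jP rP) ->.
  have x12 := x_lt i i.+1 (leqnn _) iq.
  have conc := upper_chain_concave iP jP rP hj x12 x2r.
  rewrite leNgt; apply/negP => hij.
  have E : ((f b).1 - (f a).1) * cr (f (p i)) (f (p i.+1)) (f r) =
      ((f (p i.+1)).1 - (f (p i)).1) * (h r - h (p i.+1)) -
      ((f r).1 - (f (p i.+1)).1) * (h (p i.+1) - h (p i)) := cr_height _ _ _ _ _.
  have t0 : ((f b).1 - (f a).1) * cr (f (p i)) (f (p i.+1)) (f r) < 0 by rewrite pmulr_rlt0.
  have t1 : 0 <= ((f (p i.+1)).1 - (f (p i)).1) * (h r - h (p i.+1)).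
    by rewrite mulr_ge0 // subr_ge0; [exact: ltW | exact: r_max].
  have t2 : ((f r).1 - (f (p i.+1)).1) * (h (p i.+1) - h (p i)) < 0.
    by rewrite pmulr_rlt0 ?subr_gt0 // subr_lt0.
  by lra.
have X0 : (f b).1 - (f a).1 != 0 by rewrite gt_eqF.
have D0 : h r != 0 by rewrite gt_eqF.
suff : 27 * (h r)^-1 * q%:R ^+ 3 <= 125.
  by rewrite mulrAC ler_pdivrMr.
apply: (@concave_chain_bound _ (fun i => (f (p i)).1 / ((f b).1 - (f a).1))
                               (fun i => h (p i) / h r)).
- by rewrite invr_gt0.
- by move=> i iq; rewrite ltr_pM2r ?invr_gt0 //; apply: x_lt.
- by move=> i iq; rewrite ler_pM2r ?invr_gt0 //; apply: h_le.
- have [p0 _ _] := pP 0%nat isT; have [pq _ _] := pP q.+1 (leqnn _).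
  rewrite -mulrBl ler_pdivrMr // mul1r.
  by have := a_min p0; have := b_max pq; lra.
- have [p0 h0 _] := pP 0%nat isT; have [pq _ _] := pP q.+1 (leqnn _).
  rewrite -mulrBl ler_pdivrMr // mul1r.
  by have := r_max _ pq; lra.
move=> i iq.
have [i0 _ _] := pP i (leqW (ltnW iq)); have [i1 hi1 _] := pP i.+1 (leqW iq).
have [i2 _ _] := pP i.+2 iq.
have x01 := x_lt i i.+1 (leqnn _) (leqW iq); have x12 := x_lt i.+1 i.+2 (leqnn _) iq.
have conc := upper_chain_concave i0 i1 i2 hi1 x01 x12.
have := cr_ge1 i0 i1 i2 (neq _ _ x01) (neq _ _ x12) (neq _ _ (lt_trans x01 x12)).
rewrite ltr0_norm // => cr1.
rewrite -!mulrBl.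
have -> : ((f (p i.+2)).1 - (f (p i.+1)).1) / ((f b).1 - (f a).1) * ((h (p i.+1) - h (p i)) / h r) -
   ((f (p i.+1)).1 - (f (p i)).1) / ((f b).1 - (f a).1) * ((h (p i.+2) - h (p i.+1)) / h r) =
   (- cr (f (p i)) (f (p i.+1)) (f (p i.+2))) / h r.
  apply: (mulfI X0).
  have E : ((f b).1 - (f a).1) * cr (f (p i)) (f (p i.+1)) (f (p i.+2)) =
      ((f (p i.+1)).1 - (f (p i)).1) * (h (p i.+2) - h (p i.+1)) -
      ((f (p i.+2)).1 - (f (p i.+1)).1) * (h (p i.+1) - h (p i)) := cr_height _ _ _ _ _.
  rewrite [RHS]mulrA mulrN E.
  by field; rewrite X0 D0.
by rewrite -[X in X <= _]mul1r ler_pM2r ?invr_gt0.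
Qed.
End Chain.

(** All that is kept of the lattice: it survives reflections and area-preserving maps. *)
Definition unit_cross (f : T -> F * F) : Prop :=
  forall u v w, u \in P -> v \in P -> w \in P ->
  u != v -> v != w -> u != w -> 1 <= `|cr (f u) (f v) (f w)|.

Lemma convex_position_preserve (f g : T -> F * F) :
  (forall u v w, cr (g u) (g v) (g w) = cr (f u) (f v) (f w)) ->
  convex_position f P -> convex_position g P.
Proof. by move=> gf [c1 c2]; split=> [u v w|v a b c]; rewrite !gf; [exact: c1 | exact: c2]. Qed.

Lemma convex_position_reverse (f g : T -> F * F) :
  (forall u v w, cr (g u) (g v) (g w) = - cr (f u) (f v) (f w)) ->
  convex_position f P -> convex_position g P.
Proof.
move=> gf [c1 c2]; split=> [u v w uP vP wP uv vw uw|v a b c vP aP bP cP].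
  by rewrite gf oppr_eq0 c1.
rewrite !gf -!cr_swap23 => ab bc; rewrite leNgt; apply/negP => ca.
by have := c2 v b a c vP bP aP cP ab ca; rewrite leNgt bc.
Qed.

(** Adding [a] and [b], and counting the highest vertex [r] on both sides of its vertical, gives at
    least [2 * q + 4], so one side has [q + 2] vertices. The right side is treated by reflecting
    abscissas, which exchanges [a] and [b]. *)
Lemma upper_chain_bound (f : T -> F * F) a b q : convex_position f P -> unit_cross f ->
  (forall u v, u \in P -> v \in P -> (f u).1 = (f v).1 -> u = v) ->
  a \in P -> b \in P -> a != b ->
  (forall z, z \in P -> (f a).1 <= (f z).1) -> (forall z, z \in P -> (f z).1 <= (f b).1) ->
  leq (2 * q + 1)%nat #|[set z in P | 0 < cr (f a) (f b) (f z)]| ->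
  exists u v w, [/\ u \in P, v \in P, w \in P & 27 * q%:R ^+ 3 <= 125 * `|cr (f u) (f v) (f w)|].
Proof.
move=> CP cr1 x_inj aP bP ab a_min b_max; set Up := [set z in P | _] => Upq.
pose h z := cr (f a) (f b) (f z).
case: (arg_maxP h aP) => r rP0 r_max; have rP : r \in P by [].
have hr : 0 < h r.
  have /card_gt0P[z /setIdP[zP hz]] : leq 1 #|Up| by apply: leq_trans Upq; rewrite addn1.
  exact: lt_le_trans (r_max _ zP).
exists a, b, r; rewrite -/(h r) gtr0_norm //; split=> //.
pose L := [set z in P | (0 <= h z) && ((f z).1 <= (f r).1)].
pose K := [set z in P | (0 <= h z) && ((f r).1 <= (f z).1)].
have LK : leq (2 * q + 4)%nat (#|L| + #|K|)%nat.
  rewrite -cardsUI; have UpLK : a |: (b |: Up) \subset L :|: K.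
    apply/fintype.subsetP => z; rewrite !inE => /or3P[/eqP->|/eqP->|/andP[zP hz]].
    - by rewrite aP /h cr_aab lexx a_min.
    - by rewrite bP /h cr_aab lexx b_max // orbT.
    - by rewrite zP (ltW hz) /=; exact: le_total.
  have rLK : [set r] \subset L :&: K by rewrite finset.sub1set !inE rP (ltW hr) lexx.
  have := subset_leq_card UpLK; have := subset_leq_card rLK.
  rewrite cards1 !cardsU1 !inE negb_or ab /h !cr_aab !ltxx !andbF /= -/Up.
  by move: Upq; clear; lia.
have [qL|Lq] := leqP (q + 2) #|L|.
  exact: (left_chain_bound CP x_inj aP bP a_min b_max cr1 rP hr r_max qL).
have qK : leq (q + 2)%nat #|K| by move: LK Lq; clear; lia.
pose g z := (- (f z).1, (f z).2).
have gf u v w : cr (g u) (g v) (g w) = - cr (f u) (f v) (f w) by rewrite /cr /=; ring.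
have hg z : cr (g b) (g a) (g z) = h z by rewrite gf cr_swap opprK.
have := @left_chain_bound g (convex_position_reverse gf CP) _ b a bP aP _ _ _ r q rP.
rewrite !hg; apply=> //.
- by move=> u v uP vP /oppr_inj; apply: x_inj.
- by move=> z zP; rewrite lerN2 b_max.
- by move=> z zP; rewrite lerN2 a_min.
- by move=> u v w *; rewrite gf normrN cr1.
- by move=> z zP; rewrite hg; exact: r_max.
- apply: (leq_trans qK); apply: subset_leq_card; apply/fintype.subsetP => z.
  by rewrite !inE hg lerN2.
Qed.

(** Besides the leftmost and rightmost vertices [a] and [b] there are at least [4 * q + 2] others,
    so [2 * q + 1] of them are on one side of [ab]; the lower side is reflected. *)
Lemma big_triangle_inj (f : T -> F * F) q : convex_position f P -> unit_cross f ->
  (forall u v, u \in P -> v \in P -> (f u).1 = (f v).1 -> u = v) ->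
  leq (4 * q + 4)%nat #|P| ->
  exists u v w, [/\ u \in P, v \in P, w \in P & 27 * q%:R ^+ 3 <= 125 * `|cr (f u) (f v) (f w)|].
Proof.
move=> CP cr1 x_inj Pq.
have /card_gt0P[z0 z0P] : leq 1 #|P| by apply: leq_trans Pq; rewrite addn4.
case: (arg_minP (fun z => (f z).1) z0P) => a aP0 a_min; have aP : a \in P by [].
case: (arg_maxP (fun z => (f z).1) z0P) => b bP0 b_max; have bP : b \in P by [].
have ab : a != b.
  have P2 : leq 2 #|P| by apply: leq_trans Pq; rewrite addn4.
  have [z zP za] := card_ge2_other a P2.
  apply: contraNneq za => ab; apply/eqP/x_inj => //.
  by apply: le_anti; rewrite a_min // andbT ab; exact: b_max.
pose Up := [set z in P | 0 < cr (f a) (f b) (f z)].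
pose Dn := [set z in P | cr (f a) (f b) (f z) < 0].
have UD : leq (4 * q + 2)%nat (#|Up| + #|Dn|)%nat.
  have PUD : P \subset a |: (b |: (Up :|: Dn)).
    apply/fintype.subsetP => z zP; rewrite !inE zP /=.
    case: (eqVneq z a) => //= za; case: (eqVneq z b) => //= zb.
    have := CP.1 a b z aP bP zP ab; rewrite ![_ == z]eq_sym zb za => /(_ isT isT).
    by rewrite neq_lt orbC.
  have := subset_leq_card PUD; rewrite !cardsU1.
  have [UD _] := leq_card_setU Up Dn; move: UD; move: Pq; clear.
  by move: (_ \notin _) (_ \notin _) => [] []; lia.
have [qU|Uq] := leqP (2 * q + 1) #|Up|.
  exact: upper_chain_bound CP cr1 x_inj aP bP ab a_min b_max qU.
have qD : leq (2 * q + 1)%nat #|Dn| by move: UD Uq; clear; lia.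
pose g z := ((f z).1, - (f z).2).
have gf u v w : cr (g u) (g v) (g w) = - cr (f u) (f v) (f w) by rewrite /cr /=; ring.
have cr1g : unit_cross g by move=> u v w *; rewrite gf normrN cr1.
have := @upper_chain_bound g a b q (convex_position_reverse gf CP) cr1g x_inj aP bP ab a_min b_max.
case.
  by apply: (leq_trans qD); apply: subset_leq_card; apply/fintype.subsetP => z; rewrite !inE gf oppr_gt0.
by move=> u [v [w [uP vP wP]]]; rewrite gf normrN; exists u, v, w.
Qed.

(* The unimodular shear [(x, y) -> (M x + y, - x)] separates abscissas without changing areas. *)
Lemma big_triangle (G : T -> int * int) q :
  let f z := ((G z).1%:~R, (G z).2%:~R) : F * F in
  injective G -> convex_position f P -> leq (4 * q + 4)%nat #|P| ->
  exists u v w, [/\ u \in P, v \in P, w \in P & 27 * q%:R ^+ 3 <= 125 * `|cr (f u) (f v) (f w)|].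
Proof.
move=> f G_inj CP Pq.
(* [M] exceeds the difference of any two ordinates, so [M * x + y] determines [x]. *)
pose B : int := \sum_z `|(G z).2|; pose M : int := B + B + 1.
have yB z : `|(G z).2| <= B.
  by rewrite /B (bigD1 z) //= lerDl sumr_ge0 // => *; exact: normr_ge0.
pose g z : F * F := ((M * (G z).1 + (G z).2)%:~R, (- (G z).1)%:~R).
have gf u v w : cr (g u) (g v) (g w) = cr (f u) (f v) (f w).
  by rewrite /cr /g /f /= !intrD !intrM !mulrNz; ring.
have cr1 : unit_cross g.
  move=> u v w uP vP wP uv vw uw; have := CP.1 u v w uP vP wP uv vw uw; rewrite gf.
  rewrite /cr /f /= -!intrB -!intrM -!intrB intr_eq0 -intr_norm ler1z => nz.
  by rewrite -gtz0_ge1 normr_gt0.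
have x_inj u v : u \in P -> v \in P -> (g u).1 = (g v).1 -> u = v.
  move=> _ _ /= /intr_inj; have := yB u; have := yB v; rewrite /M => Bv Bu E.
  apply: G_inj; move: Bv Bu E; case: (G u) (G v) => [x y] [x' y'] /= Bv Bu E.
  have xx : x = x' by nia.
  by move: E; rewrite xx => /addrI ->.
have := big_triangle_inj (convex_position_preserve gf CP) cr1 x_inj Pq.
by move=> [u [v [w [uP vP wP]]]]; rewrite gf; exists u, v, w.
Qed.
End LatticePolygon.

Local Open Scope classical_set_scope.
Local Open Scope ring_scope.

(** * Segments and convex hulls *)

Lemma segmentP (a b p : R * R) : Defs.segment a b p <-> exists t : R,
  [/\ 0 <= t <= 1, p.1 = (1 - t) * a.1 + t * b.1 & p.2 = (1 - t) * a.2 + t * b.2].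
Proof.
split=> [[t [t01 ->]]|[t [t01 p1 p2]]]; exists t; first by split.
by split=> //; case: p p1 p2 => x y /= -> ->.
Qed.

Lemma fst_continuous : continuous (fun q : R * R => q.1).
Proof. by case=> x y; exact: cvg_fst. Qed.

Lemma snd_continuous : continuous (fun q : R * R => q.2).
Proof. by case=> x y; exact: cvg_snd. Qed.

Lemma cr_continuous (a b : R * R) : continuous (fun q : R * R => cr a b q).
Proof.
move=> q; rewrite /cr; apply: (@cvgB R R^o); apply: (@cvgM R); try exact: cvg_cst.
  by apply: (@cvgB R R^o); [exact: snd_continuous | exact: cvg_cst].
by apply: (@cvgB R R^o); [exact: fst_continuous | exact: cvg_cst].
Qed.

Lemma near_gt0 (h : R * R -> R) (p : R * R) : continuous h -> 0 < h p ->
  \forall q \near p, 0 < h q.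
Proof. by move=> hc hp; apply: (cvgr_gt _ (hc p)). Qed.

(** Nonpositive exactly on the disk with diameter [ab]. *)
Definition dot (a b p : R * R) := (p.1 - a.1) * (p.1 - b.1) + (p.2 - a.2) * (p.2 - b.2).

Lemma dot_continuous (a b : R * R) : continuous (dot a b).
Proof.
move=> q; rewrite /dot; apply: (@cvgD R R^o); apply: (@cvgM R); apply: (@cvgB R R^o);
  by [exact: cvg_cst | exact: fst_continuous | exact: snd_continuous].
Qed.

(** Sign conditions on continuous functions replace the parameter, so that the complement of a
    segment is visibly open. *)
Lemma segment_dotP (a b p : R * R) : Defs.segment a b p <-> cr a b p = 0 /\ dot a b p <= 0.
Proof.
rewrite segmentP; case: a b p => [ax ay] [bx by'] [px py]; rewrite /cr /dot /=; split.
  move=> [t [/andP[t0 t1] -> ->]]; split; first by ring.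
  have -> : ((1 - t) * ax + t * bx - ax) * ((1 - t) * ax + t * bx - bx) +
    ((1 - t) * ay + t * by' - ay) * ((1 - t) * ay + t * by' - by') =
    - (t * (1 - t) * ((bx - ax) ^+ 2 + (by' - ay) ^+ 2)) by ring.
  by rewrite oppr_le0 !mulr_ge0 ?subr_ge0 ?addr_ge0 ?sqr_ge0.
move=> [c0 d0]; set N := (bx - ax) ^+ 2 + (by' - ay) ^+ 2.
have sq (x : R) : 0 <= x ^+ 2 by exact: sqr_ge0.
case: (eqVneq N 0) => [N0|N0].
  have /eqP := N0; rewrite paddr_eq0 // !sqrf_eq0 !subr_eq0 => /andP[/eqP bax /eqP bay].
  have : (px - ax) ^+ 2 + (py - ay) ^+ 2 = 0.
    apply: le_anti; rewrite addr_ge0 // andbT; move: d0; rewrite bax bay; apply: le_trans.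
    by rewrite !expr2 lexx.
  move=> /eqP; rewrite paddr_eq0 // !sqrf_eq0 !subr_eq0 => /andP[/eqP -> /eqP ->].
  by exists 0; rewrite lexx ler01 bax bay; split=> //; ring.
have Np : 0 < N by rewrite lt_def N0 addr_ge0.
(* The parameter of the orthogonal projection of [p] on the line [ab]. *)
pose t := ((px - ax) * (bx - ax) + (py - ay) * (by' - ay)) / N.
have pE : px - ax = t * (bx - ax) /\ py - ay = t * (by' - ay).
  rewrite /t; split; apply: (mulfI N0).
    rewrite mulrA mulrCA divff // mulr1.
    have -> : N * (px - ax) = ((px - ax) * (bx - ax) + (py - ay) * (by' - ay)) * (bx - ax) -
      (by' - ay) * ((bx - ax) * (py - ay) - (by' - ay) * (px - ax)) by rewrite /N; ring.
    by rewrite c0; ring.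
  rewrite mulrA mulrCA divff // mulr1.
  have -> : N * (py - ay) = ((px - ax) * (bx - ax) + (py - ay) * (by' - ay)) * (by' - ay) +
    (bx - ax) * ((bx - ax) * (py - ay) - (by' - ay) * (px - ax)) by rewrite /N; ring.
  by rewrite c0; ring.
have [px' py'] := pE.
have t01 : 0 <= t * (1 - t).
  rewrite -(pmulr_rge0 _ Np).
  suff -> : N * (t * (1 - t)) = - ((px - ax) * (px - bx) + (py - ay) * (py - by')).
    by rewrite oppr_ge0.
  have -> : px - bx = (t - 1) * (bx - ax) by rewrite mulrBl -px'; ring.
  have -> : py - by' = (t - 1) * (by' - ay) by rewrite mulrBl -py'; ring.
  by rewrite px' py' /N; ring.
exists t; split.
- by apply/andP; nra.
- by rewrite -[LHS](subrK ax) px'; ring.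
- by rewrite -[LHS](subrK ay) py'; ring.
Qed.

Lemma near_notin_segment (a b p : R * R) : ~ Defs.segment a b p ->
  \forall q \near p, ~ Defs.segment a b q.
Proof.
rewrite segment_dotP => ns.
case: (ltrgtP (cr a b p) 0) => [c0|c0|c0].
- have : 0 < cr b a p by rewrite cr_swap oppr_gt0.
  move=> /(near_gt0 (@cr_continuous b a)); apply: filterS => q.
  by rewrite segment_dotP => cq [c _]; move: cq; rewrite cr_swap c oppr0 ltxx.
- move: c0 => /(near_gt0 (@cr_continuous a b)); apply: filterS => q.
  by rewrite segment_dotP => cq [c _]; move: cq; rewrite c ltxx.
- have : 0 < dot a b p by rewrite ltNge; apply/negP => d0; apply: ns.
  move=> /(near_gt0 (@dot_continuous a b)); apply: filterS => q.
  by rewrite segment_dotP ltNge => /negP dq [_].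
Qed.

Lemma near_boxP (p : R * R) (A : set (R * R)) : (\forall q \near p, A q) <->
  exists2 d : R, 0 < d & forall q : R * R, `|q.1 - p.1| < d -> `|q.2 - p.2| < d -> A q.
Proof.
split=> [/nbhs_ballP[d d0 dA]|[d d0 dA]].
  by exists d => // q q1 q2; apply: dA; split; rewrite /ball /= distrC.
by apply/nbhs_ballP; exists d => // q [q1 q2]; apply: dA; rewrite distrC.
Qed.

Lemma segment_connected_set (a b : R * R) : connected (Defs.segment a b).
Proof.
have -> : Defs.segment a b =
    [set (((1 - t) * a.1 + t * b.1, (1 - t) * a.2 + t * b.2) : R * R) | t in `[0, 1]].
  apply/seteqP; split=> [p /segmentP[t [t01 p1 p2]]|_ [t t01 <-]].
    by exists t; rewrite /= ?in_itv //=; case: p p1 p2 => x y /= -> ->.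
  by apply/segmentP; exists t; split=> //; move: t01; rewrite /= in_itv.
apply: connected_continuous_connected; first exact: segment_connected.
apply: continuous_subspaceT => t.
have lim (x y : R) : (1 - s) * x + s * y @[s --> t] --> (1 - t) * x + t * y.
  apply: (@cvgD R R^o); apply: (@cvgM R); try exact: cvg_cst; try exact: cvg_id.
  by apply: (@cvgB R R^o); [exact: cvg_cst | exact: cvg_id].
exact: (cvg_pair (lim _ _) (lim _ _)).
Qed.

Lemma conv_hullP (A : set (R * R)) p : conv_hull A p <->
  exists (m : nat) (q : 'I_m -> R * R) (l : 'I_m -> R),
  [/\ forall i, A (q i), forall i, 0 <= l i, \sum_(i < m) l i = 1,
      p.1 = \sum_(i < m) l i * (q i).1 & p.2 = \sum_(i < m) l i * (q i).2].
Proof.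
split=> [[m [q [l [Aq [l0 [l1 ->]]]]]]|[m [q [l [Aq l0 l1 p1 p2]]]]]; exists m, q, l; first by split.
by do !split=> //; case: p p1 p2 => x y /= -> ->.
Qed.

Lemma conv_hull_halfplane (A : set (R * R)) (al be ga : R) p :
  (forall q, A q -> 0 <= al * q.1 + be * q.2 + ga) -> conv_hull A p ->
  0 <= al * p.1 + be * p.2 + ga.
Proof.
move=> h0 /conv_hullP[m [q [l [Aq l0 l1 -> ->]]]].
rewrite -[ga]mulr1 -l1 !mulr_sumr -!big_split /=; apply: sumr_ge0 => i _.
have -> : al * (l i * (q i).1) + be * (l i * (q i).2) + ga * l i =
  l i * (al * (q i).1 + be * (q i).2 + ga) by ring.
by rewrite mulr_ge0 // h0.
Qed.

Lemma conv_hull_cr (A : set (R * R)) u v p :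
  (forall q, A q -> 0 <= cr u v q) -> conv_hull A p -> 0 <= cr u v p.
Proof.
have crE q : cr u v q = - (v.2 - u.2) * q.1 + (v.1 - u.1) * q.2 + (u.1 * v.2 - u.2 * v.1).
  by rewrite /cr; ring.
by move=> h0 /conv_hull_halfplane; rewrite crE; apply=> q /h0; rewrite crE.
Qed.

Lemma conv_hull3 (A : set (R * R)) (a b c p : R * R) (al be ga : R) : A a -> A b -> A c ->
  0 <= al -> 0 <= be -> 0 <= ga -> al + be + ga = 1 ->
  p.1 = al * a.1 + be * b.1 + ga * c.1 -> p.2 = al * a.2 + be * b.2 + ga * c.2 ->
  conv_hull A p.
Proof.
move=> Aa Ab Ac al0 be0 ga0 s1 p1 p2; apply/conv_hullP.
exists 3%nat, (fun i => nth a [:: a; b; c] i), (fun i => nth al [:: al; be; ga] i).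
split.
- by case=> [[|[|[|]]]].
- by case=> [[|[|[|]]]].
- by rewrite !big_ord_recl big_ord0 /= addr0 addrA.
- by rewrite !big_ord_recl big_ord0 /= addr0 addrA.
- by rewrite !big_ord_recl big_ord0 /= addr0 addrA.
Qed.

Arguments conv_hull3 : clear scopes.

Lemma conv_hull_triangle (A : set (R * R)) (a b c p : R * R) : A a -> A b -> A c ->
  0 < cr a b c -> 0 <= cr a b p -> 0 <= cr b c p -> 0 <= cr c a p -> conv_hull A p.
Proof.
move=> Aa Ab Ac D0 pc pa pb; have Dn : cr a b c != 0 by rewrite gt_eqF.
apply: (@conv_hull3 A a b c p (cr b c p / cr a b c) (cr c a p / cr a b c) (cr a b p / cr a b c)) => //.
- by rewrite divr_ge0 // ltW.
- by rewrite divr_ge0 // ltW.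
- by rewrite divr_ge0 // ltW.
- rewrite -!mulrDl; have -> : cr b c p + cr c a p + cr a b p = cr a b c by rewrite /cr; ring.
  by rewrite divff.
- have E : cr a b c * p.1 = cr b c p * a.1 + cr c a p * b.1 + cr a b p * c.1 by rewrite /cr; ring.
  by apply: (mulfI Dn); rewrite E; field.
- have E : cr a b c * p.2 = cr b c p * a.2 + cr c a p * b.2 + cr a b p * c.2 by rewrite /cr; ring.
  by apply: (mulfI Dn); rewrite E; field.
Qed.

(** * Straight-line drawings *)

Definition lerp (F : pzRingType) (a b : F * F) (s : F) : F * F :=
  ((1 - s) * a.1 + s * b.1, (1 - s) * a.2 + s * b.2).
(* Otherwise [s] would be parsed in the scope of Stdlib's reals when [F] is [R]. *)
Arguments lerp : clear scopes.

Lemma cr_lerp (F : comPzRingType) (u v a b : F * F) (s : F) :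
  cr u v (lerp a b s) = (1 - s) * cr u v a + s * cr u v b.
Proof. by rewrite /cr /lerp /=; ring. Qed.

Lemma lerp_segment (a b : R * R) (s : R) : 0 <= s <= 1 -> Defs.segment a b (lerp a b s).
Proof. by move=> s01; apply/segmentP; exists s. Qed.

Lemma near_forall (I : finType) (f : I -> R * R -> Prop) (p : R * R) :
  (forall i, \forall q \near p, f i q) -> \forall q \near p, forall i, f i q.
Proof. exact: (@filter_forall _ I f (nbhs p) (nbhs_filter p)). Qed.

Lemma near_all (A : set (R * R)) (p : R * R) : (forall q, A q) -> \forall q \near p, A q.
Proof.
by move=> AT; apply: (@filterS _ _ (nbhs_filter p) setT) => //; exact: (@filterT _ _ (nbhs_filter p)).
Qed.

Definition displace (F : pzRingType) (p w : F * F) (d : F) : F * F := (p.1 + d * w.1, p.2 + d * w.2).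
Arguments displace : clear scopes.

Lemma near_displace (A : set (R * R)) (p w : R * R) : (\forall q \near p, A q) ->
  exists d : R, [/\ 0 < d, d <= 1 & A (displace p w d)].
Proof.
move=> /near_boxP[d' d'0 dA'].
have [d [d0 d1 dA]] : exists d : R, [/\ 0 < d, d <= 1 &
    forall q : R * R, `|q.1 - p.1| < d -> `|q.2 - p.2| < d -> A q].
  exists (Num.min d' 1); split; [by rewrite lt_min d'0 /= | by rewrite ge_min lexx orbT |].
  by move=> q; rewrite !lt_min => /andP[a1 _] /andP[a2 _]; exact: dA'.
have W0 : 0 < `|w.1| + `|w.2| + 1 by rewrite ltr_wpDl // addr_ge0.
exists (d / (`|w.1| + `|w.2| + 1)); split; first by rewrite divr_gt0.
  rewrite ler_pdivrMr // mul1r; apply: le_trans d1 _.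
  by rewrite lerDr addr_ge0.
have small (x : R) : `|x| <= `|w.1| + `|w.2| -> `|d / (`|w.1| + `|w.2| + 1) * x| < d.
  move=> xW; rewrite normrM gtr0_norm ?divr_gt0 // mulrAC ltr_pdivrMr // ltr_pM2l //.
  by apply: le_lt_trans xW _; rewrite ltrDl.
by apply: dA; rewrite /displace /= addrC addKr; apply: small; rewrite ?lerDl ?lerDr.
Qed.

Lemma near_lerp (A : set (R * R)) (p w : R * R) : (\forall q \near p, A q) ->
  exists d : R, [/\ 0 < d, d <= 1 & A (lerp p w d)].
Proof.
move=> /(near_displace (w.1 - p.1, w.2 - p.2))[d [d0 d1 Ad]]; exists d; split=> //.
suff -> : lerp p w d = displace p (w.1 - p.1, w.2 - p.2) d by [].
by rewrite /lerp /displace /=; congr pair; ring.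
Qed.

Lemma near_left (A : set (R * R)) (u v p : R * R) : u <> v -> 0 <= cr u v p ->
  (\forall q \near p, A q) -> exists q, A q /\ 0 < cr u v q.
Proof.
move=> uv p0 /(near_displace (- (v.2 - u.2), v.1 - u.1))[d [d0 _ Aq]].
exists (displace p (- (v.2 - u.2), v.1 - u.1) d); split=> //.
have -> : cr u v (displace p (- (v.2 - u.2), v.1 - u.1) d) =
    cr u v p + d * ((v.1 - u.1) ^+ 2 + (v.2 - u.2) ^+ 2).
  by rewrite /cr /displace /=; ring.
apply: ltr_wpDl => //; rewrite pmulr_rgt0 // lt_def addr_ge0 ?sqr_ge0 // andbT.
rewrite paddr_eq0 ?sqr_ge0 // !sqrf_eq0 !subr_eq0; apply/negP => /andP[/eqP E1 /eqP E2].
by apply: uv; case: u v E1 E2 {p0 Aq} => [? ?] [? ?] /= -> ->.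
Qed.

Lemma segment_box (p a b r : R * R) (d : R) :
  `|a.1 - p.1| < d -> `|a.2 - p.2| < d -> `|b.1 - p.1| < d -> `|b.2 - p.2| < d ->
  Defs.segment a b r -> `|r.1 - p.1| < d /\ `|r.2 - p.2| < d.
Proof.
move=> a1 a2 b1 b2 /segmentP[t [/andP[t0 t1] -> ->]].
have conv (x y z : R) : `|x - z| < d -> `|y - z| < d -> `|(1 - t) * x + t * y - z| < d.
  case: (eqVneq t 0) => [->|tn]; first by rewrite subr0 mul1r mul0r addr0.
  have tp : 0 < t by rewrite lt_def tn.
  move=> hx hy; have -> : (1 - t) * x + t * y - z = (1 - t) * (x - z) + t * (y - z) by ring.
  apply: le_lt_trans (ler_normD _ _) _; rewrite !normrM (gtr0_norm tp) ger0_norm ?subr_ge0 //.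
  have -> : d = (1 - t) * d + t * d by ring.
  by apply: ler_ltD; [rewrite ler_wpM2l ?subr_ge0 // ltW | rewrite ltr_pM2l].
by split; apply: conv.
Qed.

Lemma lerp_half_sym (a b : R * R) : lerp a b (1 / 2) = lerp b a (1 / 2).
Proof. by rewrite /lerp; congr pair; field. Qed.

Lemma half01 (F : realFieldType) : 0 < (1 / 2 : F) < 1.
Proof. by apply/andP; split; lra. Qed.

Section Drawing.
Context (n : nat) (e : rel 'I_n) (G : 'I_n -> int * int).
Hypotheses (esym : symmetric e) (eirr : forall u, ~~ e u u) (G_inj : injective G).
Hypothesis planar : planar_straight_line e G.

Lemma pt_inj : injective (pt G).
Proof.
move=> u v [/intr_inj u1 /intr_inj u2]; apply: G_inj.
by case: (G u) (G v) u1 u2 => [? ?] [? ?] /= -> ->.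
Qed.

Lemma edge_neq u v : e u v -> u != v.
Proof. by move=> euv; apply: contraTneq euv => ->. Qed.

Lemma edge_seg_sym u v p : edge_seg G u v p -> edge_seg G v u p.
Proof.
rewrite /edge_seg !segment_dotP => -[c d]; split; first by rewrite cr_swap c oppr0.
by move: d; rewrite /dot ![(p.1 - (pt G v).1) * _]mulrC ![(p.2 - (pt G v).2) * _]mulrC.
Qed.

Lemma segment_pointE (a p : R * R) : Defs.segment a a p -> p = a.
Proof. by move=> /segmentP[t [_]]; case: p a => [x y] [a b] /= -> ->; congr pair; ring. Qed.

Lemma near_notin_drawn p : ~ drawn e G p -> \forall q \near p, ~ drawn e G q.
Proof.
move=> np.
have nv : \forall q \near p, forall v, q <> pt G v.
  apply: (@near_forall _ (fun v q => q <> pt G v)) => v.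
  have : ~ Defs.segment (pt G v) (pt G v) p.
    by move=> /segment_pointE pv; apply: np; left; exists v.
  move=> /near_notin_segment; apply: filterS => q nq qv; apply: nq; rewrite qv.
  by apply/segmentP; exists 0; rewrite lexx ler01; split=> //; ring.
have ne : \forall q \near p, forall u v, e u v -> ~ edge_seg G u v q.
  apply: (@near_forall _ (fun u q => forall v, e u v -> ~ edge_seg G u v q)) => u.
  apply: (@near_forall _ (fun v q => e u v -> ~ edge_seg G u v q)) => v.
  case: (boolP (e u v)) => [euv|_]; last exact: near_all.
  have : ~ edge_seg G u v p by move=> pe; apply: np; right; exists u, v.
  by move=> /near_notin_segment; apply: filterS => q nq _.
near=> q => -[[v]|[u [v [euv]]]]; first by move: v; near: q.
by move: euv; move: u v; near: q.
Unshelve. all: by end_near. Qed.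

Lemma edge_point_neq u v s w : e u v -> 0 < s < 1 -> lerp (pt G u) (pt G v) s <> pt G w.
Proof.
move=> euv /andP[s0 s1] E.
have uv : pt G u <> pt G v by move=> /pt_inj uv; move: (eirr u); rewrite {2}uv euv.
have : edge_seg G u v (pt G w) by rewrite -E; apply: lerp_segment; rewrite !ltW.
move=> /(planar.2 _ _ _ euv)[] wE; subst w; apply: uv; move: E; rewrite /lerp.
  case: (pt G u) (pt G v) => [x y] [x' y'] /= [E1 E2].
  by congr pair; apply: (mulfI (lt0r_neq0 s0)); lra.
case: (pt G u) (pt G v) => [x y] [x' y'] /= [E1 E2].
have s1' : 1 - s != 0 by rewrite subr_eq0 eq_sym lt_eqF.
by congr pair; apply: (mulfI s1'); lra.
Qed.

Lemma edge_point_other u v x y s : e u v -> e x y -> 0 < s < 1 ->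
  edge_seg G x y (lerp (pt G u) (pt G v) s) -> (u = x /\ v = y) \/ (u = y /\ v = x).
Proof.
move=> euv exy s01 xyp; apply: contrapT => ns.
have uvp : edge_seg G u v (lerp (pt G u) (pt G v) s).
  by apply: lerp_segment; case/andP: s01 => s0 s1; rewrite !ltW.
have [w [E _]] := planar.1 _ _ _ _ _ euv exy ns uvp xyp.
exact: edge_point_neq E.
Qed.

(** By planarity an interior point of an edge is off all vertices and all other edges, which are
    finitely many closed sets. *)
Lemma near_edge_drawn u v s : e u v -> 0 < s < 1 ->
  \forall q \near lerp (pt G u) (pt G v) s, drawn e G q -> edge_seg G u v q.
Proof.
move=> euv s01; set p := lerp _ _ _.
have nv : \forall q \near p, forall w, q <> pt G w.
  apply: (@near_forall _ (fun w q => q <> pt G w)) => w.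
  have : ~ Defs.segment (pt G w) (pt G w) p by move=> /segment_pointE; exact: edge_point_neq.
  move=> /near_notin_segment; apply: filterS => q nq qv; apply: nq; rewrite qv.
  by apply/segmentP; exists 0; rewrite lexx ler01; split=> //; ring.
have ne : \forall q \near p, forall x y, e x y -> edge_seg G x y q -> edge_seg G u v q.
  apply: (@near_forall _ (fun x q => forall y, e x y -> edge_seg G x y q -> edge_seg G u v q)) => x.
  apply: (@near_forall _ (fun y q => e x y -> edge_seg G x y q -> edge_seg G u v q)) => y.
  case: (boolP (e x y)) => [exy|_]; last exact: near_all.
  have [pxy|] := pselect (edge_seg G x y p).
    have [[-> ->]|[-> ->]] := edge_point_other euv exy s01 pxy; apply: near_all => q _ //.
    exact: edge_seg_sym.
  by move=> /near_notin_segment; apply: filterS => q nq _ /nq.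
near=> q => -[[w qw]|[x [y [exy]]]]; first by exfalso; move: w qw; near: q.
by move: exy; move: x y; near: q.
Unshelve. all: by end_near. Qed.

Lemma face_not_drawn F q : face e G F -> F q -> ~ drawn e G q.
Proof. by move=> [x [_ ->]] /connected_component_sub. Qed.

Lemma face_absorb F q p : face e G F -> F q ->
  (forall r, Defs.segment q p r -> ~ drawn e G r) -> F p.
Proof.
move=> [x [nx FE]] Fq seg.
have FqE : F = connected_component (~` drawn e G) q.
  by rewrite FE; apply: same_connected_component; rewrite -FE.
rewrite FqE; apply: (connected_component_max (B := Defs.segment q p)) => //.
- by apply/segmentP; exists 0; rewrite lexx ler01; split=> //; ring.
- exact: segment_connected_set.
- by apply/segmentP; exists 1; rewrite lexx ler01; split=> //; ring.
Qed.

Lemma face_component p : ~ drawn e G p ->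
  face e G (connected_component (~` drawn e G) p) /\ connected_component (~` drawn e G) p p.
Proof. by move=> np; split; [exists p | exact: connected_component_refl]. Qed.

Lemma face_eq F F' p : face e G F -> face e G F' -> F p -> F' p -> F = F'.
Proof.
move=> [x [nx FE]] [y [ny F'E]] Fp F'p.
rewrite FE F'E (same_connected_component (y := p)); last by rewrite -FE.
by symmetry; apply: same_connected_component; rewrite -F'E.
Qed.

Lemma face_nonempty F : face e G F -> exists p, F p.
Proof. by move=> [x [nx ->]]; exists x; exact: connected_component_refl. Qed.

(** The left half of a small box around the midpoint is convex and misses the drawing, hence lies in
    one face. *)
Lemma edge_side_face x y : e x y -> exists F, face e G F /\
  \forall q \near lerp (pt G x) (pt G y) (1 / 2), 0 < cr (pt G x) (pt G y) q -> F q.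
Proof.
move=> exy; set m := lerp _ _ _.
have s01 := half01 R.
have xy : pt G x <> pt G y by move=> /pt_inj xy; move: (edge_neq exy); rewrite xy eqxx.
have /near_boxP[d d0 dD] := near_edge_drawn exy s01.
have m0 : cr (pt G x) (pt G y) m = 0 by rewrite cr_lerp !cr_aab; ring.
have [q0 [[q01 q02] q0p]] : exists q, (`|q.1 - m.1| < d /\ `|q.2 - m.2| < d) /\ 0 < cr (pt G x) (pt G y) q.
  apply: (@near_left (fun q : R * R => `|q.1 - m.1| < d /\ `|q.2 - m.2| < d) _ _ m) => //.
    by rewrite m0.
  by apply/near_boxP; exists d.
have nd (q : R * R) : `|q.1 - m.1| < d -> `|q.2 - m.2| < d -> 0 < cr (pt G x) (pt G y) q -> ~ drawn e G q.
  by move=> q1 q2 qp /(dD _ q1 q2) /segment_dotP[E _]; rewrite E ltxx in qp.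
have [fF Fq0] := face_component (nd _ q01 q02 q0p).
exists (connected_component (~` drawn e G) q0); split=> //.
apply/near_boxP; exists d => // q q1 q2 qp.
apply: (face_absorb fF Fq0) => r qr; have [r1 r2] := segment_box q01 q02 q1 q2 qr.
apply: nd => //; move: qr => /segmentP[t [/andP[t0 t1] E1 E2]].
have -> : r = lerp q0 q t by rewrite /lerp -E1 -E2; case: (r).
rewrite cr_lerp; case: (eqVneq t 0) => [->|tn]; first by rewrite subr0 mul1r mul0r addr0.
have tp : 0 < t by rewrite lt_def tn.
have t1p : 0 <= 1 - t by rewrite subr_ge0.
by apply: ltr_wpDl; [apply: mulr_ge0 => //; exact: ltW | exact: mulr_gt0].
Qed.
End Drawing.

(** * Strictly convex faces *)

Definition face_vertices n (G : 'I_n -> int * int) (F : set (R * R)) : {set 'I_n} :=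
  finset (fun v => `[< closure F (pt G v) >]).

Lemma in_face_vertices n (G : 'I_n -> int * int) (F : set (R * R)) v :
  v \in face_vertices G F <-> closure F (pt G v).
Proof. by rewrite inE; split=> /asboolP. Qed.

Lemma conv_hull_convex (A : set (R * R)) (p q r : R * R) :
  conv_hull A p -> conv_hull A q -> Defs.segment p q r -> conv_hull A r.
Proof.
move=> /conv_hullP[m1 [q1 [l1 [Aq1 l10 s1 p1 p2]]]] /conv_hullP[m2 [q2 [l2 [Aq2 l20 s2 q1E q2E]]]].
move=> /segmentP[t [/andP[t0 t1] r1 r2]]; apply/conv_hullP.
pose pts i := match fintype.split i with inl j => q1 j | inr j => q2 j end.
pose wts i := match fintype.split i with inl j => (1 - t) * l1 j | inr j => t * l2 j end.
have sumE (g : R * R -> R) : \sum_(i < m1 + m2) wts i * g (pts i) =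
    (1 - t) * \sum_(i < m1) l1 i * g (q1 i) + t * \sum_(i < m2) l2 i * g (q2 i).
  rewrite big_split_ord !mulr_sumr; congr (_ + _); apply: eq_bigr => i _.
    by rewrite /wts /pts (unsplitK (inl i)) mulrA.
  by rewrite /wts /pts (unsplitK (inr i)) mulrA.
exists (m1 + m2)%nat, pts, wts; split.
- by move=> i; rewrite /pts; case: fintype.split.
- by move=> i; rewrite /wts; case: fintype.split => j; rewrite mulr_ge0 // subr_ge0.
- have sum1 (m : nat) (l : 'I_m -> R) : \sum_(i < m) l i * 1 = \sum_(i < m) l i.
    by apply: eq_bigr => i _; rewrite mulr1.
  by have := sumE (fun=> 1); rewrite !sum1 s1 s2 => ->; ring.
- by rewrite (sumE fst) -p1 -q1E.
- by rewrite (sumE snd) -p2 -q2E.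
Qed.

Lemma collinear_lerp (u v x : R * R) : u <> v -> cr u v x = 0 -> exists a : R, x = lerp u v a.
Proof.
case: u v x => [ux uy] [vx vy] [x y] uv; rewrite /cr /lerp /= => c0.
case: (eqVneq (vx - ux) 0) => [d1|d1].
  case: (eqVneq (vy - uy) 0) => [d2|d2].
    by case: uv; congr pair; lra.
  exists ((y - uy) / (vy - uy)); congr pair.
    have : (vy - uy) * (x - ux) = 0 by rewrite d1 in c0; lra.
    move=> /eqP; rewrite mulf_eq0 (negbTE d2) /= subr_eq0 => /eqP ->.
    by have -> : vx = ux; [lra | ring].
  by field.
exists ((x - ux) / (vx - ux)); congr pair; first by field.
have E : (vx - ux) * y = (vx - ux) * uy + (vy - uy) * (x - ux) by lra.
by apply: (mulfI d1); rewrite E; field.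
Qed.

Lemma lerp_inj (u v : R * R) (s s' : R) : u <> v -> lerp u v s = lerp u v s' -> s = s'.
Proof.
move=> uv; rewrite /lerp => -[E1 E2]; apply: contrapT => ss; apply: uv.
have nz : s - s' != 0 by rewrite subr_eq0; apply/eqP.
case: u v E1 E2 => [x y] [x' y'] /= E1 E2.
by congr pair; apply: (mulfI nz); lra.
Qed.

Lemma lerp_between (u v : R * R) a b c : a <= c -> c <= b -> a < b ->
  Defs.segment (lerp u v a) (lerp u v b) (lerp u v c).
Proof.
move=> ac cb ab; have ba : b - a != 0 by rewrite subr_eq0 gt_eqF.
apply/segmentP; exists ((c - a) / (b - a)); split; [|by rewrite /=; field|by rewrite /=; field].
by rewrite divr_ge0 ?subr_ge0 ?(ltW ab) //= ler_pdivrMr ?subr_gt0 // mul1r lerD2r.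
Qed.

Section ConvexFace.
Context (n : nat) (e : rel 'I_n) (G : 'I_n -> int * int).
Hypotheses (esym : symmetric e) (eirr : forall u, ~~ e u u) (G_inj : injective G).
Hypothesis planar : planar_straight_line e G.
Context (F : set (R * R)).
Hypotheses (faceF : face e G F) (scF : strictly_convex_face G F).

Let P := face_vertices G F.
Let A : set (R * R) := [set p | exists2 v, v \in P & p = pt G v].

Lemma face_hullE : F = interior (conv_hull A).
Proof.
have [FE _] := scF; rewrite [LHS]FE; congr (interior (conv_hull _)).
by apply/seteqP; split=> p [v vP ->]; exists v => //; apply/in_face_vertices.
Qed.

Lemma face_sub_hull p : F p -> conv_hull A p.
Proof. by rewrite face_hullE => /interior_subset. Qed.

Lemma face_near p : F p -> \forall q \near p, F q.
Proof. by rewrite face_hullE => Fp; exact: (nbhs_interior Fp). Qed.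

Lemma near_hull_face p : (\forall q \near p, conv_hull A q) -> F p.
Proof. by rewrite face_hullE. Qed.

Lemma face_vertex v : v \in P -> A (pt G v).
Proof. by move=> vP; exists v. Qed.

Lemma face_vertex_not_hull v : v \in P ->
  ~ conv_hull [set p | exists2 w, w \in P /\ w <> v & p = pt G w] (pt G v).
Proof.
have [_ sc] := scF; move=> /in_face_vertices /sc nh h; apply: nh.
move: h; congr (conv_hull _ _); apply/seteqP; split=> p [w [wP wv] ->];
  exists w => //; split=> //; exact/in_face_vertices.
Qed.

(** Of three collinear vertices one is between the two others, and a vertex inside a triangle is a
    barycentre of its corners: either way a vertex is in the hull of the others. *)
Lemma face_convex_position : convex_position (pt G) P.
Proof.
have inj := pt_inj G_inj.
have no3 v a b c (al be ga : R) : v \in P -> a \in P -> b \in P -> c \in P ->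
    v != a -> v != b -> v != c -> 0 <= al -> 0 <= be -> 0 <= ga -> al + be + ga = 1 ->
    (pt G v).1 = al * (pt G a).1 + be * (pt G b).1 + ga * (pt G c).1 ->
    (pt G v).2 = al * (pt G a).2 + be * (pt G b).2 + ga * (pt G c).2 -> False.
  move=> vP aP bP cP va vb vc *; apply: (face_vertex_not_hull vP).
  apply: (@conv_hull3 _ (pt G a) (pt G b) (pt G c) _ al be ga) => //.
  - by exists a => //; split=> //; apply/eqP; rewrite eq_sym.
  - by exists b => //; split=> //; apply/eqP; rewrite eq_sym.
  - by exists c => //; split=> //; apply/eqP; rewrite eq_sym.
have no2 v a b : v \in P -> a \in P -> b \in P -> v != a -> v != b ->
    Defs.segment (pt G a) (pt G b) (pt G v) -> False.
  move=> vP aP bP va vb /segmentP[t [/andP[t0 t1] v1 v2]].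
  by apply: (no3 v a b b (1 - t) t 0) => //; rewrite ?subr_ge0 ?v1 ?v2 //; ring.
split=> [a b c aP bP cP ab bc ac|v a b c vP aP bP cP vab vbc].
  apply/eqP => c0.
  have bca : cr (pt G b) (pt G c) (pt G a) = 0 by rewrite cr_rot.
  have cab : cr (pt G c) (pt G a) (pt G b) = 0 by rewrite cr_rot.
  have d1 : 0 < dot (pt G a) (pt G b) (pt G c).
    rewrite ltNge; apply/negP => d; apply: (no2 c a b) => //; rewrite 1?eq_sym //.
    by apply/segment_dotP.
  have d2 : 0 < dot (pt G b) (pt G c) (pt G a).
    rewrite ltNge; apply/negP => d; apply: (no2 a b c) => //.
    by apply/segment_dotP.
  have d3 : 0 < dot (pt G c) (pt G a) (pt G b).
    rewrite ltNge; apply/negP => d; apply: (no2 b c a) => //; rewrite 1?eq_sym //.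
    by apply/segment_dotP.
  move: c0 d1 d2 d3; rewrite /cr /dot.
  move: (pt G a) (pt G b) (pt G c) => [ax ay] [bx by'] [cx cy] /= c0 d1 d2 d3.
  (* If no point is between the two others, the three scalar products are positive and make the
     Cauchy-Schwarz inequality for [b - a] and [c - a] strict, whereas Lagrange's identity and
     collinearity make it an equality. *)
  have p0 : (cx - ax) * (bx - ax) + (cy - ay) * (by' - ay) > 0 by move: d2; lra.
  have : ((cx - ax) * (bx - ax) + (cy - ay) * (by' - ay)) ^+ 2 <
     ((cx - ax) ^+ 2 + (cy - ay) ^+ 2) * ((bx - ax) ^+ 2 + (by' - ay) ^+ 2).
    rewrite expr2; apply: ltr_pM; rewrite ?ltW //; [move: d1 | move: d3]; lra.
  apply/negP; rewrite -leNgt -subr_ge0.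
  have -> : ((cx - ax) * (bx - ax) + (cy - ay) * (by' - ay)) ^+ 2 -
     ((cx - ax) ^+ 2 + (cy - ay) ^+ 2) * ((bx - ax) ^+ 2 + (by' - ay) ^+ 2) =
     - ((bx - ax) * (cy - ay) - (by' - ay) * (cx - ax)) ^+ 2 by ring.
  by rewrite c0 expr0n oppr0.
rewrite leNgt; apply/negP => vca.
set S := cr (pt G v) (pt G a) (pt G b) + cr (pt G v) (pt G b) (pt G c) + cr (pt G v) (pt G c) (pt G a).
have S0 : 0 < S by apply: addr_gt0 => //; apply: addr_gt0.
have Sn : S != 0 by rewrite gt_eqF.
have nv x y : 0 < cr (pt G v) (pt G x) (pt G y) -> v != x.
  by apply: contraTneq => ->; rewrite cr_aab ltxx.
apply: (no3 v a b c (cr (pt G v) (pt G b) (pt G c) / S) (cr (pt G v) (pt G c) (pt G a) / S)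
  (cr (pt G v) (pt G a) (pt G b) / S)) => //; rewrite ?divr_ge0 ?(ltW S0) ?(ltW vab) ?(ltW vbc) ?(ltW vca) //.
- exact: nv vab.
- exact: nv vbc.
- exact: nv vca.
- by apply: (mulfI Sn); rewrite !mulrDr !(mulrCA S) divff // /S; ring.
- have E : S * (pt G v).1 = cr (pt G v) (pt G b) (pt G c) * (pt G a).1 +
      cr (pt G v) (pt G c) (pt G a) * (pt G b).1 + cr (pt G v) (pt G a) (pt G b) * (pt G c).1.
    by rewrite /S /cr; ring.
  by apply: (mulfI Sn); rewrite E; field.
- have E : S * (pt G v).2 = cr (pt G v) (pt G b) (pt G c) * (pt G a).2 +
      cr (pt G v) (pt G c) (pt G a) * (pt G b).2 + cr (pt G v) (pt G a) (pt G b) * (pt G c).2.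
    by rewrite /S /cr; ring.
  by apply: (mulfI Sn); rewrite E; field.
Qed.

(** [F] is open and nonempty, and contained in the hull of its vertices: these cannot all be on one
    line. *)
Lemma face_off_line (al be ga : R) : al != 0 \/ be != 0 ->
  exists2 v, v \in P & al * (pt G v).1 + be * (pt G v).2 + ga != 0.
Proof.
move=> nz; apply: contrapT => noline.
have on v : v \in P -> al * (pt G v).1 + be * (pt G v).2 + ga = 0.
  by move=> vP; apply/eqP/negPn/negP => ne; apply: noline; exists v.
have onF q : F q -> al * q.1 + be * q.2 + ga = 0.
  move=> /face_sub_hull hq; apply: le_anti; apply/andP; split.
    rewrite -oppr_ge0; have -> : - (al * q.1 + be * q.2 + ga) = - al * q.1 + - be * q.2 + - ga by ring.
    apply: conv_hull_halfplane hq => _ [v vP ->].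
    by rewrite !mulNr -!opprD on // oppr0.
  by apply: conv_hull_halfplane hq => _ [v vP ->]; rewrite on.
have [c Fc] := face_nonempty faceF.
have /near_boxP[d d0 dF] := face_near Fc.
have dd : 0 < d / 2 by rewrite divr_gt0.
have dd' : `|d / 2| < d by rewrite gtr0_norm //; lra.
have Ec := onF _ Fc; case: nz => nz.
  have Fq : F (c.1 + d / 2, c.2) by apply: dF; rewrite /= ?subrr ?normr0 // addrAC subrr add0r.
  have := onF _ Fq; rewrite /= => Eq; have : al * (d / 2) = 0 by move: Eq Ec; lra.
  by move=> /eqP; rewrite mulf_eq0 (negbTE nz) gt_eqF.
have Fq : F (c.1, c.2 + d / 2) by apply: dF; rewrite /= ?subrr ?normr0 // addrAC subrr add0r.
have := onF _ Fq; rewrite /= => Eq; have : be * (d / 2) = 0 by move: Eq Ec; lra.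
by move=> /eqP; rewrite mulf_eq0 (negbTE nz) gt_eqF.
Qed.

Arguments face_off_line : clear scopes.

Lemma face_vertices_ge3 : leq 3 #|P|.
Proof.
have [u uP _] := @face_off_line 1 0 0 (or_introl (oner_neq0 R)).
have [v vP] := @face_off_line 1 0 (- (pt G u).1) (or_introl (oner_neq0 R)).
rewrite mul1r mul0r addr0 subr_eq0 => vu.
have nz : - ((pt G v).2 - (pt G u).2) != 0 \/ (pt G v).1 - (pt G u).1 != 0.
  by right; rewrite subr_eq0.
have [w wP] := @face_off_line _ _ ((pt G u).1 * (pt G v).2 - (pt G u).2 * (pt G v).1) nz.
have -> : - ((pt G v).2 - (pt G u).2) * (pt G w).1 + ((pt G v).1 - (pt G u).1) * (pt G w).2 +
   ((pt G u).1 * (pt G v).2 - (pt G u).2 * (pt G v).1) = cr (pt G u) (pt G v) (pt G w).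
  by rewrite /cr; ring.
move=> uvw.
have uv : u != v by apply: contraNneq vu => ->.
have uw : u != w by apply: contraNneq uvw => ->; rewrite cr_aab.
have vw : v != w by apply: contraNneq uvw => ->; rewrite cr_aab.
have : [set u; v; w]%SET \subset P.
  by apply/fintype.subsetP => z /finset.setUP[/set2P[]|/set1P] ->.
move=> /subset_leq_card; apply: leq_trans.
by rewrite -finset.setUA !cardsU1 cards1 !inE negb_or uv uw vw.
Qed.

Lemma near_side_hull u v z s : u \in P -> v \in P -> z \in P -> 0 < s < 1 ->
  0 < cr (pt G u) (pt G v) (pt G z) ->
  \forall q \near lerp (pt G u) (pt G v) s, 0 <= cr (pt G u) (pt G v) q -> conv_hull A q.
Proof.
move=> uP vP zP /andP[s0 s1] uvz; set m := lerp _ _ _.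
have mv : 0 < cr (pt G v) (pt G z) m.
  rewrite cr_lerp cr_aab mulr0 addr0 cr_rot mulr_gt0 // ?subr_gt0 //.
have mu : 0 < cr (pt G z) (pt G u) m.
  by rewrite cr_lerp cr_aab mulr0 add0r cr_rot cr_rot mulr_gt0.
have n1 := near_gt0 (@cr_continuous _ _) mv; have n2 := near_gt0 (@cr_continuous _ _) mu.
apply: filterS2 n1 n2 => q q1 q2 q0.
by apply: (conv_hull_triangle (face_vertex uP) (face_vertex vP) (face_vertex zP)) => //; exact: ltW.
Qed.

Lemma near_side_face u v z s : u \in P -> v \in P -> z \in P -> 0 < s < 1 ->
  0 < cr (pt G u) (pt G v) (pt G z) ->
  \forall q \near lerp (pt G u) (pt G v) s, 0 < cr (pt G u) (pt G v) q -> F q.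
Proof.
move=> uP vP zP s01 uvz.
have /near_boxP[d d0 dH] := near_side_hull uP vP zP s01 uvz.
apply/near_boxP; exists (d / 2); first by rewrite divr_gt0.
move=> q q1 q2 q0; apply: near_hull_face.
have /near_boxP[d' d'0 dC] := near_gt0 (@cr_continuous (pt G u) (pt G v)) q0.
apply/near_boxP; exists (Num.min d' (d / 2)); first by rewrite lt_min d'0 divr_gt0.
move=> q'; rewrite !lt_min => /andP[a1 a2] /andP[b1 b2].
have tri (x y z' : R) : `|x - y| < d / 2 -> `|y - z'| < d / 2 -> `|x - z'| < d.
  by move=> xy yz; rewrite [d]splitr; exact: le_lt_trans (ler_distD y x z') (ltrD xy yz).
by apply: dH; [apply: tri a2 q1 | apply: tri b2 q2 | apply/ltW/dC].
Qed.

Lemma side_point_closure u v z s : u \in P -> v \in P -> z \in P -> 0 < s < 1 ->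
  0 < cr (pt G u) (pt G v) (pt G z) -> closure F (lerp (pt G u) (pt G v) s).
Proof.
move=> uP vP zP s01 uvz B nB.
have uv : pt G u <> pt G v by move=> E; rewrite E cr_aab ltxx in uvz.
have nF := near_side_face uP vP zP s01 uvz.
have := @near_left (fun q => B q /\ (0 < cr (pt G u) (pt G v) q -> F q)) _ _ _ uv _ (filterI nB nF).
rewrite cr_lerp !cr_aab !mulr0 addr0 lexx => /(_ isT)[q [[Bq Fq] q0]].
by exists q; split=> //; exact: Fq.
Qed.

(** With vertices on both sides of [uv], the hull contains a triangle on each side, so the midpoint
    of the edge would be interior to it and belong to [F], although it is drawn. *)
Lemma face_chord_supports u v : u \in P -> v \in P -> e u v ->
  supports (pt G) P u v \/ supports (pt G) P v u.
Proof.
move=> uP vP euv; have uv := edge_neq eirr euv; have vu : v != u by rewrite eq_sym.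
have CP := face_convex_position.
apply: contrapT => /not_orP[ns1 ns2].
have ex (x y : 'I_n) : x \in P -> y \in P -> x != y -> ~ supports (pt G) P x y ->
    exists2 z, z \in P & 0 < cr (pt G y) (pt G x) (pt G z).
  move=> xP yP xy /existsNP[z /not_implyP[zP /not_implyP[zx /not_implyP[zy]]]].
  move=> /negP; rewrite -leNgt => z0; exists z => //.
  rewrite cr_swap oppr_gt0 lt_neqAle z0 andbT; apply: CP.1 => //; by rewrite eq_sym.
have [z zP vuz] := ex u v uP vP uv ns1.
have [z' z'P uvz'] := ex v u vP uP vu ns2.
have n1 := near_side_hull uP vP z'P (half01 R) uvz'.
have n2 := near_side_hull vP uP zP (half01 R) vuz.
have Fm : F (lerp (pt G u) (pt G v) (1 / 2)).
  apply: near_hull_face; rewrite lerp_half_sym in n2.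
  apply: filterS2 n1 n2 => q q1 q2.
  by case/orP: (le_total 0 (cr (pt G u) (pt G v) q)) => [/q1 //|q0]; apply: q2; rewrite cr_swap oppr_ge0.
apply: (face_not_drawn faceF Fm); right; exists u, v; split=> //.
by apply: lerp_segment; have /andP[h0 h1] := half01 R; rewrite !ltW.
Qed.

Lemma supports_ge0 u v p : u \in P -> v \in P -> supports (pt G) P u v ->
  conv_hull A p -> 0 <= cr (pt G u) (pt G v) p.
Proof.
move=> uP vP sp; apply: conv_hull_cr => _ [z zP ->].
case: (eqVneq z u) => [->|zu]; first by rewrite cr_aab.
case: (eqVneq z v) => [->|zv]; first by rewrite cr_aab.
exact/ltW/sp.
Qed.

Lemma lerp_neq (a b : R * R) s : a <> b -> 0 < s < 1 -> lerp a b s <> a /\ lerp a b s <> b.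
Proof.
move=> ab /andP[s0 s1]; have s1n : 1 - s != 0 by rewrite subr_eq0 eq_sym lt_eqF.
split; apply: contra_not ab; case: a b => [x y] [x' y']; rewrite /lerp /= => -[E1 E2].
  by congr pair; apply: (mulfI (lt0r_neq0 s0)); lra.
by congr pair; apply: (mulfI s1n); lra.
Qed.

(** The midpoint [m] of the side is approached by [F] without belonging to it, so it is drawn. It is
    not a vertex, since a vertex in the closure of [F] is in [P], hence strictly left of [uv] unless
    it is [u] or [v]; so [m] is on an edge [xy]. Neither end is left of [uv], or the edge would
    enter [F]; as [m] is between them, both are on the line. No vertex is inside the side, so [xy]
    contains [u] and [v], which planarity identifies with its ends. *)
Lemma supports_edge u v : u \in P -> v \in P -> u != v -> supports (pt G) P u v -> e u v.
Proof.
move=> uP vP uv sp; set m := lerp (pt G u) (pt G v) (1 / 2).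
have puv : pt G u <> pt G v by move=> /(pt_inj G_inj) E; rewrite E eqxx in uv.
have [z [zP zu zv]] := card_ge3_other u v face_vertices_ge3.
have uvz := sp z zP zu zv.
have m0 : cr (pt G u) (pt G v) m = 0 by rewrite cr_lerp !cr_aab; ring.
have nF := near_side_face uP vP zP (half01 R) uvz; rewrite -/m in nF.
have mF : ~ F m.
  move=> /face_near nFm; have pvu : pt G v <> pt G u by move=> E; apply: puv.
  have [|q [Fq]] := near_left pvu _ nFm; first by rewrite cr_swap m0 oppr0.
  by rewrite cr_swap oppr_gt0 ltNge (supports_ge0 uP vP sp (face_sub_hull Fq)).
have no_vertex w : m <> pt G w.
  move=> mw; have wP : w \in P.
    by apply/in_face_vertices; rewrite -mw; exact: (side_point_closure uP vP zP (half01 R) uvz).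
  have [mu mv] := lerp_neq puv (half01 R).
  have wu : w != u by apply/eqP => E; apply: mu; rewrite -/m mw E.
  have wv : w != v by apply/eqP => E; apply: mv; rewrite -/m mw E.
  by have := sp w wP wu wv; rewrite -mw m0 ltxx.
have : drawn e G m.
  apply: contrapT => /near_notin_drawn nD.
  have /near_boxP[d d0 dB] := nD.
  have nB : \forall q \near m, `|q.1 - m.1| < d /\ `|q.2 - m.2| < d by apply/near_boxP; exists d.
  have := @near_left (fun q => (`|q.1 - m.1| < d /\ `|q.2 - m.2| < d) /\
     (0 < cr (pt G u) (pt G v) q -> F q)) _ _ _ puv _ (filterI nB nF).
  rewrite m0 lexx => /(_ isT)[q [[[q1 q2] Fq] q0]].
  apply: mF; apply: (face_absorb faceF (Fq q0)) => r qr.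
  have mm : `|m.1 - m.1| < d /\ `|m.2 - m.2| < d by rewrite !subrr normr0.
  by have [r1 r2] := segment_box q1 q2 mm.1 mm.2 qr; exact: dB.
case=> [[w /no_vertex //]|[x [y [exy /segmentP[t [t01 t1 t2]]]]]].
have mE : m = lerp (pt G x) (pt G y) t by rewrite /lerp -t1 -t2; case: (m).
have /andP[t0 t1'] := t01.
have xm r : Defs.segment m (pt G x) r -> drawn e G r.
  move=> /segmentP[s [/andP[s0 s1] r1 r2]]; right; exists x, y; split=> //.
  apply/segmentP; exists (t * (1 - s)); split.
  - by apply/andP; split; nra.
  - by rewrite r1 t1; ring.
  - by rewrite r2 t2; ring.
have ym r : Defs.segment m (pt G y) r -> drawn e G r.
  move=> /segmentP[s [/andP[s0 s1] r1 r2]]; right; exists x, y; split=> //.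
  apply/segmentP; exists (t + s * (1 - t)); split.
  - by apply/andP; split; nra.
  - by rewrite r1 t1; ring.
  - by rewrite r2 t2; ring.
have out w : (forall r, Defs.segment m (pt G w) r -> drawn e G r) -> cr (pt G u) (pt G v) (pt G w) <= 0.
  move=> wm; rewrite leNgt; apply/negP => w0.
  have [d [d0 d1 Fd]] := near_lerp (pt G w) nF.
  have : F (lerp m (pt G w) d) by apply: Fd; rewrite cr_lerp m0 mulr0 add0r mulr_gt0.
  by move=> /(face_not_drawn faceF); apply; apply/wm/lerp_segment; rewrite d1 ltW.
have X0 := out x xm; have Y0 := out y ym.
have sum0 : (1 - t) * cr (pt G u) (pt G v) (pt G x) + t * cr (pt G u) (pt G v) (pt G y) = 0.
  by rewrite -cr_lerp -mE.
have tn0 : t != 0.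
  by apply/eqP => t00; apply: (no_vertex x); rewrite mE t00 /lerp subr0 !mul1r !mul0r !addr0; case: (pt G x).
have tn1 : t != 1.
  by apply/eqP => t11; apply: (no_vertex y); rewrite mE t11 /lerp subrr !mul1r !mul0r !add0r; case: (pt G y).
have tp : 0 < t by rewrite lt_def tn0.
have t1p : t < 1 by rewrite lt_neqAle tn1.
have X00 : cr (pt G u) (pt G v) (pt G x) = 0 by nra.
have Y00 : cr (pt G u) (pt G v) (pt G y) = 0 by nra.
have [a xa] := collinear_lerp puv X00; have [b yb] := collinear_lerp puv Y00.
have ab : (1 - t) * a + t * b = 1 / 2.
  apply: (lerp_inj puv); rewrite -/m mE xa yb /lerp /=; congr pair; ring.
have notin w (s : R) : pt G w = lerp (pt G u) (pt G v) s -> ~ (0 < s < 1).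
  move=> ws s01; have wP : w \in P.
    by apply/in_face_vertices; rewrite ws; exact: (side_point_closure uP vP zP s01 uvz).
  have [mu mv] := lerp_neq puv s01.
  have wu : w != u by apply/eqP => E; apply: mu; rewrite -ws E.
  have wv : w != v by apply/eqP => E; apply: mv; rewrite -ws E.
  by have := sp w wP wu wv; rewrite ws cr_lerp !cr_aab !mulr0 addr0 ltxx.
have outside w (s : R) : pt G w = lerp (pt G u) (pt G v) s -> s <= 0 \/ 1 <= s.
  move=> /notin /negP; rewrite negb_and -!leNgt => /orP[]; by [left|right].
have lerp0 : lerp (pt G u) (pt G v) 0 = pt G u.
  by rewrite /lerp subr0 !mul1r !mul0r !addr0; case: (pt G u).
have lerp1 : lerp (pt G u) (pt G v) 1 = pt G v.
  by rewrite /lerp subrr !mul1r !mul0r !add0r; case: (pt G v).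
have [uxy vxy] : edge_seg G x y (pt G u) /\ edge_seg G x y (pt G v).
  have [a0|a1] := outside _ _ xa; have [b0|b1] := outside _ _ yb.
  - have h1 : (1 - t) * a <= 0 by rewrite mulr_ge0_le0 // subr_ge0.
    have h2 : t * b <= 0 by rewrite mulr_ge0_le0.
    by have := lerD h1 h2; rewrite ab addr0 leNgt; have /andP[-> _] := half01 R.
  - rewrite /edge_seg xa yb -[X in _ X /\ _]lerp0 -[X in _ /\ _ X]lerp1.
    have ab01 := lt_le_trans (le_lt_trans a0 ltr01) b1.
    by split; apply: lerp_between => //; [exact: le_trans ler01 b1 | exact: le_trans a0 ler01].
  - split; apply: edge_seg_sym; rewrite /edge_seg xa yb -1?[X in _ X]lerp0 -1?[X in _ X]lerp1.
      by apply: lerp_between (le_trans ler01 a1) (lt_le_trans (le_lt_trans b0 ltr01) a1).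
    by apply: lerp_between (le_trans b0 ler01) a1 (lt_le_trans (le_lt_trans b0 ltr01) a1).
  - have h1 : 1 - t <= (1 - t) * a by rewrite ler_peMr // subr_ge0.
    have h2 : t <= t * b by rewrite ler_peMr.
    by have := lerD h1 h2; rewrite ab subrK leNgt; have /andP[_ ->] := half01 R.
have ux := planar.2 _ _ _ exy uxy; have vx := planar.2 _ _ _ exy vxy.
by case: ux => ux; case: vx => vx; subst; rewrite ?eqxx // in uv *; rewrite esym.
Qed.

Lemma face_convex p q r : F p -> F q -> Defs.segment p q r -> F r.
Proof.
move=> /face_near/near_boxP[d1 d10 F1] /face_near/near_boxP[d2 d20 F2] /segmentP[t [t01 r1 r2]].
apply: near_hull_face; apply/near_boxP; exists (Num.min d1 d2); first by rewrite lt_min d10.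
move=> s; rewrite !lt_min => /andP[a1 a2] /andP[b1 b2].
have Fp : F (p.1 + (s.1 - r.1), p.2 + (s.2 - r.2)) by apply: F1; rewrite /= addrAC subrr add0r.
have Fq : F (q.1 + (s.1 - r.1), q.2 + (s.2 - r.2)) by apply: F2; rewrite /= addrAC subrr add0r.
apply: conv_hull_convex (face_sub_hull Fp) (face_sub_hull Fq) _.
by apply/segmentP; exists t; split=> //=; rewrite ?r1 ?r2; ring.
Qed.

(** If [F] touches [xy] from the left at its midpoint, then [xy] is a side of [F]. Indeed [F] is
    left of the line [xy] and has vertices on this line on both sides of [m]; they span a side,
    which is an edge, and an edge through [m] is [xy]. *)
Lemma edge_side_vertices x y : e x y ->
  (\forall q \near lerp (pt G x) (pt G y) (1 / 2), 0 < cr (pt G x) (pt G y) q -> F q) ->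
  [/\ x \in P, y \in P & supports (pt G) P x y].
Proof.
move=> exy; set m := lerp _ _ _ => nF.
have half := half01 R; have CP := face_convex_position.
have xy : pt G x <> pt G y by move=> /(pt_inj G_inj) E; move: (eirr x); rewrite {2}E exy.
have m0 : cr (pt G x) (pt G y) m = 0 by rewrite cr_lerp !cr_aab; ring.
have mD : drawn e G m.
  right; exists x, y; split=> //; apply: lerp_segment.
  by have /andP[h0 h1] := half; rewrite !ltW.
(* From a point [z] of [F] right of [xy], going slightly past [m] leads to another point of [F]; by
   convexity [m] would be in [F]. *)
have F_ge0 z : F z -> 0 <= cr (pt G x) (pt G y) z.
  move=> Fz; rewrite leNgt; apply/negP => z0.
  have [d [d0 d1 Fd]] := near_displace (m.1 - z.1, m.2 - z.2) nF.
  have Fq : F (displace m (m.1 - z.1, m.2 - z.2) d).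
    apply: Fd.
    have -> : cr (pt G x) (pt G y) (displace m (m.1 - z.1, m.2 - z.2) d) =
      cr (pt G x) (pt G y) m + d * (cr (pt G x) (pt G y) m - cr (pt G x) (pt G y) z).
      by rewrite /cr /displace /=; ring.
    by rewrite m0 add0r sub0r mulr_gt0 // oppr_gt0.
  apply: (face_not_drawn faceF _ mD); apply: (face_convex Fz Fq).
  have d1n : 1 + d != 0 by rewrite gt_eqF // addr_gt0.
  apply/segmentP; exists (1 / (1 + d)); rewrite /displace /=; split; [|by field|by field].
  by rewrite divr_ge0 ?ler01 ?addr_ge0 ?(ltW d0) //= ler_pdivrMr ?addr_gt0 // mul1r lerDl ltW.
have P_ge0 v : v \in P -> 0 <= cr (pt G x) (pt G y) (pt G v).
  move=> /in_face_vertices clv; rewrite leNgt; apply/negP => v0.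
  have : 0 < cr (pt G y) (pt G x) (pt G v) by rewrite cr_swap oppr_gt0.
  move=> /(near_gt0 (@cr_continuous _ _)) /clv[q [/F_ge0 q0]].
  by rewrite /= cr_swap oppr_gt0 ltNge q0.
pose N := ((pt G y).1 - (pt G x).1) ^+ 2 + ((pt G y).2 - (pt G x).2) ^+ 2.
have N0 : 0 < N.
  rewrite lt_def addr_ge0 ?sqr_ge0 // andbT paddr_eq0 ?sqr_ge0 // !sqrf_eq0 !subr_eq0.
  apply/negP => /andP[/eqP E1 /eqP E2]; apply: xy.
  by case: (pt G x) (pt G y) E1 E2 => [? ?] [? ?] /= -> ->.
pose T (q : R * R) := (q.1 - (pt G x).1) * ((pt G y).1 - (pt G x).1) +
                      (q.2 - (pt G x).2) * ((pt G y).2 - (pt G x).2).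
(* Otherwise, for [K] large, [- eps * (T q - T m) + K * cr x y q >= 0] on the vertices, hence on [F];
   but this fails close to [m], slightly inside [F], in the direction [eps * (y - x)]. *)
have collinear_vertex (eps : R) : eps * eps = 1 ->
    exists v, [/\ v \in P, cr (pt G x) (pt G y) (pt G v) = 0 & 0 < eps * (T (pt G v) - T m)].
  move=> eps2; apply: contrapT => none.
  have on_line v : v \in P -> cr (pt G x) (pt G y) (pt G v) = 0 -> eps * (T (pt G v) - T m) <= 0.
    by move=> vP c0; rewrite leNgt; apply/negP => v0; apply: none; exists v.
  pose term v := `|eps * (T (pt G v) - T m)| / cr (pt G x) (pt G y) (pt G v).
  pose K := \sum_(v in P) term v.
  have term0 v : v \in P -> 0 <= term v by move=> vP; rewrite divr_ge0 // P_ge0.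
  have K0 : 0 <= K by apply: sumr_ge0.
  have hull_ge q : conv_hull A q -> 0 <= - eps * (T q - T m) + K * cr (pt G x) (pt G y) q.
    have E r : - eps * (T r - T m) + K * cr (pt G x) (pt G y) r =
      (- eps * ((pt G y).1 - (pt G x).1) - K * ((pt G y).2 - (pt G x).2)) * r.1 +
      (- eps * ((pt G y).2 - (pt G x).2) + K * ((pt G y).1 - (pt G x).1)) * r.2 +
      (eps * ((pt G x).1 * ((pt G y).1 - (pt G x).1) + (pt G x).2 * ((pt G y).2 - (pt G x).2) + T m)
       - K * (((pt G y).1 - (pt G x).1) * (pt G x).2 - ((pt G y).2 - (pt G x).2) * (pt G x).1)).
      by rewrite /T /cr; ring.
    rewrite E; apply: conv_hull_halfplane => _ [v vP ->]; rewrite -E.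
    case: (eqVneq (cr (pt G x) (pt G y) (pt G v)) 0) => [c0|cn].
      by rewrite c0 mulr0 addr0 mulNr oppr_ge0 on_line.
    have c0 : 0 < cr (pt G x) (pt G y) (pt G v) by rewrite lt_def cn P_ge0.
    have : term v * cr (pt G x) (pt G y) (pt G v) <= K * cr (pt G x) (pt G y) (pt G v).
      rewrite ler_pM2r // /K (bigD1 v) //= lerDl; apply: sumr_ge0 => w /andP[wP _]; exact: term0.
    rewrite /term divfK // => tK; rewrite addrC mulNr subr_ge0.
    exact: le_trans (ler_norm _) tK.
  have K1 : 0 < K + 1 by rewrite ltr_wpDl.
  pose w : R * R :=
    (eps * ((pt G y).1 - (pt G x).1) - ((pt G y).2 - (pt G x).2) / (K + 1),
     eps * ((pt G y).2 - (pt G x).2) + ((pt G y).1 - (pt G x).1) / (K + 1)).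
  have [d [d0 _ Fd]] := near_displace w nF.
  have K1n : K + 1 != 0 by rewrite gt_eqF.
  have crE : cr (pt G x) (pt G y) (displace m w d) = d * N / (K + 1).
    rewrite -[RHS]add0r -m0 /cr /displace /w /N /=; field.
    exact: K1n.
  have TE : T (displace m w d) - T m = d * eps * N.
    by rewrite /T /displace /w /N /=; field.
  have : F (displace m w d) by apply: Fd; rewrite crE divr_gt0 // mulr_gt0.
  move=> /face_sub_hull /hull_ge; rewrite TE crE.
  have -> : - eps * (d * eps * N) + K * (d * N / (K + 1)) = - (eps * eps - K / (K + 1)) * (d * N).
    by field.
  rewrite eps2 mulNr oppr_ge0 pmulr_lle0 ?mulr_gt0 // subr_le0 ler_pdivlMr // mul1r.
  by rewrite gerDl leNgt ltr01.
have [v' [v'P v'0 v'T]] := collinear_vertex 1 (mulr1 1).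
have [u' [u'P u'0 u'T]] := collinear_vertex (- 1) (etrans (mulrNN 1 1) (mulr1 1)).
rewrite mul1r subr_gt0 in v'T; rewrite mulN1r oppr_gt0 subr_lt0 in u'T.
have uvT := lt_trans u'T v'T.
(* [T] and [cr x y] are coordinates along and across [xy], and this change of coordinates multiplies
   areas by [N]. *)
have simil (a b c : R * R) : N * cr a b c =
   (T b - T a) * (cr (pt G x) (pt G y) c - cr (pt G x) (pt G y) a) -
   (T c - T a) * (cr (pt G x) (pt G y) b - cr (pt G x) (pt G y) a).
  by rewrite /N /T /cr; ring.
have u'v' : u' != v' by apply: contraTneq uvT => ->; rewrite ltxx.
have sp : supports (pt G) P u' v'.
  move=> z zP zu zv; rewrite lt_def; apply/andP; split.
    by apply: CP.1; rewrite // eq_sym.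
  rewrite -(pmulr_rge0 _ N0) simil u'0 v'0 !subr0 mulr0 subr0.
  by apply: mulr_ge0; [rewrite subr_ge0 ltW | exact: P_ge0].
have euv := supports_edge u'P v'P u'v' sp.
have muv : edge_seg G u' v' m.
  apply/segment_dotP; split.
    by apply: (mulfI (lt0r_neq0 N0)); rewrite simil u'0 v'0 m0 !subr0 !mulr0 subr0.
  rewrite -(pmulr_rle0 _ N0).
  have -> : N * dot (pt G u') (pt G v') m = (T m - T (pt G u')) * (T m - T (pt G v')) +
    (cr (pt G x) (pt G y) m - cr (pt G x) (pt G y) (pt G u')) *
    (cr (pt G x) (pt G y) m - cr (pt G x) (pt G y) (pt G v')).
    by rewrite /N /T /cr /dot; ring.
  rewrite m0 u'0 !subr0 mul0r addr0 mulr_ge0_le0 // ?subr_ge0 ?subr_le0; exact: ltW.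
have [[xE yE]|[xE yE]] := edge_point_other eirr G_inj planar exy euv half muv.
  by rewrite xE yE.
move: v'T; rewrite -xE /T subrr mul0r add0r subrr mul0r ltNge => /negP; case.
have -> : (m.1 - (pt G x).1) * ((pt G y).1 - (pt G x).1) +
   (m.2 - (pt G x).2) * ((pt G y).2 - (pt G x).2) = 1 / 2 * N.
  by rewrite /m /lerp /N /=; field.
by rewrite mulr_ge0 // ltW.
Qed.
End ConvexFace.

(** * Crossing parity *)

(* [crosses p a b]: the vertical ray going up from [p] meets the segment [ab], whose end of larger
   abscissa is discarded. *)
Definition crosses (F : realFieldType) (p a b : F * F) : bool :=
  [&& a.1 <= p.1, p.1 < b.1 & cr a b p < 0] || [&& b.1 <= p.1, p.1 < a.1 & 0 < cr a b p].

(** Whether the upward ray sweeps over [w] when its origin moves from [p] to a nearby [q]. *)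
Definition toggle (F : realFieldType) (p q w : F * F) : bool :=
  ((w.1 <= q.1) (+) (w.1 <= p.1)) && (p.2 < w.2).

Lemma crossesC (F : realFieldType) (p a b : F * F) : crosses p a b = crosses p b a.
Proof. by rewrite /crosses orbC [cr b a p]cr_swap oppr_gt0 oppr_lt0. Qed.

Lemma cr_above (F : comPzRingType) (a b p : F * F) :
  cr a b p = (b.1 - p.1) * (p.2 - a.2) + (p.1 - a.1) * (p.2 - b.2).
Proof. by rewrite /cr; ring. Qed.

Lemma near_abscissa_ge (p : R * R) (x : R) : x != p.1 ->
  \forall q \near p, (x <= q.1) = (x <= p.1) /\ x != q.1.
Proof.
move=> xp; apply/near_boxP; exists `|x - p.1|; first by rewrite normr_gt0 subr_eq0.
move=> q q1 _; move: xp q1; rewrite neq_lt => /orP[xp|px].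
  rewrite (ltr0_norm (_ : x - p.1 < 0)) ?subr_lt0 // ltr_norml => /andP[h1 h2].
  by have xq : x < q.1; [lra | rewrite (ltW xp) (ltW xq) lt_eqF].
rewrite (gtr0_norm (_ : 0 < x - p.1)) ?subr_gt0 // ltr_norml => /andP[h1 h2].
by have xq : q.1 < x; [lra | rewrite !leNgt px xq gt_eqF].
Qed.

Lemma near_cr_sign (p a b : R * R) : cr a b p != 0 ->
  \forall q \near p, (cr a b q < 0) = (cr a b p < 0) /\ (0 < cr a b q) = (0 < cr a b p).
Proof.
rewrite neq_lt => /orP[c0|c0].
  have : 0 < cr b a p by rewrite cr_swap oppr_gt0.
  move=> /(near_gt0 (@cr_continuous _ _)); apply: filterS => q.
  by rewrite cr_swap oppr_gt0 => q0; rewrite c0 q0 !ltNge (ltW c0) (ltW q0).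
move: (c0) => /(near_gt0 (@cr_continuous _ _)); apply: filterS => q q0.
by rewrite c0 q0 !ltNge (ltW c0) (ltW q0).
Qed.

Lemma crosses_near_endpoint (p a b : R * R) : ~ Defs.segment a b p -> a.1 = p.1 -> b.1 != p.1 ->
  \forall q \near p, crosses q a b (+) crosses p a b = toggle p q a (+) toggle p q b.
Proof.
move=> nseg ap bp.
have cE : cr a b p = (b.1 - a.1) * (p.2 - a.2) by rewrite /cr ap subrr mulr0 subr0.
have a2 : p.2 != a.2.
  apply/eqP => E; apply: nseg; apply/segmentP; exists 0; rewrite lexx ler01; split=> //.
    by rewrite ap; ring.
  by rewrite E; ring.
have c0 : cr a b p != 0 by rewrite cE mulf_neq0 ?subr_eq0 // ap.
have n1 := near_abscissa_ge bp; have n2 := near_cr_sign c0.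
apply: filterS2 n1 n2 => q [bq bqn] [s1 s2].
have tb : toggle p q b = false by rewrite /toggle bq addbb.
rewrite tb addbF /toggle /crosses s1 s2 ap lexx ltxx bq !andbF orbF /=.
rewrite (ltNge q.1 b.1) bq (ltNge p.1 b.1) (ltNge q.1 p.1); move: bp; rewrite neq_lt => /orP[bp|pb].
  have -> : (b.1 <= p.1) = true by rewrite ltW.
  rewrite /= andbF /= addbF addbT; congr (_ && _).
  by rewrite cE ap nmulr_rgt0 ?subr_lt0.
have -> : (b.1 <= p.1) = false by rewrite leNgt pb.
rewrite /= orbF.
have -> : (cr a b p < 0) = (p.2 < a.2) by rewrite cE ap pmulr_rlt0 ?subr_gt0 // subr_lt0.
by case: (p.1 <= q.1); case: (p.2 < a.2).
Qed.

(** The change is a sum of one term per endpoint, so it cancels around a closed polygon even when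
    the ray sweeps over vertices or vertical edges. *)
Lemma crosses_near (p a b : R * R) : ~ Defs.segment a b p ->
  \forall q \near p, crosses q a b (+) crosses p a b = toggle p q a (+) toggle p q b.
Proof.
move=> nseg; case: (eqVneq a.1 p.1) => [ap|ap]; case: (eqVneq b.1 p.1) => [bp|bp].
- apply: near_all => q; rewrite /crosses /toggle ap bp !lexx !ltxx !andbF /=.
  rewrite (ltNge q.1); case: (p.1 <= q.1) => //=.
  suff -> : (p.2 < a.2) = (p.2 < b.2) by rewrite addbb.
  apply/idP/idP => [pa|pb]; rewrite ltNge; apply/negP => h; apply: nseg; apply/segment_dotP;
    rewrite /cr /dot ap bp !subrr !mul0r !mulr0 ?subr0 ?add0r; split=> //.
    by rewrite mulr_le0_ge0 ?subr_ge0 ?subr_le0 ?(ltW pa).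
  by rewrite mulr_ge0_le0 ?subr_ge0 ?subr_le0 ?(ltW pb).
- exact: crosses_near_endpoint.
- have nseg' : ~ Defs.segment b a p.
    by move=> /segment_dotP[c d]; apply: nseg; apply/segment_dotP; rewrite cr_swap c oppr0 /dot
      mulrC [X in _ + X]mulrC.
  have := crosses_near_endpoint nseg' bp ap; apply: filterS => q.
  by rewrite ![crosses _ b a]crossesC addbC => ->; rewrite addbC.
have n1 := near_abscissa_ge ap; have n2 := near_abscissa_ge bp.
have n3 : \forall q \near p, crosses q a b = crosses p a b.
  case: (eqVneq (cr a b p) 0) => [c0|/near_cr_sign n3]; last first.
    apply: filterS3 n1 n2 n3 => q [aq aqn] [bq bqn] [s1 s2].
    by rewrite /crosses aq bq s1 s2 !(ltNge q.1) aq bq -!ltNge.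
  (* A point on the line [ab] but off the segment has its abscissa outside that of the segment, so
     no ray from nearby crosses it. *)
  have same : (a.1 <= p.1) = (b.1 <= p.1).
    apply/idP/idP => [pa|pb]; rewrite leNgt; apply/negP => h.
      have ab : 0 < b.1 - a.1 by lra.
      apply: nseg; apply/segmentP; exists ((p.1 - a.1) / (b.1 - a.1)).
      have abn : b.1 - a.1 != 0 by rewrite gt_eqF.
      split; first by apply/andP; split; [apply: divr_ge0 | rewrite ler_pdivrMr // mul1r]; lra.
        by field.
      have E : (b.1 - a.1) * p.2 = (b.1 - a.1) * a.2 + (b.2 - a.2) * (p.1 - a.1).
        by move: c0; rewrite /cr; lra.
      by apply: (mulfI abn); rewrite E; field.
    have ab : 0 < a.1 - b.1 by lra.
    apply: nseg; apply/segmentP; exists ((a.1 - p.1) / (a.1 - b.1)).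
    have abn : a.1 - b.1 != 0 by rewrite gt_eqF.
    split; first by apply/andP; split; [apply: divr_ge0 | rewrite ler_pdivrMr // mul1r]; lra.
      by field.
    have E : (a.1 - b.1) * p.2 = (a.1 - b.1) * a.2 - (b.2 - a.2) * (p.1 - a.1).
      by move: c0; rewrite /cr; lra.
    by apply: (mulfI abn); rewrite E; field.
  have nocross r : (a.1 <= r.1) = (b.1 <= r.1) -> crosses r a b = false.
    by rewrite /crosses !(ltNge r.1) => ->; case: (b.1 <= r.1); rewrite ?andbF.
  apply: filterS2 n1 n2 => q [aq _] [bq _].
  by rewrite !nocross // aq bq.
apply: filterS3 n1 n2 n3 => q [aq aqn] [bq bqn] ->.
by rewrite /toggle aq bq !addbb.
Qed.

Section Parity.
Context (n : nat) (f : 'I_n -> R * R) (S : {set 'I_n}) (nx : 'I_n -> 'I_n).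
Hypotheses (nxS : forall u, u \in S -> nx u \in S) (nx_inj : {in S &, injective nx}).

Definition on_cycle (p : R * R) : Prop := exists2 u, u \in S & Defs.segment (f u) (f (nx u)) p.

Definition parity (p : R * R) : bool := \big[addb/false]_(u in S) crosses p (f u) (f (nx u)).

Lemma sum_next (g : 'I_n -> bool) : \big[addb/false]_(u in S) (g u (+) g (nx u)) = false.
Proof.
have nxim : nx @: S = S.
  apply/eqP; rewrite eqEcard card_in_imset // leqnn andbT.
  by apply/fintype.subsetP => _ /imsetP[u uS ->]; exact: nxS.
by rewrite big_split /= -(big_imset g nx_inj) nxim addbb.
Qed.

Lemma parity_near p : ~ on_cycle p -> \forall q \near p, parity q = parity p.
Proof.
move=> np; have : \forall q \near p, forall u, u \in S ->
    crosses q (f u) (f (nx u)) (+) crosses p (f u) (f (nx u)) =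
    toggle p q (f u) (+) toggle p q (f (nx u)).
  apply: (@near_forall _ (fun u q => u \in S ->
    crosses q (f u) (f (nx u)) (+) crosses p (f u) (f (nx u)) =
    toggle p q (f u) (+) toggle p q (f (nx u)))) => u.
  case: (boolP (u \in S)) => [uS|_]; last exact: near_all.
  have : ~ Defs.segment (f u) (f (nx u)) p by move=> h; apply: np; exists u.
  by move=> /crosses_near; apply: filterS => q.
apply: filterS => q cq.
have : parity q (+) parity p = false.
  rewrite /parity -big_split /= -[RHS](sum_next (fun u => toggle p q (f u))).
  by apply: eq_bigr => u uS; exact: cq.
by case: (parity q); case: (parity p).
Qed.

(** The points around which the parity is locally constant with a given value form an open set; on
    [B] the two sets are complementary. *)
Lemma parity_connected (B : set (R * R)) p q : connected B -> (forall r, B r -> ~ on_cycle r) ->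
  B p -> B q -> parity p -> parity q.
Proof.
move=> cB nC Bp Bq pp.
pose U (b : bool) : set (R * R) := [set r | \forall s \near r, parity s = b].
have openU b : open (U b).
  rewrite openE => r Ur; exact: near_join Ur.
have UE b r : B r -> U b r <-> parity r = b.
  move=> Br; split=> [Ur|<-]; first exact: (nbhs_singleton Ur).
  exact: parity_near (nC r Br).
have BE : B `&` U true = B.
  apply: cB.
  - by exists p; split=> //; apply/UE.
  - by exists (U true).
  - exists (~` U false); first exact: open_closedC.
    apply/seteqP; split=> r [Br Ur]; split=> //.
      by move=> /(UE _ _ Br); rewrite ((UE _ _ Br).1 Ur).
    by apply/UE => //; apply/negPn/negP => /negbTE nr; apply: Ur; apply/UE.
by move: Bq; rewrite -BE => -[Bq /(UE _ _ Bq)].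
Qed.

(** Left of, right of or above all vertices, the ray meets no edge. Below them, an edge is crossed
    exactly when its ends are on different sides of the vertical through [p], which happens an even
    number of times around the cycle. *)
Lemma parity_bounded p : parity p ->
  let M := \sum_v (`|(f v).1| + `|(f v).2|) in `|p.1| <= M /\ `|p.2| <= M.
Proof.
move=> pp M.
have fM v : `|(f v).1| <= M /\ `|(f v).2| <= M.
  have : `|(f v).1| + `|(f v).2| <= M.
    by rewrite /M (bigD1 v) //= lerDl sumr_ge0 // => w _; rewrite addr_ge0.
  by move=> h; split; apply: le_trans h; rewrite ?lerDl ?lerDr.
have f1 v : - M <= (f v).1 <= M by rewrite -ler_norml; exact: (fM v).1.
have f2 v : - M <= (f v).2 <= M by rewrite -ler_norml; exact: (fM v).2.
have no0 (g : 'I_n -> bool) : (forall u, u \in S -> crosses p (f u) (f (nx u)) = g u (+) g (nx u)) -> False.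
  by move=> E; move: pp; rewrite /parity (eq_bigr _ E) sum_next.
have nocross : (forall u, u \in S -> crosses p (f u) (f (nx u)) = false) -> False.
  by move=> E; apply: (no0 (fun=> false)).
split; rewrite leNgt; apply/negP; rewrite ltr_normr => /orP[] big.
- have lt v : (f v).1 < p.1 by have /andP[_] := f1 v; move=> /le_lt_trans; apply.
  apply: nocross => u uS.
  by rewrite /crosses !(ltNge p.1) !ltW.
- have gt v : p.1 < (f v).1 by have /andP[+ _] := f1 v; apply: lt_le_trans; rewrite ltrNr.
  apply: nocross => u uS.
  by rewrite /crosses !(leNgt _ p.1) !gt.
- have lt v : (f v).2 < p.2 by have /andP[_] := f2 v; move=> /le_lt_trans; apply.
  have above v : 0 <= p.2 - (f v).2 by rewrite subr_ge0 ltW.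
  apply: nocross => u uS.
  apply/negbTE/negP => /orP[] /and3P[x1 x2]; apply/negP; rewrite -leNgt cr_above.
    by rewrite addr_ge0 // mulr_ge0 // subr_ge0 // ltW.
  by rewrite -oppr_ge0 opprD -!mulNr !opprB addr_ge0 // mulr_ge0 // subr_ge0 // ltW.
- have gt v : p.2 < (f v).2 by have /andP[+ _] := f2 v; apply: lt_le_trans; rewrite ltrNr.
  have below v : 0 < (f v).2 - p.2 by rewrite subr_gt0.
  apply: (no0 (fun u => (f u).1 <= p.1)) => u uS.
  rewrite /crosses !(ltNge p.1).
  case: (leP (f u).1 p.1) => x1; case: (leP (f (nx u)).1 p.1) => x2; rewrite ?orbF //=.
    rewrite -oppr_gt0 cr_above opprD -!mulrN !opprB.
    by apply: ltr_wpDr; [rewrite mulr_ge0 ?subr_ge0 // ltW | rewrite mulr_gt0 ?subr_gt0].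
  rewrite cr_above -mulrNN -[X in _ + X]mulrNN !opprB.
  by apply: ltr_wpDl; [rewrite mulr_ge0 ?subr_ge0 // ltW | rewrite mulr_gt0 ?subr_gt0].
Qed.

(** On the vertical through [m] nothing is swept over, so the other edges contribute a constant [c],
    and the edge of [u0] is crossed exactly from below. *)
Lemma parity_column u0 : u0 \in S -> (f u0).1 != (f (nx u0)).1 ->
  let m := lerp (f u0) (f (nx u0)) (1 / 2) in
  (forall u, u \in S -> u != u0 -> ~ Defs.segment (f u) (f (nx u)) m) ->
  exists c : bool, \forall q \near m, q.1 = m.1 -> q.2 != m.2 -> parity q = (q.2 < m.2) (+) c.
Proof.
move=> u0S nvert m other.
exists (\big[addb/false]_(u in S | u != u0) crosses m (f u) (f (nx u))).
have : \forall q \near m, forall u, u \in S -> u != u0 ->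
    crosses q (f u) (f (nx u)) (+) crosses m (f u) (f (nx u)) =
    toggle m q (f u) (+) toggle m q (f (nx u)).
  apply: (@near_forall _ (fun u q => u \in S -> u != u0 ->
    crosses q (f u) (f (nx u)) (+) crosses m (f u) (f (nx u)) =
    toggle m q (f u) (+) toggle m q (f (nx u)))) => u.
  case: (boolP (u \in S)) => [uS|_]; last exact: near_all.
  case: (boolP (u != u0)) => [uu0|_]; last exact: near_all.
  by have := crosses_near (other u uS uu0); apply: filterS.
apply: filterS => q cq q1 q2; rewrite /parity (bigD1 u0) //=; congr (_ (+) _); last first.
  apply: eq_bigr => u /andP[uS uu0]; have := cq u uS uu0.
  by rewrite /toggle q1 !addbb /=; case: (crosses q _ _); case: (crosses m _ _).
have cE : cr (f u0) (f (nx u0)) q = ((f (nx u0)).1 - (f u0).1) * (q.2 - m.2).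
  have -> : cr (f u0) (f (nx u0)) q = cr (f u0) (f (nx u0)) q - cr (f u0) (f (nx u0)) m.
    by rewrite cr_lerp !cr_aab !mulr0 addr0 subr0.
  by rewrite /cr q1; ring.
rewrite /crosses cE q1.
have mE : m.1 = ((f u0).1 + (f (nx u0)).1) / 2 by rewrite /m /lerp /=; field.
move: nvert; rewrite neq_lt => /orP[ab|ba].
  have -> : (f u0).1 <= m.1 by rewrite mE; lra.
  have -> : m.1 < (f (nx u0)).1 by rewrite mE; lra.
  have -> : (m.1 < (f u0).1) = false by apply/negbTE; rewrite -leNgt mE; lra.
  by rewrite andbF orbF /= pmulr_rlt0 ?subr_gt0 // subr_lt0.
have -> : (f (nx u0)).1 <= m.1 by rewrite mE; lra.
have -> : (m.1 < (f (nx u0)).1) = false by apply/negbTE; rewrite -leNgt mE; lra.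
have -> : m.1 < (f u0).1 by rewrite mE; lra.
by rewrite /= andbF /= nmulr_rgt0 ?subr_lt0 // subr_lt0.
Qed.
End Parity.

(** * Internal faces are drawn as faces *)

Section Faces.
Context (n : nat) (e : rel 'I_n) (sigma : {perm 'I_n}) (G : 'I_n -> int * int).
Hypotheses (outer : outerplane e sigma) (G_inj : injective G).
Hypothesis convexG : internally_strictly_convex e G.

Let e_sym : symmetric e := outer.1.1.
Let eirr : forall u, ~~ e u u := outer.1.2.
Let planar : planar_straight_line e G := convexG.1.
Let pos := position sigma.
Let pos_inj : injective pos := @position_inj n sigma.
Let pos_lt := position_lt sigma.
Let noncross := outerplane_noncross outer.

(** The geometry of the polygon supplies the neighbours and the connectivity, the embedding supplies
    the absence of crossings. *)
Lemma face_vertices_cyc_face F : face e G F -> strictly_convex_face G F ->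
  cyc_face pos e (face_vertices G F).
Proof.
move=> faceF scF; set P := face_vertices G F.
have P3 : leq 3 #|P| := face_vertices_ge3 faceF scF.
have CP : convex_position (pt G) P := face_convex_position G_inj scF.
have edge u v : u \in P -> v \in P -> u != v -> supports (pt G) P u v -> e u v.
  exact: (supports_edge e_sym G_inj planar faceF scF).
have Q_step u v (Q : pred 'I_n) :
   (forall w w', w \in P :\: [set u; v]%SET -> w' \in P :\: [set u; v]%SET -> e w w' -> Q w -> Q w') ->
   forall w w', w \in P :\: [set u; v]%SET -> w' \in P :\: [set u; v]%SET ->
     supports (pt G) P w w' \/ supports (pt G) P w' w -> Q w -> Q w'.
  move=> step w w' wD w'D s; case: (eqVneq w w') => [-> //|ww'].
  have [wP _] := finset.setDP wD; have [w'P _] := finset.setDP w'D.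
  apply: step => //; case: s => s; first exact: edge.
  by rewrite e_sym; apply: edge; rewrite // eq_sym.
apply: (polygon_cyc_face pos_inj e_sym noncross P3) => //.
  move=> u uP; have [a [b [aP bP ab [au bu sa sb]]]] := supporting_neighbours CP P3 uP.
  exists a, b; split=> //; first by apply: edge; rewrite // eq_sym.
  by rewrite e_sym; apply: edge.
move=> u v uP vP euv Q step.
have uv := edge_neq eirr euv.
have [s|s] := face_chord_supports eirr G_inj faceF scF uP vP euv.
  exact: (polygon_minus_side_connected CP P3 uP vP uv s (Q_step u v Q step)).
rewrite finset.setUC in step *; rewrite eq_sym in uv.
exact: (polygon_minus_side_connected CP P3 vP uP uv s (Q_step v u Q step)).
Qed.

Section Cycle.
Context (S : {set 'I_n}).
Hypothesis faceS : internal_face e sigma S.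
Let nx := next (cyc_order sigma S).
Let f := pt G.

Let S3 : leq 3 #|S|. Proof. by have [] := faceS. Qed.

Let S_cyc : cyc_face pos e S := internal_face_cyc_face faceS.

Let nx_next u : u \in S -> arc_next pos S u (nx u).
Proof. by move=> uS; apply: cyc_order_next => //; exact: ltnW. Qed.

Let nxS u : u \in S -> nx u \in S.
Proof. by move=> /nx_next[]. Qed.

Let nx_inj : {in S &, injective nx}.
Proof.
move=> u v uS vS E; have := nx_next vS; rewrite -E => vn.
exact: (arc_prev_inj pos_inj (nx_next uS) vn).
Qed.

Let nx_edge u : u \in S -> e u (nx u).
Proof. by move=> uS; have [_ h _] := S_cyc; apply/h/nx_next. Qed.

Let on_cycle_drawn p : on_cycle f S nx p -> drawn e G p.
Proof. by move=> [u uS pu]; right; exists u, (nx u); split=> //; exact: nx_edge. Qed.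

Let face_not_on_cycle F p : face e G F -> F p -> ~ on_cycle f S nx p.
Proof. by move=> faceF Fp /on_cycle_drawn; exact: face_not_drawn faceF Fp. Qed.

Let face_parity F p q : face e G F -> F p -> F q -> parity f S nx p -> parity f S nx q.
Proof.
move=> faceF Fp Fq; apply: (parity_connected nxS nx_inj (B := F)) => //.
  by move: faceF => [x [_ ->]]; exact: component_connected.
by move=> r; exact: face_not_on_cycle.
Qed.

Let inside_convex F p : face e G F -> F p -> parity f S nx p -> strictly_convex_face G F.
Proof.
move=> faceF Fp pp; apply: convexG.2 => //.
exists (\sum_v (`|(f v).1| + `|(f v).2|)) => q Fq.
exact: (parity_bounded nxS nx_inj (face_parity faceF Fp Fq pp)).
Qed.

(** If all edges were vertical, both neighbours of the lowest vertex would be straight above it, and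
    the nearer one would lie on the edge to the farther one. *)
Let nonvertical_edge : exists2 u, u \in S & (f u).1 != (f (nx u)).1.
Proof.
apply: contrapT => none.
have vert u : u \in S -> (f (nx u)).1 = (f u).1.
  by move=> uS; apply/esym/eqP/negPn/negP => h; apply: none; exists u.
have /card_gt0P[u0 u0S] : leq 1 #|S| by apply: leq_trans S3.
case: (arg_minP (fun u => (f u).2) u0S) => u uS0 u_min; have uS : u \in S by [].
have [b bu] := arc_prev_exists pos_inj pos_lt (ltnW S3) uS.
have [bS _ bun _] := bu.
have ub : nx b = u := arc_next_inj pos_inj (nx_next bS) bu.
have ab : nx u != b.
  by apply/eqP => E; apply: (arc_next_asym pos_inj S3 bu); rewrite -E; exact: nx_next.
have uun : u != nx u by have [] := nx_next uS.
have xa := vert u uS; have xb : (f b).1 = (f u).1 by rewrite -(vert b bS) ub.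
have seg (v w : 'I_n) : (f v).1 = (f u).1 -> (f w).1 = (f u).1 -> (f u).2 <= (f v).2 ->
    (f v).2 <= (f w).2 -> Defs.segment (f u) (f w) (f v).
  move=> xv xw uv vw; apply/segment_dotP; rewrite /cr /dot xv xw !subrr !mul0r sub0r mulr0 oppr0 add0r.
  by split=> //; rewrite mulr_ge0_le0 // ?subr_ge0 ?subr_le0.
have eub : e u b by rewrite e_sym -ub; exact: nx_edge.
have [ab2|/ltW ba2] := leP (f (nx u)).2 (f b).2.
  have := planar.2 (nx u) u b eub (seg _ _ xa xb (u_min _ (nxS uS)) ab2).
  by case=> E; [rewrite E eqxx in uun | rewrite E eqxx in ab].
have := planar.2 b u (nx u) (nx_edge uS) (seg _ _ xb xa (u_min _ bS) ba2).
by case=> E; [rewrite E eqxx in bun | rewrite -E eqxx in ab].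
Qed.

Let inside_point : exists2 q, ~ drawn e G q & parity f S nx q.
Proof.
have [u uS vert] := nonvertical_edge.
set m := lerp (f u) (f (nx u)) (1 / 2).
have other v : v \in S -> v != u -> ~ Defs.segment (f v) (f (nx v)) m.
  move=> vS vu seg.
  have [[uE _]|[uE nuE]] :=
    edge_point_other eirr G_inj planar (nx_edge uS) (nx_edge vS) (half01 R) seg.
    by rewrite uE eqxx in vu.
  apply: (arc_next_asym pos_inj S3 (nx_next uS)).
  by rewrite nuE uE; exact: nx_next.
have [c near_c] := parity_column uS vert other; rewrite -/m in near_c.
have near_e := near_edge_drawn eirr G_inj planar (nx_edge uS) (half01 R).
have /near_boxP[d d0 dB] : \forall q \near m,
    (q.1 = m.1 -> q.2 != m.2 -> parity f S nx q = (q.2 < m.2) (+) c) /\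
    (drawn e G q -> edge_seg G u (nx u) q) by apply: filterI near_c near_e.
have point (x : R) : x != 0 -> `|x| < d ->
    ~ drawn e G (m.1, m.2 + x) /\ parity f S nx (m.1, m.2 + x) = (x < 0) (+) c.
  move=> x0 xd; have [Bc Be] : (fun q => (q.1 = m.1 -> q.2 != m.2 ->
      parity f S nx q = (q.2 < m.2) (+) c) /\ (drawn e G q -> edge_seg G u (nx u) q)) (m.1, m.2 + x).
    by apply: dB; rewrite /= ?subrr ?normr0 // addrAC subrr add0r.
  split.
    move=> /Be /segment_dotP[c0 _]; move: c0.
    have -> : cr (pt G u) (pt G (nx u)) (m.1, m.2 + x) =
        cr (pt G u) (pt G (nx u)) m + ((f (nx u)).1 - (f u).1) * x.
      by rewrite /cr /f /=; ring.
    rewrite cr_lerp !cr_aab !mulr0 !add0r => /eqP; rewrite mulf_eq0 subr_eq0 (negbTE x0) orbF.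
    by rewrite eq_sym (negbTE vert).
  rewrite Bc //=; first by rewrite gtrDl.
  by rewrite -subr_eq0 addrAC subrr add0r.
have d2 : 0 < d / 2 by rewrite divr_gt0.
have d2d : `|d / 2| < d by rewrite gtr0_norm //; lra.
(* The odd side of the edge is above the midpoint or below it, according to [c]. *)
case: c point {near_c dB} => point.
  have [nd pp] := point _ (lt0r_neq0 d2) d2d.
  by exists (m.1, m.2 + d / 2); rewrite ?pp // ltNge (ltW d2).
have [nd pp] : ~ drawn e G (m.1, m.2 + - (d / 2)) /\
    parity f S nx (m.1, m.2 + - (d / 2)) = (- (d / 2) < 0) (+) false.
  by apply: point; rewrite ?oppr_eq0 ?lt0r_neq0 // normrN.
by exists (m.1, m.2 + - (d / 2)); rewrite ?pp // oppr_lt0 d2.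
Qed.

(* If the face is not bounded by [S], crossing a side which is not an edge of [S] leads to a face
   still inside [S], on the far side of that edge in the circular order. *)
Let inside_descent F p : face e G F -> F p -> parity f S nx p -> face_vertices G F <> S ->
  exists F' q, [/\ face e G F', F' q, parity f S nx q &
    (pos_span pos (face_vertices G F') < pos_span pos (face_vertices G F))%nat].
Proof.
move=> faceF Fp pp DS; have scF := inside_convex faceF Fp pp.
set D := face_vertices G F in DS *.
have D_cyc : cyc_face pos e D := face_vertices_cyc_face faceF scF.
have [x [y [Dxy xy nSxy nSyx]]] := child_edge pos_inj pos_lt e_sym noncross S_cyc D_cyc (nesym DS).
have exy : e x y by have [_ h _] := D_cyc; exact: h.
have [xD yD xyn _] := Dxy.
(* The drawing may reverse the circular order; [ab] is the side [xy] directed so that the polygon is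
   on its left. *)
have [a [b [ab aD bD sab]]] : exists a b, [/\ (a = x /\ b = y) \/ (a = y /\ b = x),
    a \in D, b \in D & supports (pt G) D a b].
  have [s|s] := face_chord_supports eirr G_inj faceF scF xD yD exy.
    by exists x, y; split=> //; left.
  by exists y, x; split=> //; right.
have eab : e a b by case: ab => -[-> ->] //; rewrite e_sym.
have eba : e b a by rewrite e_sym.
have abn := edge_neq eirr eab.
have [z [zD za zb]] := card_ge3_other a b (face_vertices_ge3 faceF scF).
have abz : 0 < cr (pt G a) (pt G b) (pt G z) := sab z zD za zb.
have pab : pt G a <> pt G b by move=> /(pt_inj G_inj) E; rewrite E eqxx in abn.
have pba : pt G b <> pt G a by move=> E; apply: pab.
set m := lerp (pt G a) (pt G b) (1 / 2).
have m0 : cr (pt G a) (pt G b) m = 0 by rewrite cr_lerp !cr_aab !mulr0 addr0.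
have nF : \forall q \near m, 0 < cr (pt G a) (pt G b) q -> F q.
  exact: (near_side_face scF aD bD zD (half01 R) abz).
(* Since the crossed edge is not an edge of [S], the parity is constant around its midpoint and is
   carried over to the face beyond. *)
have m_off : ~ on_cycle f S nx m.
  move=> [u uS seg].
  have ends := edge_point_other eirr G_inj planar eab (nx_edge uS) (half01 R) seg.
  have un := nx_next uS.
  by case: ab ends => -[-> ->] [] [E1 E2]; move: un; (rewrite -E1 -E2 || rewrite -E2 -E1).
have near_m := parity_near nxS nx_inj m_off.
have pm : parity f S nx m.
  have [|q [[Fq pq] q0]] := @near_left (fun q => (0 < cr (pt G a) (pt G b) q -> F q) /\
    parity f S nx q = parity f S nx m) _ _ m pab _ (filterI nF near_m); first by rewrite m0.
  by rewrite -pq; exact: face_parity (Fq q0) pp.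
have [F' [faceF' nF']] := edge_side_face eirr G_inj planar eba.
have nF'm : \forall q \near m, 0 < cr (pt G b) (pt G a) q -> F' q by rewrite /m lerp_half_sym.
have [|q [[F'q' pq] q0]] := @near_left (fun q => (0 < cr (pt G b) (pt G a) q -> F' q) /\
    parity f S nx q = parity f S nx m) _ _ m pba _ (filterI nF'm near_m).
  by rewrite cr_swap m0 oppr0.
have F'q := F'q' q0; rewrite pm in pq.
have scF' := inside_convex faceF' F'q pq.
have [bD' aD' sba] := edge_side_vertices e_sym eirr G_inj planar faceF' scF' eba nF'.
exists F', q; split=> //.
have D'_cyc := face_vertices_cyc_face faceF' scF'.
apply: (pos_span_lt pos_inj pos_lt e_sym noncross D_cyc D'_cyc _ Dxy xy _ _ exy).
(* With the same vertices for both faces, [z] would be on both sides of [ab]. *)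
- move=> DD'; rewrite -DD' in sba; have := sba z zD zb za.
  by rewrite cr_swap oppr_gt0 => /lt_trans /(_ abz); rewrite ltxx.
- by case: ab => -[E1 E2]; rewrite -?E1 -?E2.
- by case: ab => -[E1 E2]; rewrite -?E1 -?E2.
Qed.

Lemma internal_face_drawn : exists F : set (R * R),
  [/\ face e G F, strictly_convex_face G F & face_vertices G F = S].
Proof.
apply: contrapT => none.
have noface k : forall F p, face e G F -> F p -> parity f S nx p ->
    (pos_span pos (face_vertices G F) < k)%nat -> False.
  elim: k => // k IH F p faceF Fp pp; rewrite ltnS => spk.
  have DS : face_vertices G F <> S.
    by move=> DS; apply: none; exists F; split=> //; exact: inside_convex Fp pp.
  have [F' [q [faceF' F'q pq lt]]] := inside_descent faceF Fp pp DS.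
  exact: (IH F' q faceF' F'q pq (leq_trans lt spk)).
have [q nq pq] := inside_point.
have [faceF Fq] := face_component nq.
exact: (noface _ _ q faceF Fq pq (leqnn _)).
Qed.
End Cycle.
End Faces.

(** * Counting grid points *)

(** The [B] integers following the floor of the smaller end are strictly inside, since [B <= l - 1];
    and [B > l - 2], which is at least [l / 2] when [l >= 4]. *)
Lemma integers_between (K : realType) (a b l : K) : l <= `|b - a| -> 4 <= l ->
  let B := Num.truncn (l - 1) in
  l <= 2 * B%:R /\ exists y : 'I_B -> int, injective y /\
    forall j, exists th : K, [/\ 0 < th, th < 1 & (y j)%:~R = (1 - th) * a + th * b].
Proof.
wlog ab : a b / a <= b.
  move=> wl; have [/wl//|/ltW ba lab l4] := leP a b.
  rewrite distrC in lab; have [lB [y [yi yP]]] := wl b a ba lab l4.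
  split=> //; exists y; split=> // j; have [th [th0 th1 E]] := yP j.
  by exists (1 - th); split; [lra | lra | rewrite E; ring].
rewrite ger0_norm ?subr_ge0 // => lab l4.
have l0 : 0 <= l - 1 by lra.
have /andP[B1 B2] := truncn_itv l0.
move=> B; rewrite -/B in B1 B2.
split; first by move: B2; rewrite -natr1; lra.
exists (fun j => Num.floor a + 1 + j%:Z); split=> [i j /addrI [/val_inj] //|j].
have /andP[f1 f2] := floor_itv a.
have jB : (j%:R + 1 : K) <= B%:R by rewrite natr1 ler_nat.
have yE : (Num.floor a + 1 + j%:Z)%:~R = (Num.floor a + 1)%:~R + j%:R :> K by rewrite intrD.
have j0 : (0 : K) <= j%:R by [].
have f1' : (Num.floor a + 1)%:~R <= a + 1 :> K by rewrite intrD; lra.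
have ba : 0 < b - a by lra.
exists (((Num.floor a + 1 + j%:Z)%:~R - a) / (b - a)); split.
- by rewrite divr_gt0 // yE; lra.
- by rewrite ltr_pdivrMr // yE; lra.
- by field; rewrite gt_eqF.
Qed.

Definition int_pt (K : realType) (p : int * int) : K * K := (p.1%:~R, p.2%:~R).

(* The columns used are those meeting the half of the triangle [p, q, r'] next to [q], where [r'] is
   the point of the side [pr] above or below [q]. *)
Lemma lattice_in_triangle (K : realType) (p q r : int * int) (M : nat) :
  let f := @int_pt K in
  ((p.1 <= q.1) && (q.1 <= r.1)) || ((r.1 <= q.1) && (q.1 <= p.1)) ->
  `|r.1 - p.1| <= 2 * `|q.1 - p.1| -> cr (f p) (f q) (f r) != 0 ->
  4 * `|r.1 - p.1| <= M%:Z ->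
  exists (A B : nat) (z : 'I_A -> 'I_B -> int * int),
  [/\ forall i j i' j', z i j = z i' j' -> i = i' /\ j = j',
      forall i j, exists al be ga : K, [/\ 0 < al, 0 < be, 0 < ga, al + be + ga = 1 &
        f (z i j) = (2 * M%:R * (al * (f p).1 + be * (f q).1 + ga * (f r).1),
                     2 * M%:R * (al * (f p).2 + be * (f q).2 + ga * (f r).2))] &
      (2 * M%:R) ^+ 2 * `|cr (f p) (f q) (f r)| <= 16 * (A * B)%:R].
Proof.
move=> f xs half D0 XM.
set dx := `|q.1 - p.1| in half; set X := `|r.1 - p.1| in half XM.
have X_ge : dx <= X by move: xs; rewrite /dx /X; lia.
have X1 : 1 <= X.
  rewrite -gtz0_ge1 normr_gt0 subr_eq0; apply: contraNneq D0 => rp.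
  have qp : q.1 = p.1 by move: xs; rewrite rp; lia.
  by rewrite /cr /f /int_pt /= rp qp !subrr mul0r mulr0 subrr.
have dx1 : 1 <= dx by lia.
pose sg : int := if p.1 <= q.1 then 1 else -1.
have qpE : q.1 - p.1 = sg * dx by move: X1 xs; rewrite /sg /dx /X; case: (leP p.1 q.1) => *; lia.
have rpE : r.1 - p.1 = sg * X.
  by move: X1 dx1 xs; rewrite /sg /dx /X; case: (leP p.1 q.1) => *; lia.
have sg2 : sg * sg = 1 by rewrite /sg; case: ifP.
(* After scaling by [2 * M] the abscissas of [p] and [q] differ by [2 * A]; the columns are at
   distance [A + i] from [p], so [s i] is in [[1 / 2, 1)]. *)
pose A := (M * `|dx|)%nat.
have M0 : (0 < M)%nat by lia.
have MR : 0 < M%:R :> K by rewrite ltr0n.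
pose N : K := 2 * M%:R.
have N0 : 0 < N by rewrite /N mulr_gt0.
pose col (i : 'I_A) : int := 2 * M%:Z * p.1 + sg * (A + i)%:Z.
pose s (i : 'I_A) : K := (A + i)%:R / (2 * A%:R).
have A0 : (0 < A)%nat by rewrite /A muln_gt0 M0; lia.
have AR : 0 < A%:R :> K by rewrite ltr0n.
have s_lb i : 1 / 2 <= s i.
  by rewrite /s ler_pdivlMr ?mulr_gt0 // natrD; have : 0 <= i%:R :> K by []; lra.
have s_lt1 i : s i < 1.
  rewrite /s ltr_pdivrMr ?mulr_gt0 // natrD; have : i%:R < A%:R :> K by rewrite ltr_nat.
  by lra.
pose Dl := `|cr (f p) (f q) (f r)|.
have XR : 1 <= X%:~R :> K by rewrite ler1z.
have XR0 : 0 < X%:~R :> K by lra.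
have Xn : X%:~R != 0 :> K by rewrite gt_eqF.
have dxR : 1 <= dx%:~R :> K by rewrite ler1z.
have dxX : dx%:~R <= X%:~R :> K by rewrite ler_int.
have Xdx : X%:~R <= 2 * dx%:~R :> K by rewrite -[2]/(2%:~R) -intrM ler_int.
have XMR : 4 * X%:~R <= M%:R :> K by rewrite -[4]/(4%:~R) -intrM -[M%:R]/(M%:Z%:~R) ler_int.
have s0 i : 0 < s i by apply: lt_le_trans (s_lb i); rewrite divr_gt0.
pose s' i : K := s i * dx%:~R / X%:~R.
have s'_gt0 i : 0 < s' i.
  by rewrite /s' divr_gt0 // mulr_gt0 // (lt_le_trans ltr01 dxR).
have s'_lt1 i : s' i < 1.
  rewrite /s' ltr_pdivrMr // mul1r; apply: le_lt_trans (ler_wpM2l (ltW (s0 i)) dxX) _.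
  by rewrite gtr_pMl.
pose ya i : K := N * ((f p).2 + s i * ((f q).2 - (f p).2)).
pose yb i : K := N * ((f p).2 + s' i * ((f r).2 - (f p).2)).
have sgR : (sg%:~R : K) * sg%:~R = 1 by rewrite -intrM sg2.
have qpR : (f q).1 - (f p).1 = sg%:~R * dx%:~R by rewrite /f /= -intrB qpE intrM.
have rpR : (f r).1 - (f p).1 = sg%:~R * X%:~R by rewrite /f /= -intrB rpE intrM.
have Dl1 : 1 <= Dl.
  move: D0; rewrite /Dl /cr /f /int_pt /= -!intrB -!intrM -!intrB intr_eq0 -intr_norm ler1z => nz.
  by rewrite -gtz0_ge1 normr_gt0.
have gap i : yb i - ya i = sg%:~R * (N * s i / X%:~R) * cr (f p) (f q) (f r).
  rewrite /cr qpR rpR.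
  have -> : sg%:~R * (N * s i / X%:~R) * (sg%:~R * dx%:~R * ((f r).2 - (f p).2) -
      ((f q).2 - (f p).2) * (sg%:~R * X%:~R)) =
    (sg%:~R * sg%:~R) * ((N * s i / X%:~R) * (dx%:~R * ((f r).2 - (f p).2) -
      ((f q).2 - (f p).2) * X%:~R)) by ring.
  by rewrite sgR mul1r /yb /ya /s'; field.
(* A lower bound for the length of every column, reached at [s i = 1 / 2]; it is at least 4 because
   [M >= 4 * X] and [Dl >= 1]. *)
pose l : K := N * Dl / (2 * X%:~R).
have l4 : 4 <= l.
  rewrite /l ler_pdivlMr ?mulr_gt0 //; rewrite /N.
  have -> : 4 * (2 * X%:~R) = 2 * (4 * X%:~R) :> K by ring.
  by rewrite -mulrA ler_pM2l //; apply: le_trans XMR _; rewrite ler_peMr // ltW.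
have lgap i : l <= `|yb i - ya i|.
  have sgn : `|sg%:~R| = 1 :> K by rewrite /sg; case: ifP; rewrite ?normrN1 ?normr1 // mulrN1z normrN1.
  rewrite gap normrM [`|sg%:~R * _|]normrM sgn mul1r gtr0_norm; last first.
    by rewrite divr_gt0 // mulr_gt0.
  have -> : l = N * (1 / 2) / X%:~R * Dl by rewrite /l; field.
  rewrite ler_pM2r; last exact: lt_le_trans ltr01 Dl1.
  by rewrite ler_pM2r ?invr_gt0 // ler_pM2l.
have lB : l <= 2 * (Num.truncn (l - 1))%:R.
  by have [] := integers_between (lgap (Ordinal A0)) l4.
set B := Num.truncn (l - 1) in lB.
have cols i : exists y : 'I_B -> int, injective y /\
    forall j, exists th : K, [/\ 0 < th, th < 1 & (y j)%:~R = (1 - th) * ya i + th * yb i].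
  by have [] := integers_between (lgap i) l4.
have [y yP] := choice cols.
exists A, B, (fun i j => (col i, y i j)); split.
- move=> i j i' j' [/addrI ci yj].
  have ii : i = i'.
    apply: val_inj; move: ci; rewrite /sg; case: ifP => _; first by rewrite !mul1r => -[] /addnI.
    by rewrite !mulN1r => /oppr_inj -[] /addnI.
  by subst i'; split=> //; exact: (yP i).1.
- move=> i j; have [th [th0 th1 yE]] := (yP i).2 j.
  have := s_lt1 i; have := s'_gt0 i; have := s'_lt1 i => s'1 s'0 s1.
  exists (1 - (1 - th) * s i - th * s' i), ((1 - th) * s i), (th * s' i); split.
  + have -> : 1 - (1 - th) * s i - th * s' i = (1 - th) * (1 - s i) + th * (1 - s' i) by ring.
    by rewrite addr_gt0 // mulr_gt0 // subr_gt0.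
  + by rewrite mulr_gt0 // subr_gt0.
  + exact: mulr_gt0.
  + by ring.
  congr pair; last by rewrite [LHS]yE /ya /yb /N; ring.
  have -> : (f q).1 = (f p).1 + sg%:~R * dx%:~R by rewrite -qpR; ring.
  have -> : (f r).1 = (f p).1 + sg%:~R * X%:~R by rewrite -rpR; ring.
  have AE : A%:R = M%:R * dx%:~R :> K.
    by rewrite /A natrM; congr (_ * _); rewrite -[dx in RHS]gez0_abs //; lia.
  have sE : (A + i)%:R = 2 * A%:R * s i :> K by rewrite /s; field; rewrite gt_eqF.
  have colE : (f (col i, y i j)).1 = 2 * M%:R * (f p).1 + sg%:~R * (A + i)%:R.
    by rewrite /f /col /= intrD !intrM.
  rewrite [LHS]colE sE AE /s'; field.
  exact: Xn.
have AE : A%:R = M%:R * dx%:~R :> K.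
  by rewrite /A natrM; congr (_ * _); rewrite -[dx in RHS]gez0_abs //; lia.
rewrite natrM AE.
have h1 : N * Dl = 2 * X%:~R * l by rewrite /l; field.
have -> : (2 * M%:R) ^+ 2 * Dl = 2 * M%:R * (2 * X%:~R * l) by rewrite -h1 /N; ring.
(* The two losses by a factor 2: [q] is only at least halfway from [p] to [r] in abscissa, and
   rounding halves the columns. Keeping only half of the columns and the factor 2 between area and
   [cr] complete the constant 16. *)
have h2 : X%:~R * l <= (2 * dx%:~R) * (2 * B%:R).
  by apply: ler_pM => //; exact: le_trans l4.
have -> : 2 * M%:R * (2 * X%:~R * l) = 4 * (M%:R * (X%:~R * l)) :> K by ring.
have -> : 16 * (M%:R * dx%:~R * B%:R) = 4 * (M%:R * (2 * dx%:~R * (2 * B%:R))) :> K by ring.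
by rewrite ler_pM2l // ler_pM2l.
Qed.

Lemma coord_spanP (s : seq int) : s <> [::] ->
  exists (lo : int) (W : nat), Defs.coord_span s = W%:Z /\ forall x, x \in s -> lo <= x < lo + W%:Z.
Proof.
case: s => // x t _; pose hi := foldr Num.max x t; pose lo := foldr Num.min x t.
have hiP t' y : y \in x :: t' -> y <= foldr Num.max x t'.
  elim: t' => [|z t' IH]; first by rewrite inE => /eqP ->.
  rewrite !inE /= le_max => /or3P[/eqP yx|/eqP ->|yt]; [|by rewrite lexx|].
    by rewrite IH ?orbT // inE yx eqxx.
  by rewrite IH ?orbT // inE yt orbT.
have loP t' y : y \in x :: t' -> foldr Num.min x t' <= y.
  elim: t' => [|z t' IH]; first by rewrite inE => /eqP ->.
  rewrite !inE /= ge_min => /or3P[/eqP yx|/eqP ->|yt]; [|by rewrite lexx|].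
    by rewrite IH ?orbT // inE yx eqxx.
  by rewrite IH ?orbT // inE yt orbT.
have lohi : lo <= hi by apply: (@le_trans _ _ x); [apply: loP | apply: hiP]; rewrite inE eqxx.
exists lo, (absz (hi - lo + 1)); split; first by rewrite /= -/hi -/lo; lia.
by move=> y yt; have := loP t y yt; have := hiP t y yt; rewrite -/hi -/lo; lia.
Qed.

(** [q] has the median abscissa, and [p] is chosen as an extreme at least half the width away from
    it. *)
Lemma sort_abscissas (T : Type) (P : T -> Prop) (x : T -> int) (D : T -> T -> T -> R) :
  (forall u v w, D v u w = D u v w) -> (forall u v w, D u w v = D u v w) ->
  forall u v w, P u -> P v -> P w -> exists p q r,
  [/\ P p, P q & P r] /\ [/\ D p q r = D u v w,
      ((x p <= x q) && (x q <= x r)) || ((x r <= x q) && (x q <= x p)) &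
      `|x r - x p| <= 2 * `|x q - x p|].
Proof.
move=> D12 D23 u v w Pu Pv Pw.
have : exists p q r, [/\ P p, P q & P r] /\ D p q r = D u v w /\ (x p <= x q) && (x q <= x r).
  case: (leP (x u) (x v)) => uv; case: (leP (x v) (x w)) => vw.
  - by exists u, v, w; rewrite uv vw.
  - case: (leP (x u) (x w)) => uw.
      by exists u, w, v; rewrite D23 uw ltW.
    by exists w, u, v; rewrite D12 D23 uv ltW.
  - case: (leP (x u) (x w)) => uw.
      by exists v, u, w; rewrite D12 uw ltW.
    by exists v, w, u; rewrite D23 D12 vw ltW.
  - by exists w, v, u; rewrite D12 D23 D12 !ltW.
move=> [p [q [r [[Pp Pq Pr] [DE /andP[pq qr]]]]]].
case: (leP `|x r - x p| (2 * `|x q - x p|)) => h.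
  by exists p, q, r; split=> //; split=> //; rewrite pq qr.
exists r, q, p; split=> //; split; first by rewrite D12 D23 D12.
  by rewrite pq qr orbT.
by move: h; lia.
Qed.

Lemma face_triangle_interior n (G : 'I_n -> int * int) (F : set (R * R)) u v w (al be ga : R) :
  strictly_convex_face G F ->
  u \in face_vertices G F -> v \in face_vertices G F -> w \in face_vertices G F ->
  cr (pt G u) (pt G v) (pt G w) != 0 -> 0 < al -> 0 < be -> 0 < ga -> al + be + ga = 1 ->
  F (al * (pt G u).1 + be * (pt G v).1 + ga * (pt G w).1,
     al * (pt G u).2 + be * (pt G v).2 + ga * (pt G w).2).
Proof.
move=> scF; wlog D0 : v w be ga / 0 < cr (pt G u) (pt G v) (pt G w).
  move=> wl uP vP wP D0 al0 be0 ga0 s1; move: (D0); rewrite neq_lt => /orP[Dn|Dp]; last exact: wl.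
  rewrite addrAC [X in (_, X)]addrAC; apply: wl => //; last by rewrite addrAC.
    by rewrite cr_swap23 oppr_gt0.
  by rewrite cr_swap23 oppr_eq0.
move=> uP vP wP _ al0 be0 ga0 s1; set z := (_, _).
have alE : al = 1 - be - ga by rewrite -s1; ring.
have c1 : 0 < cr (pt G u) (pt G v) z.
  have -> : cr (pt G u) (pt G v) z = ga * cr (pt G u) (pt G v) (pt G w) by rewrite /z alE /cr /=; ring.
  exact: mulr_gt0.
have c2 : 0 < cr (pt G v) (pt G w) z.
  have -> : cr (pt G v) (pt G w) z = al * cr (pt G u) (pt G v) (pt G w) by rewrite /z alE /cr /=; ring.
  exact: mulr_gt0.
have c3 : 0 < cr (pt G w) (pt G u) z.
  have -> : cr (pt G w) (pt G u) z = be * cr (pt G u) (pt G v) (pt G w) by rewrite /z alE /cr /=; ring.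
  exact: mulr_gt0.
apply: (near_hull_face scF).
have n1 := near_gt0 (@cr_continuous _ _) c1; have n2 := near_gt0 (@cr_continuous _ _) c2.
have n3 := near_gt0 (@cr_continuous _ _) c3.
apply: filterS3 n1 n2 n3 => q q1 q2 q3.
apply: (conv_hull_triangle (a := pt G u) (b := pt G v) (c := pt G w)) => //; try exact: ltW.
- by exists u.
- by exists v.
- by exists w.
Qed.

Section GridCount.
Context (n : nat) (G : 'I_n -> int * int) (lo1 lo2 : int) (W H : nat).
Hypotheses (G_inj : injective G)
  (box1 : forall v, lo1 <= (G v).1 < lo1 + W%:Z)
  (box2 : forall v, lo2 <= (G v).2 < lo2 + H%:Z).

Lemma vertices_le_area : leq n (W * H)%nat.
Proof.
have idx v : exists ij : 'I_W * 'I_H, (lo1 + ij.1%:Z, lo2 + ij.2%:Z) = G v.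
  have := box1 v; have := box2 v; case: (G v) => x y /= /andP[y1 y2] /andP[x1 x2].
  have xW : (absz (x - lo1) < W)%nat by lia.
  have yH : (absz (y - lo2) < H)%nat by lia.
  by exists (Ordinal xW, Ordinal yH); congr pair => /=; lia.
have [phi phiP] := choice idx.
have phi_inj : injective phi by move=> u v E; apply: G_inj; rewrite -!phiP E.
by have := leq_card phi phi_inj; rewrite card_prod !card_ord.
Qed.

(** Four times the width bounds [4 * X] for every triangle in the box, so one mesh serves all
    faces. *)
Let M : nat := (4 * W)%nat.

(** The grid of mesh [1 / (2 * M)] in a half-open [W] by [H] box: exactly [(2 * M) ^ 2] points per
    unit area. *)
Definition fine_point (ij : 'I_(2 * M * W) * 'I_(2 * M * H)) : R * R :=
  ((2 * M%:Z * lo1 + ij.1%:Z)%:~R / (2 * M%:R), (2 * M%:Z * lo2 + ij.2%:Z)%:~R / (2 * M%:R)).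

Definition fine_points (F : set (R * R)) : {set 'I_(2 * M * W) * 'I_(2 * M * H)} :=
  finset (fun ij => `[< F (fine_point ij) >]).

Lemma in_fine_points (F : set (R * R)) g : g \in fine_points F <-> F (fine_point g).
Proof. by rewrite inE; split=> /asboolP. Qed.

Lemma fine_points_triangle F u v w : strictly_convex_face G F ->
  u \in face_vertices G F -> v \in face_vertices G F -> w \in face_vertices G F ->
  cr (pt G u) (pt G v) (pt G w) != 0 ->
  (2 * M%:R) ^+ 2 * `|cr (pt G u) (pt G v) (pt G w)| <= 16 * #|fine_points F|%:R.
Proof.
move=> scF uP vP wP D0.
have [p [q [r [[pP qP rP] [DE xs half]]]]] :=
  @sort_abscissas _ (fun v => v \in face_vertices G F) (fun v => (G v).1)
    (fun u v w => `|cr (pt G u) (pt G v) (pt G w)|)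
    (fun u v w => etrans (congr1 _ (cr_swap _ _ _)) (normrN _))
    (fun u v w => etrans (congr1 _ (cr_swap23 _ _ _)) (normrN _)) u v w uP vP wP.
have D0' : cr (pt G p) (pt G q) (pt G r) != 0 by rewrite -normr_gt0 DE normr_gt0.
have XM : 4 * `|(G r).1 - (G p).1| <= M%:Z.
  by move: (box1 r) (box1 p); rewrite /M; clear; lia.
have [A [B [z [z_inj z_in z_count]]]] := @lattice_in_triangle R (G p) (G q) (G r) M xs half D0' XM.
rewrite -DE; apply: le_trans z_count _; rewrite ler_pM2l // ler_nat.
have M0 : (0 < M)%nat by move: (box1 p); rewrite /M; clear; lia.
have MR : 0 < M%:R :> R by rewrite ltr0n.
have idx (t : 'I_A * 'I_B) : exists g, g \in fine_points F /\
    (2 * M%:Z * lo1 + g.1%:Z, 2 * M%:Z * lo2 + g.2%:Z) = z t.1 t.2.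
  have [al [be [ga [al0 be0 ga0 s1 zE]]]] := z_in t.1 t.2.
  have range (a b c lo : int) (L : nat) (y : int) : lo <= a < lo + L%:Z -> lo <= b < lo + L%:Z ->
      lo <= c < lo + L%:Z -> y%:~R = 2 * M%:R * (al * a%:~R + be * b%:~R + ga * c%:~R) :> R ->
      exists g : 'I_(2 * M * L), 2 * M%:Z * lo + g%:Z = y.
    move=> /andP[a1 a2] /andP[b1 b2] /andP[c1 c2] yE.
    have y1 : 2 * M%:Z * lo <= y.
      rewrite -(ler_int R) yE !intrM -!mulrA ler_pM2l // ler_pM2l //.
      have -> : lo%:~R = al * lo%:~R + be * lo%:~R + ga * lo%:~R :> R by rewrite -!mulrDl s1 mul1r.
      by rewrite !lerD // ler_pM2l // ler_int.
    have y2 : y < 2 * M%:Z * (lo + L%:Z).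
      rewrite -(ltr_int R) yE !intrM -!mulrA ltr_pM2l // ltr_pM2l //.
      have -> : (lo + L%:Z)%:~R = al * (lo + L%:Z)%:~R + be * (lo + L%:Z)%:~R + ga * (lo + L%:Z)%:~R :> R.
        by rewrite -!mulrDl s1 mul1r.
      by rewrite !ltrD // ltr_pM2l // ltr_int.
    have y0 : 0 <= y - 2 * M%:Z * lo by rewrite subr_ge0.
    have [g gE] : exists g : nat, y - 2 * M%:Z * lo = g%:Z.
      by case: (y - 2 * M%:Z * lo) y0 => [g|//] _; exists g.
    have gL : (g < 2 * M * L)%nat.
      have : g%:Z < 2 * M%:Z * L%:Z by rewrite -gE ltrBlDl -mulrDr.
      by rewrite -!PoszM.
    by exists (Ordinal gL); rewrite /= -gE addrC subrK.
  move: zE; case zt : (z t.1 t.2) => [x y] [xE yE].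
  have [g1 g1E] := range _ _ _ _ _ _ (box1 p) (box1 q) (box1 r) xE.
  have [g2 g2E] := range _ _ _ _ _ _ (box2 p) (box2 q) (box2 r) yE.
  exists (g1, g2); rewrite /= g1E g2E; split=> //.
  apply/in_fine_points.
  have := @face_triangle_interior _ G F p q r al be ga scF pP qP rP D0' al0 be0 ga0 s1.
  congr (F _); rewrite /fine_point /= g1E g2E xE yE /=.
  by congr pair; rewrite mulrAC divff ?mul1r // mulf_neq0 // gt_eqF.
have [phi phiP] := choice idx.
have phi_inj : injective phi.
  move=> [i j] [i' j'] E; have [_ E1] := phiP (i, j); have [_ E2] := phiP (i', j').
  by move: E2; rewrite -E E1 /= => /z_inj[-> ->].
have : phi @: [set: 'I_A * 'I_B]%SET \subset fine_points F.
  by apply/fintype.subsetP => _ /imsetP[t _ ->]; exact: (phiP t).1.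
by move=> /subset_leq_card; rewrite card_imset // cardsT card_prod !card_ord.
Qed.

Lemma fine_points_face e F k : face e G F -> strictly_convex_face G F ->
  #|face_vertices G F| = k -> leq 8 k ->
  (2 * M%:R) ^+ 2 * k%:R ^+ 3 <= 16 * 20 ^+ 3 * #|fine_points F|%:R :> R.
Proof.
move=> faceF scF Pk k8; pose q := (k %/ 4).-1.
have [u [v [w [uP vP wP D]]]] : exists u v w, [/\ u \in face_vertices G F, v \in face_vertices G F,
    w \in face_vertices G F & 27 * q%:R ^+ 3 <= 125 * `|cr (pt G u) (pt G v) (pt G w)|].
  have k4 : leq (4 * q + 4)%nat #|face_vertices G F| by rewrite Pk /q; lia.
  exact: (@big_triangle R _ _ G q G_inj (face_convex_position G_inj scF) k4).
(* [k <= 4 * q + 7] and [q >= 1]. The constant [20 ^ 3] then bounds [11 ^ 3 * 125 / 27]. *)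
have kq : (k <= 11 * q)%nat by rewrite /q; lia.
have q1 : (1 <= q)%nat by rewrite /q; lia.
have qR : 1 <= q%:R :> R by rewrite ler1n.
have k3 : k%:R ^+ 3 <= 1331 * q%:R ^+ 3 :> R.
  have -> : 1331 * q%:R ^+ 3 = (11 * q%:R) ^+ 3 :> R by ring.
  by rewrite lerXn2r ?nnegrE ?mulr_ge0 // -natrM ler_nat.
have q3 : 1 <= q%:R ^+ 3 :> R by rewrite exprn_ege1.
have D0 : cr (pt G u) (pt G v) (pt G w) != 0.
  by rewrite -normr_gt0; lra.
have := fine_points_triangle scF uP vP wP D0.
have N0 : 0 <= (2 * M%:R) ^+ 2 :> R by rewrite sqr_ge0.
set N2 := (2 * M%:R) ^+ 2 in N0 *; set D1 := `|cr _ _ _| in D *.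
have kD : k%:R ^+ 3 <= 20 ^+ 3 * D1 by lra.
move=> ND; apply: le_trans (ler_wpM2l N0 kD) _.
have -> : 16 * 20 ^+ 3 * #|fine_points F|%:R = 20 ^+ 3 * (16 * #|fine_points F|%:R) :> R by ring.
by rewrite mulrCA ler_pM2l // exprn_gt0.
Qed.

(** Double counting: faces are connected components, so a grid point is in at most one of them. *)
Lemma fine_points_disjoint_sum e (I : finType) (A : {set I}) (F : I -> set (R * R)) :
  (forall i, i \in A -> face e G (F i)) ->
  (forall i j, i \in A -> j \in A -> F i = F j -> i = j) ->
  (\sum_(i in A) #|fine_points (F i)| <= (2 * M * W) * (2 * M * H))%nat.
Proof.
move=> faceF F_inj.
have -> : (\sum_(i in A) #|fine_points (F i)| = \sum_g \sum_(i in A) (g \in fine_points (F i)))%nat.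
  rewrite exchange_big /=; apply: eq_bigr => i _.
  by rewrite -sum1_card big_mkcond /=; apply: eq_bigr => g _; case: (g \in _).
have -> : ((2 * M * W) * (2 * M * H) = \sum_(g : 'I_(2 * M * W) * 'I_(2 * M * H)) 1)%nat.
  by rewrite sum1_card card_prod !card_ord.
apply: leq_sum => g _.
case: (pickP [pred i in A | g \in fine_points (F i)]) => [i /andP[iA gi]|none]; last first.
  by rewrite big1 // => i iA; have := none i; rewrite /= iA /= => ->.
rewrite (bigD1 i) //= gi big1 // => j /andP[jA ji].
apply/eqP; rewrite eqb0; apply: contra ji => gj; apply/eqP; apply: F_inj => //.
move: gi gj => /in_fine_points gi /in_fine_points gj.
exact: (face_eq (faceF j jA) (faceF i iA) gj gi).
Qed.
End GridCount.

(** * The area bound *)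

(* The bound [1 / 64] serves for [k < 8]. A [k]-gon contains a triangle of double area at least
   [(k / 20) ^ 3], hence at least [(k / 20) ^ 3 / 16] times the number of grid points per unit area. *)
Definition area_constant (F : realFieldType) (alpha : F) := Num.min (1 / 64) (alpha / (16 * 20 ^+ 3)).

Theorem theorem8 :
  forall alpha : R, 0 < alpha ->
  exists c : R, 0 < c /\
  forall (k n : nat), leq 3 k -> leq 1 n ->
  forall (e : rel 'I_n) (sigma : {perm 'I_n}),
    outerplane e sigma ->
    alpha * n%:R / k%:R <= (num_internal_faces_of_size e sigma k)%:R ->
  forall G : 'I_n -> int * int,
    grid_drawing G -> internally_strictly_convex e G ->
    c * n%:R * (k%:R ^+ 2) <= (area G)%:~R.
Proof.
move=> alpha alpha0; exists (area_constant alpha); rewrite /area_constant; set K := 16 * 20 ^+ 3.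
have K0 : 0 < K by rewrite mulr_gt0 ?exprn_gt0.
split; first by rewrite lt_min !divr_gt0.
move=> k n k3 n1 e sigma outer count G G_inj convexG.
have enum_nil (f : 'I_n -> int) : [seq f v | v <- enum 'I_n] <> [::].
  by move=> /(congr1 size); rewrite size_map size_enum_ord /=; lia.
have mem_seq (f : 'I_n -> int) v : f v \in [seq f v | v <- enum 'I_n].
  by apply: map_f; rewrite mem_enum.
have [lo1 [W [WE box1]]] := coord_spanP (enum_nil (fun v => (G v).1)).
have [lo2 [H [HE box2]]] := coord_spanP (enum_nil (fun v => (G v).2)).
have {}box1 v : lo1 <= (G v).1 < lo1 + W%:Z by apply: box1; exact: mem_seq (fun v => (G v).1) v.
have {}box2 v : lo2 <= (G v).2 < lo2 + H%:Z by apply: box2; exact: mem_seq (fun v => (G v).2) v.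
have areaE : (area G)%:~R = (W * H)%:R :> R by rewrite /area /width /height WE HE.
rewrite areaE.
have [k8|k7] := leqP 8 k; last first.
  have nWH : n%:R <= (W * H)%:R :> R by rewrite ler_nat; exact: vertices_le_area G_inj box1 box2.
  have kk : k%:R ^+ 2 <= 64 :> R.
    have -> : 64 = 8 ^+ 2 :> R by ring.
    by rewrite lerXn2r ?nnegrE // ler_nat ltnW.
  apply: le_trans nWH; rewrite -mulrA.
  apply: (@le_trans _ _ (1 / 64 * (n%:R * 64))).
    apply: ler_pM; rewrite ?mulr_ge0 ?exprn_ge0 //.
    - by rewrite le_min !divr_ge0 // ltW.
    - by rewrite ge_min lexx.
    - by rewrite ler_wpM2l.
  by rewrite mulrCA div1r mulVf ?mulr1.
pose A := [set S : {set 'I_n} | `[< internal_face e sigma S >] && (#|S| == k)]%SET.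
have cardA : num_internal_faces_of_size e sigma k = #|A|.
  by apply: eq_card => S; apply/idP/idP; [move=> /set_mem h | move=> h; apply/mem_set; move: h];
    rewrite inE.
have AP S : S \in A -> internal_face e sigma S /\ #|S| = k.
  by rewrite inE => /andP[/asboolP fS /eqP kS].
have [F FP] : exists F : {set 'I_n} -> set (R * R), forall S, S \in A ->
    [/\ face e G (F S), strictly_convex_face G (F S) & face_vertices G (F S) = S].
  have ex S : exists F : set (R * R), S \in A ->
      [/\ face e G F, strictly_convex_face G F & face_vertices G F = S].
    case: (boolP (S \in A)) => [SA|_]; last by exists set0.
    have [F FP] := internal_face_drawn outer G_inj convexG (AP S SA).1.
    by exists F.
  by have [F FP] := choice ex; exists F.
have W0 : (0 < W)%nat by have := box1 (Ordinal n1); lia.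
have N20 : 0 < (2 * (4 * W)%:R) ^+ 2 :> R by rewrite exprn_gt0 // mulr_gt0 // ltr0n muln_gt0.
have N2E : (2 * (4 * W)%:R) ^+ 2 * (W * H)%:R = ((2 * (4 * W) * W) * (2 * (4 * W) * H))%:R :> R.
  by rewrite !natrM; ring.
have face_count S : S \in A ->
    (2 * (4 * W)%:R) ^+ 2 * k%:R ^+ 3 <= K * #|fine_points lo1 lo2 W H (F S)|%:R.
  move=> SA; have [fF sF vF] := FP S SA.
  apply: (fine_points_face G_inj box1 box2 fF sF) => //.
  by rewrite vF (AP S SA).2.
set N2 := (2 * _) ^+ 2 in N20 N2E face_count.
have sum1 : #|A|%:R * (N2 * k%:R ^+ 3) <= K * (N2 * (W * H)%:R).
  have -> : #|A|%:R * (N2 * k%:R ^+ 3) = \sum_(S in A) (N2 * k%:R ^+ 3).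
    by rewrite sumr_const mulr_natl.
  apply: (@le_trans _ _ (\sum_(S in A) K * #|fine_points lo1 lo2 W H (F S)|%:R)).
    by apply: ler_sum => S SA; exact: face_count.
  rewrite -mulr_sumr ler_pM2l // -natr_sum.
  rewrite N2E ler_nat; apply: (@fine_points_disjoint_sum n G lo1 lo2 W H e) => [S SA|S S' SA S'A E].
    by have [] := FP S SA.
  (* Distinct internal faces are drawn as distinct faces, since [S] is recovered as the vertex set
     of [F S]. *)
  by have [_ _ <-] := FP S SA; have [_ _ <-] := FP S' S'A; rewrite E.
have kR : 0 < k%:R :> R by rewrite ltr0n; lia.
have sum2 : #|A|%:R * k%:R ^+ 3 <= K * (W * H)%:R.
  by rewrite -(ler_pM2l N20) mulrCA [X in _ <= X]mulrCA.
have count' : alpha * n%:R * k%:R ^+ 2 <= #|A|%:R * k%:R ^+ 3.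
  have -> : alpha * n%:R * k%:R ^+ 2 = alpha * n%:R / k%:R * k%:R ^+ 3 by field; rewrite gt_eqF.
  by rewrite ler_pM2r ?exprn_gt0 // -cardA.
apply: (@le_trans _ _ (alpha / K * n%:R * k%:R ^+ 2)).
  by rewrite ler_wpM2r ?exprn_ge0 // ler_wpM2r // ge_min lexx orbT.
have -> : alpha / K * n%:R * k%:R ^+ 2 = alpha * n%:R * k%:R ^+ 2 / K by field; rewrite gt_eqF.
by rewrite ler_pdivrMr // [X in _ <= X]mulrC; exact: le_trans count' sum2.
Qed.
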